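(* Let $d\ge 1$, let $\alpha,\beta$ be positive constants, and let $\{X_t,t\ge 0\}$ be the super-Brownian motion on $\mathbb{R}^d$ corresponding to the operator $\frac12\Delta u+\beta u-\alpha u^2$. Let $x\in\mathbb{R}^d$. Then for every relatively compact Borel subset $B$ of $\mathbb{R}^d$ with positive Lebesgue measure whose boundary has zero Lebesgue measure, we have, $\mathbb{P}_{\delta_x}$-almost surely, $$\lim_{t\to\infty}\frac{X_t(B)}{\mathbb{E}_{\delta_x}[X_t(B)]}=W(0),$$ where $W(0)$ is the $\mathbb{P}_{\delta_x}$-almost sure limit of $e^{-\beta t}\langle X_t,1\rangle$ as $t\to\infty$.
   Context: $M_F(\mathbb{R}^d)$ is the space of finite Borel measures on $\mathbb{R}^d$ with the topology of weak convergence, and $\langle\mu,f\rangle=\langle f,\mu\rangle=\int f\,d\mu$. Let $P_t$ be the transition semigroup of standard Brownian motion on $\mathbb{R}^d$ (generator $\frac12\Delta$) and $P_t^\beta=e^{\beta t}P_t$. The super-Brownian motion on $\mathbb{R}^d$ corresponding to the operator $\frac12\Delta u+\beta u-\alpha u^2$ is the time-homogeneous càdlàg $M_F(\mathbb{R}^d)$-valued Markov process $\{X_t,t\ge0\}$, with laws $\mathbb{P}_\mu$ for $\mu\in M_F(\mathbb{R}^d)$ (under $\mathbb{P}_\mu$, $X_0=\mu$), such that for every bounded non-negative Borel function $f$, $$\mathbb{E}_\mu[e^{-\langle f,X_t\rangle}]=e^{-\langle u(t,\cdot),\mu\rangle},$$ where $\mathbb{E}_\mu$ is expectation under $\mathbb{P}_\mu$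 and $u$ is the unique solution of $u(t,x)+\int_0^t P^\beta_{t-s}(\alpha\, u(s,\cdot)^2)(x)\,ds=P_t^\beta f(x)$. $\delta_x$ is the unit mass at $x$. *)

(* Defs.v *)
From HB Require Import structures.
From mathcomp Require Import all_boot all_order all_algebra.
From mathcomp Require Import all_classical all_reals all_analysis.
From mathcomp Require Import measurable_realfun.

Set Implicit Arguments.
Unset Strict Implicit.
Unset Printing Implicit Defensive.

Import Order.TTheory GRing.Theory Num.Theory.
Import numFieldNormedType.Exports.

Local Open Scope classical_set_scope.
Local Open Scope ring_scope.

Definition mx_borel_display : measure_display.
Proof. by constructor. Qed.

Section mx_borel.
Variables (R : realType) (m n : nat).

Definition mx_borel : set (set 'M[R]_(m, n)) := <<s open >>.

Let mx_borel0 : mx_borel set0.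
Proof. exact: sigma_algebra0. Qed.

Let mx_borelC (A : set 'M[R]_(m, n)) : mx_borel A -> mx_borel (~` A).
Proof. exact: sigma_algebraC. Qed.

Let mx_borel_bigcup (F : (set 'M[R]_(m, n))^nat) :
  (forall i, mx_borel (F i)) -> mx_borel (\bigcup_i F i).
Proof. exact: sigma_algebra_bigcup. Qed.

HB.instance Definition _ := @isMeasurable.Build mx_borel_display
  'M[R]_(m, n) mx_borel mx_borel0 mx_borelC mx_borel_bigcup.

End mx_borel.

Section rV_measurability.
Variable R : realType.

Lemma measurable_rV_coord n (i : 'I_n) :
  measurable_fun [set: 'rV[R]_n] (fun v => v ord0 i).
Proof.
apply: (measurability _ (RGenOpens.measurableE R)) => _ [_ [a [b ->] <-]].
rewrite setTI; apply: sub_gen_smallest.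
by apply: open_comp; [move=> v _; exact: coord_continuous|exact: interval_open].
Qed.

Let rat_ball n (q : 'rV[rat]_n * nat) : set 'rV[R]_n :=
  ball (map_mx ratr q.1 : 'rV[R]_n) q.2.+1%:R^-1.

Let open_rV_cover n (U : set 'rV[R]_n) : open U ->
  U = \bigcup_(q in [set q | rat_ball q `<=` U]) rat_ball q.
Proof.
move=> oU; apply/seteqP; split => [v Uv|v [q qU]]; last exact: qU.
have [e e0 veU] : exists2 e : R, 0 < e & ball v e `<=` U.
  by move: oU; rewrite openE => /(_ _ Uv) /nbhs_ballP[e /= e0 ?]; exists e.
have [k ke] : exists k : nat, k.+1%:R^-1 + k.+1%:R^-1 <= e :> R.
  exists (Num.trunc (2 / e)).
  rewrite -mulr2n -[leLHS]mulr_natl ler_pdivrMr ?ltr0n// mulrC -ler_pdivrMr//.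
  by apply/ltW; rewrite truncnS_gt// divr_ge0// ltW.
have k0 : 0 < k.+1%:R^-1 :> R by rewrite invr_gt0 ltr0n.
have /choice[q vq] : forall i, exists q : rat, ball (v ord0 i) k.+1%:R^-1 (ratr q).
  move=> i; have /rat_in_itvoo[q /itvP qv] :
    v ord0 i - k.+1%:R^-1 < v ord0 i + k.+1%:R^-1.
    by rewrite ltrBlDr -addrA ltrDl addr_gt0.
  by exists q; rewrite /ball/= distrC ltr_distl !qv.
have vqk : ball (map_mx ratr (\row_i q i) : 'rV[R]_n) k.+1%:R^-1 v.
  by split => // i j; rewrite !mxE (ord1 i); exact: ball_sym.
exists (\row_i q i, k) => //= w qw; apply: veU.
by apply: (le_ball ke); apply: ball_triangle qw; exact: ball_sym.
Qed.

Lemma measurable_fun_rV d (T : measurableType d) n (f : T -> 'rV[R]_n) :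
  (forall i, measurable_fun [set: T] (fun t => f t ord0 i)) ->
  measurable_fun [set: T] f.
Proof.
move=> mf; apply: (measurability _ (erefl (@measurable _ 'rV[R]_n))) => _ [U oU <-].
rewrite setTI (open_rV_cover oU) preimage_bigcup.
rewrite bigcup_mkcond; apply: countable_bigcupT_measurable => [|[q k]].
  exact: countableP.
case: ifPn => // _.
have -> : f @^-1` rat_ball (q, k) =
    \bigcap_(i in [set: 'I_n])
      (fun t => f t ord0 i) @^-1` ball (ratr (q ord0 i) : R) k.+1%:R^-1.
  apply/seteqP; split => [t [_ qft] i _|t qft].
    by have := qft ord0 i; rewrite mxE.
  split=> [|i j]; first by rewrite invr_gt0 ltr0n.
  by rewrite mxE (ord1 i); exact: qft.
apply: fin_bigcap_measurable => [|i _]; first exact: finite_finset.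
rewrite -[X in measurable X]setTI; apply: mf => //.
exact: measurable_ball.
Qed.

End rV_measurability.

Section lebesgue_rV.
Variable R : realType.

Definition rV_cons n (p : R * 'rV[R]_n) : 'rV[R]_n.+1 :=
  \row_i oapp (p.2 ord0) p.1 (unlift ord0 i).

Let rV_cons0 n (p : R * 'rV[R]_n) : rV_cons p ord0 ord0 = p.1.
Proof. by rewrite mxE unlift_none. Qed.

Let rV_consS n (p : R * 'rV[R]_n) i :
  rV_cons p ord0 (lift ord0 i) = p.2 ord0 i.
Proof. by rewrite mxE liftK. Qed.

Lemma measurable_rV_cons n : measurable_fun setT (@rV_cons n).
Proof.
apply: measurable_fun_rV => i; case: (unliftP ord0 i) => [j|] ->.
  under eq_fun do rewrite rV_consS.
  exact: (measurableT_comp (measurable_rV_coord j) measurable_snd).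
by under eq_fun do rewrite rV_cons0; exact: measurable_fst.
Qed.

Let rV_uncons n (v : 'rV[R]_n.+1) : R * 'rV[R]_n :=
  (v ord0 ord0, \row_i v ord0 (lift ord0 i)).

Let measurable_rV_uncons n : measurable_fun setT (@rV_uncons n).
Proof.
apply: measurable_fun_pair; first exact: measurable_rV_coord.
apply: measurable_fun_rV => i; under eq_fun do rewrite mxE.
exact: measurable_rV_coord.
Qed.

Let rV_consK n : cancel (@rV_cons n) (@rV_uncons n).
Proof.
move=> [a v]; rewrite /rV_uncons rV_cons0; congr pair.
by apply/rowP => i; rewrite mxE rV_consS.
Qed.

Section step.
Variables (n : nat) (mu : {sigma_finite_measure set 'rV[R]_n -> \bar R}).

Definition lebesgue_rV_succ : set 'rV[R]_n.+1 -> \bar R :=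
  pushforward (lebesgue_measure \x mu)%E (@rV_cons n).

Let lebesgue_rV_succ0 : lebesgue_rV_succ set0 = 0%E.
Proof. by rewrite /lebesgue_rV_succ /pushforward preimage_set0 measure0. Qed.

Let lebesgue_rV_succ_ge0 A : (0 <= lebesgue_rV_succ A)%E.
Proof. by rewrite /lebesgue_rV_succ /pushforward measure_ge0. Qed.

Let lebesgue_rV_succ_sigma_additive : semi_sigma_additive lebesgue_rV_succ.
Proof.
have mcons A : measurable A -> measurable (@rV_cons n @^-1` A).
  by move=> mA; rewrite -[X in measurable X]setTI; exact: measurable_rV_cons.
move=> F mF tF mUF; rewrite /lebesgue_rV_succ /pushforward preimage_bigcup.
apply: measure_semi_sigma_additive => [k| |].
- exact: mcons.
- apply/trivIsetP => i j _ _ ij; rewrite -preimage_setI.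
  by move/trivIsetP : tF => /(_ _ _ _ _ ij) ->//; rewrite preimage_set0.
- by rewrite -preimage_bigcup; exact: mcons.
Qed.

HB.instance Definition _ := isMeasure.Build _ _ _ lebesgue_rV_succ
  lebesgue_rV_succ0 lebesgue_rV_succ_ge0 lebesgue_rV_succ_sigma_additive.

Let lebesgue_rV_succ_sigma_finite : sigma_finite setT lebesgue_rV_succ.
Proof.
have /sigma_finiteP[F [FT ndF Foo]] := sigma_finiteT (@lebesgue_measure R).
have /sigma_finiteP[G [GT ndG Goo]] := sigma_finiteT mu.
have FGT : \bigcup_k (F k `*` G k) = setT.
  rewrite -setXTT FT GT; apply/seteqP; split=> [[x y] [k _ [Fx Gy]]|[x y]].
    by split; exists k.
  move=> [[k _ Fx] [l _ Gy]]; exists (maxn k l) => //; split.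
    by have /subsetPset := ndF _ _ (leq_maxl k l); exact.
  by have /subsetPset := ndG _ _ (leq_maxr k l); exact.
exists (fun k => @rV_uncons n @^-1` (F k `*` G k)).
  by rewrite -preimage_bigcup FGT.
move=> k; have [mF ltF] := Foo k; have [mG ltG] := Goo k; split.
  rewrite -[X in measurable X]setTI; apply: measurable_rV_uncons => //.
  exact: measurableX.
rewrite /lebesgue_rV_succ /pushforward -comp_preimage.
rewrite (_ : _ \o _ = id); last by apply/funext => p; exact: rV_consK.
by rewrite preimage_id product_measure1E// lte_mul_pinfty// ge0_fin_numE.
Qed.

HB.instance Definition _ := Measure_isSigmaFinite.Build _ _ _ lebesgue_rV_succ
  lebesgue_rV_succ_sigma_finite.

End step.

(* Lebesgue measure on R^n, as the n-fold product of the one on R.            *)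
Fixpoint lebesgue_rV n : {sigma_finite_measure set 'rV[R]_n -> \bar R} :=
  if n is n'.+1 then lebesgue_rV_succ (lebesgue_rV n')
  else \d_(0 : 'rV[R]_0).

Lemma lebesgue_rV_box n (A : 'I_n -> set R) : (forall i, measurable (A i)) ->
  lebesgue_rV n [set v | forall i, A i (v ord0 i)] =
  (\prod_(i < n) lebesgue_measure (A i))%E.
Proof.
elim: n A => [|n IHn] A mA.
  by rewrite big_ord0/= diracE mem_set// => -[].
rewrite big_ord_recl -IHn; last by move=> i; exact: mA.
rewrite -product_measure1E; last 2 first.
- exact: mA.
- rewrite [X in measurable X](_ : _ = \bigcap_(i in [set: 'I_n])
      ((fun v : 'rV[R]_n => v ord0 i) @^-1` A (lift ord0 i))).
    apply: fin_bigcap_measurable => [|i _]; first exact: finite_finset.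
    by rewrite -[X in measurable X]setTI; exact: measurable_rV_coord.
  by apply/seteqP; split=> [v vA i _|v vA i]; exact: vA.
congr (product_measure1 _ _ _).
apply/seteqP; split=> [p pA|p [pA0 pAS] i].
  split=> [|i]; first by have := pA ord0; rewrite rV_cons0.
  by have := pA (lift ord0 i); rewrite rV_consS.
by case: (unliftP ord0 i) => [j|] ->; rewrite ?rV_consS ?rV_cons0.
Qed.

End lebesgue_rV.
Arguments lebesgue_rV {R} n.

Section finite_measures.
Variables (R : realType) (d : nat).

Definition MF : Type := {finite_measure set 'rV[R]_d -> \bar R}.

HB.instance Definition _ := gen_eqMixin MF.
HB.instance Definition _ := gen_choiceMixin MF.
HB.instance Definition _ := isPointed.Build MF mzero.

Definition Cb : Type :=
  {g : 'rV[R]_d -> R | continuous g /\ bounded_fun g}.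

Definition MF_pairing (mu : MF) : {ptws Cb -> R} :=
  fun g => \int[mu]_y sval g y.

(* The topology of weak convergence is the coarsest one for which all the     *)
(* maps mu |-> \int g dmu, with g bounded and continuous, are continuous.     *)
HB.instance Definition _ := Topological.copy MF (initial_topology MF_pairing).

Lemma MF_cvgP (F : set_system MF) {FF : Filter F} (mu : MF) :
  F --> mu <-> forall g : Cb,
    \int[nu]_y sval g y @[nu --> F] --> \int[mu]_y sval g y.
Proof.
split=> [Fmu g|Fmu A].
  have /(cvg_comp _ _ Fmu)/cvg_sup/(_ g) Fg : MF_pairing @ mu --> MF_pairing mu.
    exact: initial_continuous.
  have eval_g := @initial_continuous _ _ (fun h : {ptws Cb -> R} => h g)
    (MF_pairing mu).
  exact: cvg_comp _ _ Fg eval_g.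
rewrite nbhsE => -[U [[V oV <-] Vmu]] VA.
have /(_ V) FV : MF_pairing @ F --> MF_pairing mu.
  apply/cvg_sup => g B; rewrite nbhsE => -[W [[Q oQ <-] Qmu]] QB.
  have /(Fmu g) : nbhs (\int[mu]_y sval g y) Q by exact: open_nbhs_nbhs.
  by apply: (@filterS _ F) => nu Qnu; exact: QB.
have /FV : nbhs (MF_pairing mu) V by exact: open_nbhs_nbhs.
by apply: (@filterS _ F) => nu Vnu; exact: VA.
Qed.

Definition MF_borel : set (set MF) := <<s open >>.

Let MF_borel0 : MF_borel set0.
Proof. exact: sigma_algebra0. Qed.

Let MF_borelC (A : set MF) : MF_borel A -> MF_borel (~` A).
Proof. exact: sigma_algebraC. Qed.

Let MF_borel_bigcup (F : (set MF)^nat) :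
  (forall i, MF_borel (F i)) -> MF_borel (\bigcup_i F i).
Proof. exact: sigma_algebra_bigcup. Qed.

Definition MF_borel_display : measure_display.
Proof. by constructor. Qed.

HB.instance Definition _ := @isMeasurable.Build MF_borel_display MF
  MF_borel MF_borel0 MF_borelC MF_borel_bigcup.

End finite_measures.
Arguments MF : clear implicits.

Section brownian_semigroup.
Variables (R : realType) (d : nat).

Definition heat_kernel (t : R) (x y : 'rV[R]_d) : R :=
  (2 * pi * t) `^ (- (d%:R / 2)) *
  expR (- (\sum_(i < d) (x ord0 i - y ord0 i) ^+ 2) / (2 * t)).

Definition brownian_semigroup (t : R) (f : 'rV[R]_d -> R) (x : 'rV[R]_d) :
    \bar R :=
  if t == 0 then (f x)%:E
  else (\int[lebesgue_rV d]_y (heat_kernel t x y * f y)%:E)%E.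

Definition growth_semigroup (beta t : R) (f : 'rV[R]_d -> R) (x : 'rV[R]_d) :
    \bar R :=
  ((expR (beta * t))%:E * brownian_semigroup t f x)%E.

End brownian_semigroup.

Section super_brownian_motion.
Variables (R : realType) (d : nat) (alpha beta : R).

(* Mild form of du/dt = (1/2) Laplacian u + beta u - alpha u^2, u(0) = f; only *)
(* the values u t x with 0 <= t matter.                                       *)
Definition log_laplace_solution (f : 'rV[R]_d -> R) (u : R -> 'rV[R]_d -> R) :=
  [/\ forall t x, 0 <= t -> 0 <= u t x,
      measurable_fun ([set p | 0 <= p.1] : set (R * 'rV[R]_d))
        (fun p : R * 'rV[R]_d => u p.1 p.2) &
      forall t x, 0 <= t ->
        ((u t x)%:E +
         \int[lebesgue_measure]_(s in `[0%R, t])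
           growth_semigroup beta (t - s) (fun y => alpha * u s y ^+ 2)%R x
         = growth_semigroup beta t f x)%E].

Definition unique_log_laplace_solution (f : 'rV[R]_d -> R)
    (u : R -> 'rV[R]_d -> R) :=
  log_laplace_solution f u /\
  forall v, log_laplace_solution f v ->
    forall t x, 0 <= t -> v t x = u t x.

(* Times range over the nonnegative elements of R; the values of X at         *)
(* negative times are unconstrained.                                          *)
Section process.
Context {dO : measure_display} {Omega : measurableType dO}.
Variables (X : R -> Omega -> MF R d).

Definition natural_filtration (t : R) : set (set Omega) :=
  <<s [set A | exists s G, [/\ 0 <= s, s <= t, measurable G
                             & A = X s @^-1` G]] >>.

Definition cadlag (path : R -> MF R d) :=
  (forall t, 0 <= t -> path s @[s --> t^'+] --> path t) /\
  (forall t, 0 < t -> exists mu : MF R d, path s @[s --> t^'-] --> mu).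

(* P is the family of laws of X. Measures being functions on all sets, the    *)
(* initial condition X_0 = mu is equality on Borel sets.                      *)
Record super_brownian_motion (P : MF R d -> probability Omega R) : Prop := {
  sbm_measurable : forall t, 0 <= t -> measurable_fun [set: Omega] (X t) ;
  sbm_cadlag : forall w, cadlag (X ^~ w) ;
  sbm_start : forall mu : MF R d,
    {ae P mu, forall w, forall B, measurable B -> X 0 w B = mu B} ;
  sbm_measurable_law : forall t (G : set (MF R d)), 0 <= t -> measurable G ->
    measurable_fun [set: MF R d] (fun mu => P mu (X t @^-1` G)) ;
  sbm_markov : forall (mu : MF R d) s t A (G : set (MF R d)),
    0 <= s -> 0 <= t -> natural_filtration s A -> measurable G ->
    P mu (A `&` X (s + t) @^-1` G) =
    (\int[P mu]_(w in A) P (X s w) (X t @^-1` G))%E ;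
  sbm_log_laplace : forall f : 'rV[R]_d -> R,
    measurable_fun [set: 'rV[R]_d] f -> (forall x, 0 <= f x) ->
    bounded_fun f ->
    exists2 u, unique_log_laplace_solution f u &
    forall t (mu : MF R d), 0 <= t ->
      'E_(P mu)[fun w => expR (- \int[X t w]_y f y)]%E =
      (expR (- \int[mu]_y u t y))%:E
}.

End process.
End super_brownian_motion.

(* Main.v *)
(* For a Lipschitz [f >= 0] with bounded support and a terminal time [T], the
   process [t |-> e^(-beta t) <P_(T-t) f, X_t>] is a martingale whose increments
   after time [s] have variance at most a polynomial in [T] times [e^(-beta s)];
   the moments come from the log-Laplace functional near [theta = 0]. By Doob's
   inequality, right-continuity and the Borel-Cantelli lemma, for
   [n^4 <= t < (n+1)^4] the quantity [e^(-beta t) <f, X_t>] differs from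
   [e^(-beta n) <P_(T-n) f, X_n>], with [T] a grid point just after [t], by
   [o(t^(-d/2))]. As [r] grows, the Gaussian averages [g_r = (2 pi r)^(d/2) P_r f]
   increase to [I = \int f], and [e^(-beta n) <I - g_r, X_n>], which is
   nonnegative and decreasing in [r], has a summable mean for [r = n^4 - n].
   Hence [(2 pi t)^(d/2) e^(-beta t) <f, X_t>] tends to [I W]. Sandwiching the
   indicator of [B] between such functions [f] gives the same limit for [X_t(B)],
   with [I] replaced by [|B|], and [(2 pi t)^(d/2) P_t 1_B x] tends to [|B|]. *)
Require Import Defs.
From mathcomp Require Import all_boot all_order all_algebra.
From mathcomp Require Import all_classical all_reals all_analysis.
From mathcomp Require Import measurable_realfun ring lra.

Set Implicit Arguments.
Unset Strict Implicit.
Unset Printing Implicit Defensive.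

Import Order.TTheory GRing.Theory Num.Theory.
Import numFieldNormedType.Exports.

Local Open Scope classical_set_scope.
Local Open Scope ring_scope.

(** The limit must hold along all real times, whereas each probabilistic estimate concerns one
    terminal time [T], so the failure probability has to beat the number of terminal times in a
    block. Starting the martingale at time [n] achieves this: the variance carries
    [expR (- beta * n)], while a block ending at [n.+1 ^+ 4] costs only powers of [n]. At the same
    time [n] is negligible against [n ^+ 4], so the heat kernel over the remaining time is nearly
    flat where the measure at time [n] lives and sees only its mass. The exponent 4 leaves errors of
    order [n ^- 3] and [n ^- 4], which are summable, and turns [(n^4)^(d/2)] into the integer power
    [n^(2d)]. Lipschitz functions enter because [T - t] is positive, though below the mesh: the heat
    flow over that time must move [f] little, uniformly in space. The process is given only by its
    log-Laplace functional, the Markov property and right-continuous paths; even the semigroup law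
    of the heat kernel is extracted from these. Total mass is the case [f = 1], in which smoothing
    costs nothing, so the same estimate also produces [W]. *)

Section nonneg_real_integrals.
Context {R : realType} d (T : measurableType d) (mu : {measure set T -> \bar R}).
Implicit Types (D : set T) (f g : T -> R).

Lemma ge0_integralZ_EFin D f (k : R) : measurable D -> measurable_fun D f ->
  (forall x, 0 <= f x) -> 0 <= k ->
  (\int[mu]_(x in D) (k * f x)%:E = k%:E * \int[mu]_(x in D) (f x)%:E)%E.
Proof.
move=> mD mf f0 k0; rewrite -ge0_integralZl//;
  first [exact/measurable_EFinP | by move=> x _; rewrite lee_fin].
Qed.

Lemma ge0_integralD_EFin D f g : measurable D ->
  measurable_fun D f -> measurable_fun D g ->
  (forall x, 0 <= f x) -> (forall x, 0 <= g x) ->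
  (\int[mu]_(x in D) (f x + g x)%:E =
   \int[mu]_(x in D) (f x)%:E + \int[mu]_(x in D) (g x)%:E)%E.
Proof.
move=> mD mf mg f0 g0; rewrite -ge0_integralD//;
  first [exact/measurable_EFinP | by move=> x _; rewrite lee_fin].
Qed.

Lemma ge0_le_integral_EFin D f g : measurable D ->
  measurable_fun D f -> measurable_fun D g ->
  (forall x, 0 <= f x) -> (forall x, D x -> f x <= g x) ->
  (\int[mu]_(x in D) (f x)%:E <= \int[mu]_(x in D) (g x)%:E)%E.
Proof.
move=> mD mf mg f0 fg; apply: ge0_le_integral => //;
  first [exact/measurable_EFinP | by move=> x Dx; rewrite lee_fin// fg].
Qed.

End nonneg_real_integrals.

(** * Gaussian integrals over row vectors *)

Section gaussian.
Context {R : realType}.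

Definition gauss_exp d (t : R) (x y : 'rV[R]_d) : R :=
  expR (- (\sum_(i < d) (x ord0 i - y ord0 i) ^+ 2) / (2 * t)).

Lemma measurable_gauss_exp d (t : R) :
  measurable_fun setT (fun p : 'rV[R]_d * 'rV[R]_d => gauss_exp t p.1 p.2).
Proof.
apply: measurableT_comp => //; apply: measurable_funM => //.
apply: measurableT_comp => //; apply: measurable_sum => i.
apply: measurable_funX; apply: measurable_funB.
  exact: (measurableT_comp (measurable_rV_coord i) measurable_fst).
exact: (measurableT_comp (measurable_rV_coord i) measurable_snd).
Qed.

Lemma measurable_gauss_expr d (t : R) (x : 'rV[R]_d) :
  measurable_fun setT (gauss_exp t x).
Proof.
exact: (measurableT_comp (@measurable_gauss_exp d t) (pair1_measurable x)).
Qed.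

Lemma measurable_gauss_exprE d (t : R) (x : 'rV[R]_d) :
  measurable_fun setT (fun y => (gauss_exp t x y)%:E).
Proof. by apply/measurable_EFinP; exact: measurable_gauss_expr. Qed.

(** Tonelli through the pushforward that defines [lebesgue_rV n.+1]; Gaussian integrals can then be
    computed one coordinate at a time. *)
Lemma ge0_integral_lebesgue_rVS n (F : 'rV[R]_n.+1 -> \bar R) :
  measurable_fun setT F -> (forall y, (0 <= F y)%E) ->
  (\int[lebesgue_rV n.+1]_y F y =
   \int[lebesgue_measure]_a \int[lebesgue_rV n]_v F (rV_cons (a, v)))%E.
Proof.
move=> mF F0.
have mF' : measurable_fun setT (F \o @rV_cons R n).
  exact: (measurableT_comp mF (@measurable_rV_cons R n)).
transitivity (\int[lebesgue_measure \x lebesgue_rV n]_p (F \o @rV_cons R n) p)%E;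
  last by rewrite fubini_tonelli1// => p; exact: F0.
rewrite -[X in _ = (\int[_]_(_ in X) _)%E](preimage_setT (@rV_cons R n)).
pose mu : {measure set (measurableTypeR R * 'rV[R]_n) -> \bar R} :=
  (lebesgue_measure \x lebesgue_rV n)%E.
have mc : measurable_fun (setT : set (measurableTypeR R * 'rV[R]_n)) (@rV_cons R n).
  exact: measurable_rV_cons.
transitivity (\int[pushforward mu (@rV_cons R n)]_y F y)%E; last first.
  apply: (ge0_integral_pushforward mc mu measurableT mF) => y _.
  exact: F0.
exact: eq_measure_integral.
Qed.

Lemma measurable_gauss1 (t a : R) :
  measurable_fun [set: R] (fun b => expR (- (a - b) ^+ 2 / (2 * t))).
Proof.
apply: measurableT_comp => //; apply: measurable_funM => //.
by apply: measurableT_comp => //; apply: measurable_funX; exact: measurable_funB.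
Qed.

(** The normal density of mean [a] and standard deviation [Num.sqrt t] has integral one, so only its
    normalising constant has to be identified. *)
Lemma integral_gauss1 (t a : R) : 0 < t ->
  (\int[lebesgue_measure]_b (expR (- (a - b) ^+ 2 / (2 * t)))%:E =
   ((2 * pi * t) `^ (2^-1))%:E)%E.
Proof.
move=> t0; pose s := Num.sqrt t.
have s2 : s ^+ 2 = t by rewrite sqr_sqrtr// ltW.
have s0 : s != 0 by rewrite gt_eqF// sqrtr_gt0.
have pk : normal_peak s = (2 * pi * t) `^ (- 2^-1).
  rewrite /normal_peak s2 powRN powR12_sqrt; last first.
    by rewrite !mulr_ge0// ?pi_ge0// ltW.
  by congr ((Num.sqrt _)^-1); rewrite -mulr_natl mulrA mulrAC -mulrA.
have p0 : 0 < 2 * pi * t by rewrite !mulr_gt0// pi_gt0.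
have := integral_normal_pdf a s.
rewrite normal_pdfE//= => H.
transitivity (((2 * pi * t) `^ (2^-1))%:E *
    \int[lebesgue_measure]_b (normal_peak s * normal_fun a s b)%:E)%E; last first.
  by rewrite H mule1.
rewrite -ge0_integralZ_EFin//; last 3 first.
- rewrite -[X in measurable_fun _ X](normal_pdfE _ s0).
  exact: measurable_normal_pdf.
- by move=> b; rewrite mulr_ge0 ?normal_peak_ge0 ?expR_ge0.
- exact: powR_ge0.
apply: eq_integral => b _; congr EFin.
rewrite mulrA pk -powRD; last by rewrite (gt_eqF p0) implybT.
rewrite subrr powRr0 mul1r /normal_fun s2 -sqrrN opprB.
by rewrite -[X in _ = expR (_ / X)]mulr_natl.
Qed.

Lemma integral_gauss_exp d (t : R) (x : 'rV[R]_d) : 0 < t ->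
  (\int[lebesgue_rV d]_y (gauss_exp t x y)%:E = ((2 * pi * t) `^ (d%:R / 2))%:E)%E.
Proof.
move=> t0; have p0 : 0 < 2 * pi * t by rewrite !mulr_gt0// pi_gt0.
elim: d x => [|n IHn] x.
  rewrite /= integral_dirac//; last exact: measurable_gauss_exprE.
  by rewrite diracE mem_set// mul1e /gauss_exp big_ord0 oppr0 !mul0r expR0 powRr0.
rewrite ge0_integral_lebesgue_rVS//; last 2 first.
- exact: measurable_gauss_exprE.
- by move=> y; rewrite lee_fin expR_ge0.
have [x' xE] : exists x' : 'rV[R]_n, forall b v, gauss_exp t x (rV_cons (b, v)) =
    expR (- (x ord0 ord0 - b) ^+ 2 / (2 * t)) * gauss_exp t x' v.
  exists (\row_i x ord0 (lift ord0 i)) => b v.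
  rewrite /gauss_exp big_ord_recl opprD mulrDl expRD.
  rewrite [rV_cons (b, v) ord0 ord0]mxE unlift_none /=.
  under eq_bigr do rewrite [rV_cons (b, v) ord0 _]mxE liftK /=.
  by under [in RHS]eq_bigr do rewrite mxE.
transitivity (\int[lebesgue_measure]_b
    ((2 * pi * t) `^ (n%:R / 2) *
     (expR (- (x ord0 ord0 - b) ^+ 2 / (2 * t))))%:E)%E.
  apply: eq_integral => b _; rewrite mulrC EFinM -(IHn x') -ge0_integralZ_EFin//;
    [|exact: measurable_gauss_expr|by move=> y; exact: expR_ge0].
  apply: eq_integral => v _; congr EFin.
  exact: xE.
rewrite ge0_integralZ_EFin//;
  [|exact: measurable_gauss1|exact: powR_ge0].
rewrite integral_gauss1// -EFinM -powRD; last by rewrite (gt_eqF p0) implybT.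
by congr ((_ `^ _)%:E); rewrite -[n.+1%:R]natr1 mulrDl mul1r.
Qed.

End gaussian.

Lemma bernoulli_ineq (R : realFieldType) (q : R) n :
  0 <= q -> q <= 1 -> 1 - n%:R * (1 - q) <= q ^+ n.
Proof.
move=> q0 q1; elim: n => [|n IHn]; first by rewrite mul0r subr0 expr0.
have h : q * (1 - n%:R * (1 - q)) <= q ^+ n.+1 by rewrite exprS ler_wpM2l.
apply: le_trans h; rewrite -natr1 -subr_ge0.
have -> : q * (1 - n%:R * (1 - q)) - (1 - (n%:R + 1) * (1 - q)) =
  n%:R * (1 - q) ^+ 2 by ring.
by rewrite mulr_ge0// sqr_ge0.
Qed.

(** The bound [K] stays explicit because the variance estimates are quadratic in it; together with
    nonnegativity it also makes every pairing with a finite measure finite. *)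
Definition bounded_borel (R : realType) d (K : R) (f : 'rV[R]_d -> R) :=
  measurable_fun [set: 'rV[R]_d] f /\ forall x, 0 <= f x <= K.

(** * The heat semigroup on bounded Borel functions *)

Section heat_semigroup.
Context {R : realType} {d : nat}.
Implicit Types (f g : 'rV[R]_d -> R) (x y : 'rV[R]_d) (t T K L eta : R).

(** [fine] sends an infinite integral to 0; by [brownian_semigroupE] nothing is lost for
    [bounded_borel] functions and [0 <= t], and the arithmetic stays in [R]. *)
Definition heat t f x : R := fine (brownian_semigroup t f x).

Lemma bounded_borel_ge0 K f : bounded_borel K f -> forall x, 0 <= f x.
Proof. by move=> [_ fK] x; have /andP[] := fK x. Qed.

Lemma bounded_borel_le K f : bounded_borel K f -> forall x, f x <= K.
Proof. by move=> [_ fK] x; have /andP[] := fK x. Qed.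

Lemma bounded_borel_bound K f : bounded_borel K f -> 0 <= K.
Proof. by move=> [_ /(_ 0)/andP[/le_trans]]; exact. Qed.

Lemma bounded_borel_cst K : 0 <= K -> bounded_borel K (cst K : 'rV[R]_d -> R).
Proof. by move=> K0; split=> // x; rewrite K0 lexx. Qed.

Lemma heat_kernelE t x y :
  heat_kernel t x y = (2 * pi * t) `^ (- (d%:R / 2)) * gauss_exp t x y.
Proof. by []. Qed.

Lemma heat_kernel_ge0 t x y : 0 <= heat_kernel t x y.
Proof. by rewrite heat_kernelE mulr_ge0 ?powR_ge0// expR_ge0. Qed.

Lemma measurable_heat_kernel t :
  measurable_fun setT (fun p : 'rV[R]_d * 'rV[R]_d => heat_kernel t p.1 p.2).
Proof.
by apply: measurable_funM; [exact: measurable_cst|exact: measurable_gauss_exp].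
Qed.

Lemma measurable_heat_kernelr t x : measurable_fun setT (heat_kernel t x).
Proof.
by apply: measurable_funM; [exact: measurable_cst|exact: measurable_gauss_expr].
Qed.

Lemma integral_heat_kernel t x : 0 < t ->
  (\int[lebesgue_rV d]_y (heat_kernel t x y)%:E = 1)%E.
Proof.
move=> t0; have p0 : 0 < 2 * pi * t by rewrite !mulr_gt0// pi_gt0.
under eq_integral do rewrite heat_kernelE.
rewrite ge0_integralZ_EFin//; [|exact: measurable_gauss_expr|
  by move=> y; exact: expR_ge0|exact: powR_ge0].
rewrite integral_gauss_exp// -EFinM -powRD; last by rewrite (gt_eqF p0) implybT.
by rewrite addNr powRr0.
Qed.

(** Both Gaussians are centred at [x], so their product is again one: the inverse variances add,
    which gives [s = t * T / (T + t)]. *)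
Lemma integral_heat_gauss t T x : 0 < t -> 0 < T ->
  (\int[lebesgue_rV d]_y (heat_kernel t x y * gauss_exp T x y)%:E =
   ((T / (T + t)) `^ (d%:R / 2))%:E)%E.
Proof.
move=> t0 T0; have p0 : 0 < 2 * pi * t by rewrite !mulr_gt0// pi_gt0.
pose s := t * T / (T + t).
have s0 : 0 < s by rewrite divr_gt0 ?mulr_gt0// addr_gt0.
transitivity (\int[lebesgue_rV d]_y
    ((2 * pi * t) `^ (- (d%:R / 2)) * gauss_exp s x y)%:E)%E.
  apply: eq_integral => y _; congr EFin; rewrite heat_kernelE -mulrA; congr (_ * _).
  rewrite /gauss_exp -expRD; congr expR; rewrite /s; field.
  by rewrite !gt_eqF// addr_gt0.
rewrite ge0_integralZ_EFin//; [|exact: measurable_gauss_expr|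
  by move=> y; exact: expR_ge0|exact: powR_ge0].
rewrite integral_gauss_exp// -EFinM; congr EFin.
have -> : 2 * pi * s = (2 * pi * t) * (T / (T + t)).
  by rewrite /s; field; rewrite gt_eqF// addr_gt0.
rewrite [X in _ * X]powRM ?(ltW p0)//; last by rewrite ltW// divr_gt0// addr_gt0.
rewrite mulrA -powRD; last by rewrite (gt_eqF p0) implybT.
by rewrite addNr powRr0 mul1r.
Qed.

Lemma brownian_semigroupE t f x K : 0 <= t -> bounded_borel K f ->
  brownian_semigroup t f x = (heat t f x)%:E /\ 0 <= heat t f x <= K.
Proof.
move=> t0 fK; have f0 := bounded_borel_ge0 fK; have fle := bounded_borel_le fK.
have mf := fK.1.
rewrite /heat /brownian_semigroup; case: eqVneq => [_|tn0].
  by split => //=; rewrite f0 fle.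
have {tn0}t0 : 0 < t by rewrite lt0r tn0.
have h0 y : 0 <= heat_kernel t x y * f y by rewrite mulr_ge0 ?heat_kernel_ge0.
have I0 : (0 <= \int[lebesgue_rV d]_y (heat_kernel t x y * f y)%:E)%E.
  by apply: integral_ge0 => y _; rewrite lee_fin.
have IK : (\int[lebesgue_rV d]_y (heat_kernel t x y * f y)%:E <= K%:E)%E.
  rewrite -[K%:E]mule1 -(integral_heat_kernel x t0) -ge0_integralZ_EFin//;
    [|exact: measurable_heat_kernelr|by move=> y; exact: heat_kernel_ge0|
     exact: bounded_borel_bound fK].
  apply: ge0_le_integral_EFin => //.
  - by apply: measurable_funM => //; exact: measurable_heat_kernelr.
  - by apply: measurable_funM => //; exact: measurable_heat_kernelr.
  - by move=> y _; rewrite mulrC ler_wpM2r ?heat_kernel_ge0.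
have fin : (\int[lebesgue_rV d]_y (heat_kernel t x y * f y)%:E)%E \is a fin_num.
  by rewrite ge0_fin_numE// (le_lt_trans IK)// ltry.
rewrite fineK//; split => //.
by rewrite -!lee_fin fineK// I0 IK.
Qed.

Lemma heat0 f x : heat 0 f x = f x.
Proof. by rewrite /heat /brownian_semigroup eqxx. Qed.

Lemma heatE t f x K : 0 < t -> bounded_borel K f ->
  (heat t f x)%:E = (\int[lebesgue_rV d]_y (heat_kernel t x y * f y)%:E)%E.
Proof.
move=> t0 fK; have [<- _] := brownian_semigroupE x (ltW t0) fK.
by rewrite /brownian_semigroup gt_eqF.
Qed.

Lemma heat_cst t K x : 0 <= t -> 0 <= K -> heat t (cst K) x = K.
Proof.
move=> t0 K0; move: t0; rewrite le_eqVlt => /predU1P[<-|t0]; first by rewrite heat0.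
apply: EFin_inj; rewrite (heatE x t0 (bounded_borel_cst K0)).
under eq_integral do rewrite mulrC.
rewrite ge0_integralZ_EFin//; [|exact: measurable_heat_kernelr|
  by move=> y; exact: heat_kernel_ge0].
by rewrite integral_heat_kernel// mule1.
Qed.

Lemma measurable_heat t f K : 0 <= t -> bounded_borel K f ->
  measurable_fun setT (heat t f).
Proof.
move=> t0 fK; move: t0; rewrite le_eqVlt => /predU1P[<-|t0].
  by rewrite (_ : heat 0 f = f); [exact: fK.1|apply/funext => x; rewrite heat0].
apply/measurable_EFinP.
rewrite (_ : _ \o _ = fubini_F (lebesgue_rV d)
  (fun p : 'rV[R]_d * 'rV[R]_d => (heat_kernel t p.1 p.2 * f p.2)%:E)); last first.
  by apply/funext => x /=; rewrite (heatE x t0 fK).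
apply: measurable_fun_fubini_tonelli_F.
- apply/measurable_EFinP; apply: measurable_funM; first exact: measurable_heat_kernel.
  exact: (measurableT_comp fK.1 measurable_snd).
- move=> p; rewrite lee_fin mulr_ge0 ?heat_kernel_ge0//.
  exact: bounded_borel_ge0 fK _.
Qed.

Lemma bounded_borel_heat t f K : 0 <= t -> bounded_borel K f ->
  bounded_borel K (heat t f).
Proof.
move=> t0 fK; split; first exact: measurable_heat fK.
by move=> x; have [] := brownian_semigroupE x t0 fK.
Qed.

Lemma bounded_borelD f g K L : bounded_borel K f -> bounded_borel L g ->
  bounded_borel (K + L) (f \+ g).
Proof.
move=> fK gL; split; first exact: measurable_funD fK.1 gL.1.
move=> x /=; rewrite addr_ge0 ?(bounded_borel_ge0 fK) ?(bounded_borel_ge0 gL)//=.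
by rewrite lerD// ?(bounded_borel_le fK) ?(bounded_borel_le gL).
Qed.

Lemma bounded_borelZ f k K : 0 <= k -> bounded_borel K f ->
  bounded_borel (k * K) (fun x => k * f x).
Proof.
move=> k0 fK; split; first by apply: measurable_funM; [exact: measurable_cst|exact: fK.1].
move=> x /=; rewrite mulr_ge0 ?(bounded_borel_ge0 fK)//=.
by rewrite ler_wpM2l// (bounded_borel_le fK).
Qed.

Lemma bounded_borelB f K : bounded_borel K f -> bounded_borel K (fun x => K - f x).
Proof.
move=> fK; split; first exact: measurable_funB (@measurable_cst _ _ _ _ _ K) fK.1.
move=> x; rewrite subr_ge0 (bounded_borel_le fK)/= gerBl.
exact: bounded_borel_ge0 fK _.
Qed.

Lemma bounded_borel_gauss_exp t x : 0 < t -> bounded_borel 1 (gauss_exp t x).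
Proof.
move=> t0; split; first exact: measurable_gauss_expr.
move=> y; rewrite expR_ge0 /= -expR0 ler_expR mulNr oppr_le0 mulr_ge0//.
  by apply: sumr_ge0 => i _; exact: sqr_ge0.
by rewrite invr_ge0 mulr_ge0// ltW.
Qed.

Lemma heatD t f g x K L : 0 <= t -> bounded_borel K f -> bounded_borel L g ->
  heat t (f \+ g) x = heat t f x + heat t g x.
Proof.
move=> t0 fK gL; move: t0; rewrite le_eqVlt => /predU1P[<-|t0]; first by rewrite !heat0.
apply: EFin_inj; rewrite EFinD (heatE x t0 fK) (heatE x t0 gL).
rewrite (heatE x t0 (bounded_borelD fK gL)) -ge0_integralD_EFin//.
- by apply: eq_integral => y _; rewrite mulrDr.
- by apply: measurable_funM; [exact: measurable_heat_kernelr|exact: fK.1].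
- by apply: measurable_funM; [exact: measurable_heat_kernelr|exact: gL.1].
- by move=> y; rewrite mulr_ge0 ?heat_kernel_ge0// (bounded_borel_ge0 fK).
- by move=> y; rewrite mulr_ge0 ?heat_kernel_ge0// (bounded_borel_ge0 gL).
Qed.

Lemma heatZ t f x k K : 0 <= t -> 0 <= k -> bounded_borel K f ->
  heat t (fun y => k * f y) x = k * heat t f x.
Proof.
move=> t0 k0 fK; move: t0; rewrite le_eqVlt => /predU1P[<-|t0]; first by rewrite !heat0.
apply: EFin_inj; rewrite EFinM (heatE x t0 fK).
rewrite (heatE x t0 (bounded_borelZ k0 fK)) -ge0_integralZ_EFin//.
- by apply: eq_integral => y _; rewrite mulrCA.
- by apply: measurable_funM; [exact: measurable_heat_kernelr|exact: fK.1].
- by move=> y; rewrite mulr_ge0 ?heat_kernel_ge0// (bounded_borel_ge0 fK).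
Qed.

Lemma le_heat t f g x K L : 0 <= t -> bounded_borel K f -> bounded_borel L g ->
  (forall y, f y <= g y) -> heat t f x <= heat t g x.
Proof.
move=> t0 fK gL fg; move: t0; rewrite le_eqVlt => /predU1P[<-|t0]; first by rewrite !heat0.
rewrite -lee_fin (heatE x t0 fK) (heatE x t0 gL); apply: ge0_le_integral_EFin => //.
- by apply: measurable_funM; [exact: measurable_heat_kernelr|exact: fK.1].
- by apply: measurable_funM; [exact: measurable_heat_kernelr|exact: gL.1].
- by move=> y; rewrite mulr_ge0 ?heat_kernel_ge0// (bounded_borel_ge0 fK).
- by move=> y _; rewrite ler_wpM2l ?heat_kernel_ge0.
Qed.

Lemma heat_gauss_exp t T x : 0 < t -> 0 < T ->
  heat t (gauss_exp T x) x = (T / (T + t)) `^ (d%:R / 2).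
Proof.
move=> t0 T0; apply: EFin_inj.
by rewrite (heatE x t0 (bounded_borel_gauss_exp x T0)) integral_heat_gauss.
Qed.

(** Since [q <= 1], passing from the exponent [d / 2] to [d] lowers the power, and Bernoulli's
    inequality applies to an integer exponent. Changes of Gaussian normalisation between two times
    are controlled this way. *)
Lemma powR_half_ge (q : R) : 0 < q -> q <= 1 ->
  1 - d%:R * (1 - q) <= q `^ (d%:R / 2).
Proof.
move=> q0 q1; apply: le_trans (bernoulli_ineq d (ltW q0) q1) _.
rewrite -(powR_mulrn d (ltW q0)); apply: (@ger_powR _ q); first by rewrite q0.
by rewrite ler_pdivrMr// ler_peMr// ler1n.
Qed.

(* The indicator of [eta < |x - y|] is at most [2 (1 - gauss_exp T x y)] when
   [T = eta^2 / 2], and the mean of the latter under the heat kernel is explicit. *)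
Lemma heat_sub_lipschitz t eta f x K L : 0 < t -> 0 < eta -> 0 <= L ->
  bounded_borel K f -> (forall y z, `|f y - f z| <= L * `|y - z|) ->
  `|heat t f x - f x| <= L * eta + 4 * K * d%:R * t / eta ^+ 2.
Proof.
move=> t0 eta0 L0 fK fL.
have f0 := bounded_borel_ge0 fK; have fle := bounded_borel_le fK.
have K0 := bounded_borel_bound fK.
pose T := eta ^+ 2 / 2.
have T0 : 0 < T by rewrite divr_gt0// exprn_gt0.
pose g := gauss_exp T x.
have g1 : bounded_borel 1 g by exact: bounded_borel_gauss_exp.
(* The norm on row vectors is the maximum norm, so a single coordinate already exceeds [eta]; as
   [2 * T = eta ^+ 2], the Gaussian is then at most [expR (- 1)], which is below one half. *)
have far y : eta < `|x - y| -> 1 <= 2 * (1 - g y).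
  move=> xy.
  have [|[i j] xyi] := @mx_norm_neq0 _ _ _ (x - y).
    by rewrite gt_eqF// (lt_trans eta0).
  rewrite (ord1 i) /= !mxE in xyi.
  have S : eta ^+ 2 <= \sum_(i < d) (x ord0 i - y ord0 i) ^+ 2.
    rewrite (bigD1 j)//= ler_wpDr ?sumr_ge0// => [k _|]; first exact: sqr_ge0.
    have {}xyi : eta < `|x ord0 j - y ord0 j| by rewrite -[ltRHS]xyi.
    by rewrite -[leRHS]real_normK ?num_real// lerXn2r ?nnegrE// ltW.
  have ge : g y <= expR (- 1).
    rewrite ler_expR mulNr lerN2 ler_pdivlMr ?mul1r; last by rewrite mulr_gt0.
    by rewrite (le_trans _ S)// /T; lra.
  have e2 : expR (-1) <= 2^-1 :> R.
    rewrite expRN lef_pV2 ?posrE ?expR_gt0//.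
    by have := expR_ge1Dx (1 : R); lra.
  by lra.
have cmp y : `|f x - f y| <= L * eta + 2 * K * (1 - g y).
  have [xy|/far xy] := leP `|x - y| eta.
    rewrite (le_trans (fL x y))// ler_wpDr ?ler_wpM2l//.
    by rewrite !mulr_ge0// subr_ge0 (bounded_borel_le g1).
  rewrite ler_wpDl ?mulr_ge0 ?(ltW eta0)// [2 * K]mulrC -mulrA.
  apply: (@le_trans _ _ K); last by rewrite ler_peMr.
  have := f0 x; have := f0 y; have := fle x; have := fle y.
  by rewrite ler_norml; move=> *; apply/andP; split; lra.
have rho : 1 - 2 * d%:R * t / eta ^+ 2 <= heat t g x.
  rewrite /g heat_gauss_exp//; apply: le_trans (powR_half_ge _ _); last 2 first.
  - by rewrite divr_gt0// addr_gt0.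
  - by rewrite ler_pdivrMr ?addr_gt0// mul1r lerDl ltW.
  have -> : 1 - T / (T + t) = t / (T + t) by field; rewrite gt_eqF// addr_gt0.
  have -> : 2 * d%:R * t / eta ^+ 2 = d%:R * (2 * (t / eta ^+ 2)) by ring.
  rewrite lerB// ler_wpM2l//.
  rewrite ler_pdivrMr ?addr_gt0//.
  have -> : 2 * (t / eta ^+ 2) * (T + t) = t + t * (2 * t / eta ^+ 2).
    by rewrite /T; field; rewrite gt_eqF.
  by rewrite lerDl !mulr_ge0 ?invr_ge0 ?sqr_ge0// ltW.
(* [heatD] and [le_heat] concern nonnegative bounded functions, so [cmp] is integrated with
   [2 * K * g] moved to the smaller side instead of subtracted. *)
pose c := L * eta + 2 * K.
have c0 : 0 <= c by rewrite addr_ge0// mulr_ge0// ltW.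
have K20 : 0 <= 2 * K by rewrite mulr_ge0.
have gK := bounded_borelZ K20 g1.
have up : heat t f x + 2 * K * heat t g x <= f x + c.
  rewrite -(heatZ x (ltW t0) K20 g1) -(heatD x (ltW t0) fK gK).
  have fc : 0 <= f x + c by rewrite addr_ge0.
  rewrite -[leRHS](heat_cst x (ltW t0) fc).
  apply: (le_heat x (ltW t0) (bounded_borelD fK gK) (bounded_borel_cst fc)) => y /=.
  by have := cmp y; rewrite ler_norml /c => /andP[? ?]; lra.
have dn : f x + 2 * K * heat t g x <= heat t f x + c.
  rewrite -(heatZ x (ltW t0) K20 g1).
  rewrite -{1}(heat_cst x (ltW t0) (f0 x)) -{1}(heat_cst x (ltW t0) c0).
  have fx := bounded_borel_cst (f0 x); have cc := bounded_borel_cst c0.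
  rewrite -(heatD x (ltW t0) fx gK) -(heatD x (ltW t0) fK cc).
  apply: (le_heat x (ltW t0) (bounded_borelD fx gK) (bounded_borelD fK cc)) => y /=.
  by have := cmp y; rewrite ler_norml /c => /andP[? ?]; lra.
have {rho} : 2 * K * (1 - 2 * d%:R * t / eta ^+ 2) <= 2 * K * heat t g x.
  by rewrite ler_wpM2l.
have -> : 2 * K * (1 - 2 * d%:R * t / eta ^+ 2) =
    2 * K - 4 * K * d%:R * t / eta ^+ 2 by field; rewrite gt_eqF.
by move: up dn; rewrite /c ler_norml => *; apply/andP; split; lra.
Qed.

End heat_semigroup.

(** * Lipschitz approximation of indicators of open sets *)

Section bump.
Context {R : realType} {d : nat}.
Implicit Types (U : set 'rV[R]_d) (k : R) (y z : 'rV[R]_d).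

Let bump_set U k y := [set 1] `|` [set k * `|y - z| | z in ~` U].

(** This is the minimum of 1 and [k] times the distance to the complement of [U]; the singleton
    keeps the set nonempty when [U] is the whole space. *)
Definition bump U k y : R := inf ([set 1] `|` [set k * `|y - z| | z in ~` U]).

Let bump_has_inf U k y : 0 <= k -> has_inf (bump_set U k y).
Proof.
move=> k0; split; first by exists 1; left.
by exists 0 => _ [->//|[z _ <-]]; rewrite mulr_ge0.
Qed.

Lemma bump_le1 U k y : 0 <= k -> bump U k y <= 1.
Proof. by move=> k0; apply: ge_inf; [exact: (bump_has_inf U y k0).2|left]. Qed.

Lemma bump_le_dist U k y z : 0 <= k -> ~ U z -> bump U k y <= k * `|y - z|.
Proof.
move=> k0 Uz; apply: ge_inf; first exact: (bump_has_inf U y k0).2.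
by right; exists z.
Qed.

Lemma le_bump U k y b : 0 <= k -> b <= 1 ->
  (forall z, ~ U z -> b <= k * `|y - z|) -> b <= bump U k y.
Proof.
move=> k0 b1 bz; apply: lb_le_inf; first exact: (bump_has_inf U y k0).1.
by move=> _ [->//|[z Uz <-]]; exact: bz.
Qed.

Lemma bump_ge0 U k y : 0 <= k -> 0 <= bump U k y.
Proof. by move=> k0; apply: le_bump => // z _; rewrite mulr_ge0. Qed.

Lemma bump_out U k y : 0 <= k -> ~ U y -> bump U k y = 0.
Proof.
move=> k0 Uy; apply/eqP; rewrite eq_le bump_ge0// andbT.
by rewrite (le_trans (bump_le_dist y k0 Uy))// subrr normr0 mulr0.
Qed.

Lemma bump_in U k y : 0 <= k -> (forall z, ~ U z -> 1 <= k * `|y - z|) ->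
  bump U k y = 1.
Proof.
by move=> k0 far; apply/eqP; rewrite eq_le bump_le1//= le_bump.
Qed.

Lemma bump_lipschitz U k y z : 0 <= k ->
  `|bump U k y - bump U k z| <= k * `|y - z|.
Proof.
move=> k0; wlog suff H : y z / bump U k y - bump U k z <= k * `|y - z|.
  rewrite ler_norml H andbT lerNl opprB (le_trans (H _ _))//.
  by rewrite distrC.
rewrite lerBlDl -lerBlDr; apply: le_bump => //.
  by rewrite lerBlDr (le_trans (bump_le1 _ _ k0))// lerDl mulr_ge0.
move=> v Uv; rewrite lerBlDr (le_trans (bump_le_dist y k0 Uv))//.
by rewrite -mulrDr ler_wpM2l// [leRHS]addrC; exact: ler_distD.
Qed.

Lemma lipschitz_continuous (f : 'rV[R]_d -> R) (L : R) :
  (forall y z, `|f y - f z| <= L * `|y - z|) -> continuous f.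
Proof.
move=> fL y; apply/(@cvgrPdist_le _ _ _ (nbhs y)) => e e0.
have L10 : 0 < `|L| + 1 by rewrite ltr_wpDl.
near=> z; rewrite (le_trans (fL y z))//.
apply: (@le_trans _ _ ((`|L| + 1) * `|y - z|)).
  by rewrite ler_wpM2r// (le_trans (ler_norm L))// lerDl.
rewrite mulrC -ler_pdivlMr//; near: z.
by apply: cvgr_dist_le; [exact: cvg_id|rewrite divr_gt0].
Unshelve. all: by end_near. Qed.

Lemma continuous_bump U k : 0 <= k -> continuous (bump U k).
Proof. by move=> k0; apply: lipschitz_continuous => y z; exact: bump_lipschitz. Qed.

Lemma continuous_measurable_rV (f : 'rV[R]_d -> R) :
  continuous f -> measurable_fun setT f.
Proof.
move=> cf; apply: (measurability _ (RGenOpens.measurableE R)) => _ [_ [a [b ->] <-]].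
rewrite setTI; apply: sub_gen_smallest.
by apply: open_comp; [move=> v _; exact: cf|exact: interval_open].
Qed.

Lemma bounded_borel_bump U k : 0 <= k -> bounded_borel 1 (bump U k).
Proof.
move=> k0; split; first by apply: continuous_measurable_rV; exact: continuous_bump.
by move=> y; rewrite bump_ge0 ?bump_le1.
Qed.

(** The sequence is eventually constant: inside [U] it equals one as soon as [n] times the radius of
    a ball around [y] contained in [U] reaches one. *)
Lemma cvg_bump U y : open U -> bump U n%:R y @[n --> \oo] --> (\1_U y : R).
Proof.
move=> oU; rewrite indicE; have [Uy|Uy] := pselect (U y); last first.
  rewrite memNset//; apply: cvg_near_cst; apply: nearW => n.
  exact: bump_out.
rewrite mem_set//.
move: oU; rewrite openE => /(_ _ Uy)/nbhs_ballP[e /= e0 yeU].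
apply: cvg_near_cst; near=> n; apply: bump_in => // z Uz.
have ez : e <= `|y - z|.
  by rewrite leNgt; apply/negP => yz; apply: Uz; apply: yeU; rewrite -ball_normE.
apply: (@le_trans _ _ (n%:R * e)); last by rewrite ler_wpM2l.
rewrite -ler_pdivrMr// mul1r; near: n; exact: nbhs_infty_ger.
Unshelve. all: by end_near. Qed.

End bump.

(** * Pairings with finite measures and their measurability *)

Section finite_measure_pairing.
Context {R : realType} {d : nat}.
Implicit Types (nu : MF R d) (f g : 'rV[R]_d -> R) (K L k : R).

Lemma bounded_borel_integrable nu f K : bounded_borel K f ->
  nu.-integrable setT (EFin \o f).
Proof.
move=> fK; apply: measurable_bounded_integrable => //; [exact: fin_num_fun_lty|exact: fK.1|].
exists K; split; first exact: num_real.
move=> M KM x _ /=; rewrite ger0_norm ?(bounded_borel_ge0 fK)//.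
by rewrite (le_trans (bounded_borel_le fK _))// ltW.
Qed.

Lemma pairingE nu f K : bounded_borel K f ->
  (\int[nu]_y (f y)%:E = (\int[nu]_y f y)%R%:E)%E.
Proof.
move=> fK; rewrite /Rintegral fineK//.
exact: integrable_fin_num (bounded_borel_integrable nu fK).
Qed.

Lemma dirac_pairing x f K : bounded_borel K f ->
  \int[\d_x : MF R d]_y f y = f x.
Proof.
move=> fK; apply: EFin_inj; rewrite -(pairingE (\d_x : MF R d) fK).
rewrite integral_dirac//; last by apply/measurable_EFinP; exact: fK.1.
by rewrite diracT mul1e.
Qed.

Lemma pairing_ge0 nu f K : bounded_borel K f -> 0 <= \int[nu]_y f y.
Proof. by move=> fK; apply: Rintegral_ge0 => y _; exact: bounded_borel_ge0 fK y. Qed.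

Lemma le_pairing nu f g K L : bounded_borel K f -> bounded_borel L g ->
  (forall y, f y <= g y) -> \int[nu]_y f y <= \int[nu]_y g y.
Proof.
move=> fK gL fg; apply: le_Rintegral => //.
- exact: bounded_borel_integrable fK.
- exact: bounded_borel_integrable gL.
Qed.

Lemma pairingD nu f g K L : bounded_borel K f -> bounded_borel L g ->
  \int[nu]_y (f y + g y) = \int[nu]_y f y + \int[nu]_y g y.
Proof.
move=> fK gL; apply: RintegralD => //.
- exact: bounded_borel_integrable fK.
- exact: bounded_borel_integrable gL.
Qed.

Lemma pairingB nu f g K L : bounded_borel K f -> bounded_borel L g ->
  \int[nu]_y (f y - g y) = \int[nu]_y f y - \int[nu]_y g y.
Proof.
move=> fK gL; apply: RintegralB => //.
- exact: bounded_borel_integrable fK.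
- exact: bounded_borel_integrable gL.
Qed.

Lemma pairingZ nu f k K : bounded_borel K f ->
  \int[nu]_y (k * f y) = k * \int[nu]_y f y.
Proof. by move=> fK; apply: RintegralZl => //; exact: bounded_borel_integrable fK. Qed.

Lemma pairing_cst nu k : \int[nu]_y k = k * \int[nu]_y 1.
Proof. by rewrite !Rintegral_cst// mul1r. Qed.

Lemma pairing_indic nu (B : set 'rV[R]_d) : measurable B ->
  \int[nu]_y (\1_B y : R) = fine (nu B).
Proof. by move=> mB; rewrite /Rintegral integral_indic// setIT. Qed.

Lemma bounded_borel_indic (B : set 'rV[R]_d) : measurable B ->
  bounded_borel 1 (\1_B : 'rV[R]_d -> R).
Proof.
move=> mB; split; first exact: measurable_indic.
by move=> y; rewrite indicE ler0n lern1 leq_b1.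
Qed.

Lemma cvg_pairing_bump nu (U : set 'rV[R]_d) : open U ->
  \int[nu]_y bump U n%:R y @[n --> \oo] --> fine (nu U).
Proof.
move=> oU.
have mU : measurable U by exact: sub_gen_smallest.
rewrite -(pairing_indic nu mU).
have b1 (n : nat) : bounded_borel 1 (bump U n%:R : 'rV[R]_d -> R).
  exact: bounded_borel_bump.
apply: fine_cvg; rewrite /= -(pairingE nu (bounded_borel_indic mU)).
have [] := @dominated_convergence _ _ _ nu setT measurableT
    (fun n y => (bump U n%:R y)%:E) (fun y => (\1_U y)%:E) (fun=> 1%E).
- by move=> n; apply/measurable_EFinP; exact: (b1 n).1.
- by apply/measurable_EFinP; exact: measurable_indic.
- by apply: aeW => y _; apply: cvg_EFin; [exact: nearW|exact: cvg_bump].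
- exact: (bounded_borel_integrable nu (bounded_borel_cst ler01)).
- apply: aeW => y n _; rewrite lee_fin ger0_norm ?(bounded_borel_ge0 (b1 n))//.
  exact: bounded_borel_le (b1 n) _.
by [].
Qed.

Lemma continuous_measurable_MF (F : MF R d -> R) :
  continuous F -> measurable_fun setT F.
Proof.
move=> cF; apply: (measurability _ (RGenOpens.measurableE R)) => _ [_ [a [b ->] <-]].
rewrite setTI; apply: sub_gen_smallest.
by apply: open_comp; [move=> v _; exact: cF|exact: interval_open].
Qed.

Lemma measurable_MF_pairing_Cb (g : Cb R d) :
  measurable_fun setT (fun nu : MF R d => \int[nu]_y sval g y).
Proof.
apply: continuous_measurable_MF => nu.
by apply: (@MF_cvgP R d (nbhs nu) _ nu).1; exact: cvg_id.
Qed.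

(** The sigma-algebra on [MF] is generated by weakly open sets, so at first only pairings with [Cb]
    functions are measurable. Bumps carry this to open sets, which form a pi-system, and Dynkin
    induction reaches all Borel sets; finiteness of [nu] settles complements. *)
Lemma measurable_MF_eval (B : set 'rV[R]_d) : measurable B ->
  measurable_fun setT (fun nu : MF R d => nu B).
Proof.
have cst1 : continuous (cst 1 : 'rV[R]_d -> R) /\ bounded_fun (cst 1 : 'rV[R]_d -> R).
  by split; [exact: cst_continuous|exact: bounded_cst].
have meval (A : set 'rV[R]_d) : measurable A ->
    measurable_fun setT (fun nu : MF R d => fine (nu A)) ->
    measurable_fun setT (fun nu : MF R d => nu A).
  move=> mA mf; rewrite (_ : (fun nu : MF R d => nu A) = EFin \o (fun nu : MF R d => fine (nu A))).
    exact/measurable_EFinP.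
  by apply/funext => nu /=; rewrite fineK// fin_num_measure.
have mT : measurable_fun setT (fun nu : MF R d => nu setT).
  apply: meval => //.
  rewrite (_ : (fun nu : MF R d => fine (nu setT)) =
      (fun nu : MF R d => \int[nu]_y sval (exist _ _ cst1 : Cb R d) y)).
    exact: measurable_MF_pairing_Cb.
  by apply/funext => nu /=; rewrite Rintegral_cst// mul1r.
move=> mB.
apply: (@dynkin_induction _ 'rV[R]_d open
  (fun B => measurable_fun setT (fun nu : MF R d => nu B))) => //.
- by move=> U V; exact: openI.
- move=> U oU; apply: meval; first exact: sub_gen_smallest.
  have cb (n : nat) : continuous (bump U n%:R) /\ bounded_fun (bump U n%:R).
    split; first exact: continuous_bump.
    exists 1; split; first exact: num_real.
    move=> M M1 y _ /=; rewrite ger0_norm ?bump_ge0//.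
    by rewrite (le_trans (bump_le1 _ _ _))// ltW.
  apply: (@measurable_fun_cvg _ _ _ setT (fun n nu => \int[nu]_y bump U n%:R y)).
    by move=> n; exact: (measurable_MF_pairing_Cb (exist _ _ (cb n))).
  by move=> nu _; exact: cvg_pairing_bump.
- move=> S mS mfS.
  rewrite (_ : (fun nu : MF R d => nu (~` S)) = (fun nu : MF R d => nu setT - nu S)%E).
    exact: emeasurable_funB.
  apply/funext => nu; rewrite -setTD measureD ?setTI//.
  exact: fin_num_fun_lty.
- move=> F mF tF mfF.
  rewrite (_ : (fun nu : MF R d => nu _) = (fun nu : MF R d => \sum_(i <oo) nu (F i))%E).
    by apply: ge0_emeasurable_sum => // *; exact: measure_ge0.
  by apply/funext => nu; rewrite measure_bigcup//; apply: eq_eseriesl => k; exact: mem_set.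
Qed.

(** By [measurable_MF_eval] the identity map is a kernel from [MF] to row vectors, and integrals
    against a kernel are measurable. *)
Lemma measurable_MF_integral f K : bounded_borel K f ->
  measurable_fun setT (fun nu : MF R d => \int[nu]_y (f y)%:E)%E.
Proof.
move=> fK.
apply: (@measurable_fun_integral_kernel _ _ (MF R d) 'rV[R]_d R (fun nu : MF R d => nu)).
- by move=> B mB; exact: measurable_MF_eval.
- by move=> y; rewrite lee_fin (bounded_borel_ge0 fK).
- by apply/measurable_EFinP; exact: fK.1.
Qed.

Lemma measurable_MF_pairing f K : bounded_borel K f ->
  measurable_fun setT (fun nu : MF R d => \int[nu]_y f y).
Proof.
move=> fK; apply/measurable_EFinP.
rewrite (_ : _ \o _ = (fun nu : MF R d => \int[nu]_y (f y)%:E)%E).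
  exact: measurable_MF_integral fK.
by apply/funext => nu /=; rewrite (pairingE nu fK).
Qed.

End finite_measure_pairing.

(** * Fatou and monotonicity bounds *)

Section integral_bounds.
Context {R : realType} d (T : measurableType d) (mu : {measure set T -> \bar R}).

Lemma fatou_le (D : set T) (f_ : (T -> \bar R)^nat) (f : T -> \bar R)
    (b : (\bar R)^nat) (c : \bar R) :
  measurable D -> (forall n, measurable_fun D (f_ n)) ->
  (forall n x, D x -> (0 <= f_ n x)%E) ->
  (forall x, D x -> f_ ^~ x @ \oo --> f x) ->
  (forall n, (\int[mu]_(x in D) f_ n x <= b n)%E) -> b @ \oo --> c ->
  (\int[mu]_(x in D) f x <= c)%E.
Proof.
move=> mD mf f0 fcvg fb bc.
have -> : (\int[mu]_(x in D) f x = \int[mu]_(x in D) limn_einf (f_ ^~ x))%E.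
  apply: eq_integral => x; rewrite inE => Dx.
  rewrite is_cvg_limn_einfE; last by apply/cvg_ex; exists (f x); exact: fcvg.
  by apply/esym/cvg_lim => //; exact: fcvg.
apply: le_trans (fatou mu mD mf f0) _.
rewrite limn_einf_lim -(cvg_lim _ bc)//; apply: lee_lim.
- exact: is_cvg_einfs.
- by apply/cvg_ex; exists c.
- apply: nearW => n; apply: le_trans (fb n).
  by apply: ereal_inf_lbound; exists n => //=.
Qed.

(** The integral of a nonnegative function is a supremum over the simple functions below it, which
    is monotone by itself. This serves the time integral of the mild equation, whose integrand would
    otherwise have to be proved measurable in time. *)
Lemma ge0_le_integral_nomeas (D : set T) (f g : T -> \bar R) :
  (forall x, D x -> (0 <= f x)%E) -> (forall x, D x -> (f x <= g x)%E) ->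
  (\int[mu]_(x in D) f x <= \int[mu]_(x in D) g x)%E.
Proof.
move=> f0 fg.
have g0 x : D x -> (0 <= g x)%E by move=> Dx; rewrite (le_trans (f0 x Dx))// fg.
rewrite !ge0_integralE//; apply: le_ereal_sup => _ [h hf <-].
exists h => //= x; rewrite (le_trans (hf x))//.
rewrite /patch; case: ifPn => // /set_mem Dx; exact: fg.
Qed.

End integral_bounds.

(** * First and second moments from a Laplace transform *)

Section laplace_transform.
Context {R : realType}.

Lemma one_sub_expRN_le (y : R) : 1 - expR (- y) <= y.
Proof. by have := expR_ge1Dx (- y); lra. Qed.

Lemma expR_sub1_le (y : R) : expR y - 1 <= y * expR y.
Proof.
have := ler_wpM2r (expR_ge0 y) (one_sub_expRN_le y).
by rewrite mulrBl -expRD addNr expR0 mul1r.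
Qed.

Lemma one_sub_expRN_ge (y : R) : 0 <= y -> y / (1 + y) <= 1 - expR (- y).
Proof.
move=> y0; have y1 : 0 < 1 + y by rewrite ltr_pwDl.
have : expR (- y) <= (1 + y)^-1.
  by rewrite expRN lef_pV2 ?posrE ?expR_gt0//; exact: expR_ge1Dx.
have -> : y / (1 + y) = 1 - (1 + y)^-1 by field; rewrite gt_eqF.
by lra.
Qed.

Lemma cvg_harmonicM (c : R) : c * (n.+1%:R)^-1 @[n --> \oo] --> (0 : R).
Proof.
rewrite -[X in _ --> X](mulr0 c); apply: cvgM; first exact: cvg_cst.
exact: cvg_harmonic.
Qed.

Lemma cvg_laplace_quotient (y : R) : 0 <= y ->
  (1 - expR (- (n.+1%:R^-1 * y))) / n.+1%:R^-1 @[n --> \oo] --> y.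
Proof.
move=> y0; apply: (@squeeze_cvgr _ _ _ _ (fun n => y / (1 + y * n.+1%:R^-1)) (cst y)).
- apply: nearW => n.
  have n0 : 0 < n.+1%:R^-1 :> R by rewrite invr_gt0.
  apply/andP; split.
    rewrite ler_pdivlMr// mulrAC [y * _]mulrC; apply: one_sub_expRN_ge.
    by rewrite mulr_ge0// ltW.
  by rewrite ler_pdivrMr// [leRHS]mulrC one_sub_expRN_le.
- rewrite -[X in _ --> X]divr1; apply: cvgM; first exact: cvg_cst.
  apply: cvgV; first by rewrite oner_neq0.
  rewrite -[X in _ --> X]addr0; apply: cvgD; first exact: cvg_cst.
  exact: cvg_harmonicM.
- exact: cvg_cst.
Qed.

Context d (T : measurableType d) (P : probability T R).

(* Second moments come from the elementary identity
   [((1 - e^(-ty)) / t)^2 = (1 - 2 e^(-ty) + e^(-2ty)) / t^2]. *)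
Lemma moments_of_laplace (Y : T -> R) (m v : R) :
  measurable_fun setT Y -> (forall w, 0 <= Y w) -> 0 <= m -> 0 <= v ->
  (forall t : R, 0 < t -> exists2 U : R, t * m - t ^+ 2 * v <= U <= t * m &
    (\int[P]_w (expR (- (t * Y w)))%:E = (expR (- U))%:E)%E) ->
  (\int[P]_w (Y w)%:E = m%:E)%E /\ (\int[P]_w (Y w ^+ 2)%:E <= (m ^+ 2 + 4 * v)%:E)%E.
Proof.
move=> mY Y0 m0 v0 L.
have int1 : (\int[P]_w 1 = 1)%E.
  by rewrite integral_cst// mul1e; exact: probability_setT.
have mexp t : measurable_fun setT (fun w => expR (- (t * Y w))).
  by apply: measurableT_comp => //; apply: measurableT_comp => //; exact: measurable_funM.
pose t_ n : R := n.+1%:R^-1.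
have t0 n : 0 < t_ n by rewrite invr_gt0.
have L1 (t : R) : 0 < t -> exists2 U : R, t * m - t ^+ 2 * v <= U <= t * m &
    (\int[P]_w (1 - expR (- (t * Y w)))%:E = (1 - expR (- U))%:E)%E.
  move=> t1; have [U Um UE] := L t t1; exists U => //.
  have e1 w : expR (- (t * Y w)) <= 1.
    by rewrite -expR0 ler_expR oppr_le0 mulr_ge0// ltW.
  have : (\int[P]_w (1 - expR (- (t * Y w)) + expR (- (t * Y w)))%:E = 1)%E.
    by under eq_integral do rewrite subrK.
  rewrite ge0_integralD_EFin//; last 2 first.
  - exact: measurable_funB.
  - by move=> w; rewrite subr_ge0.
  rewrite UE EFinB => <-; rewrite addeK//.
pose Z n w := (1 - expR (- (t_ n * Y w))) / t_ n.
have Z0 n w : 0 <= Z n w.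
  by rewrite divr_ge0 ?(ltW (t0 n))// subr_ge0 -expR0 ler_expR oppr_le0 mulr_ge0// ltW.
have mZ n : measurable_fun setT (Z n).
  by apply: measurable_funM => //; exact: measurable_funB.
have cZ w : Z ^~ w @ \oo --> Y w by exact: cvg_laplace_quotient.
have ZY n w : Z n w <= Y w.
  by rewrite /Z ler_pdivrMr ?t0// [leRHS]mulrC one_sub_expRN_le.
have IZ n : exists2 U : R, t_ n * m - t_ n ^+ 2 * v <= U <= t_ n * m &
    (\int[P]_w (Z n w)%:E = ((1 - expR (- U)) / t_ n)%:E)%E.
  have [U Um UE] := L1 _ (t0 n); exists U => //.
  rewrite /Z; under eq_integral do rewrite mulrC.
  rewrite ge0_integralZ_EFin//.
  - by rewrite UE -EFinM mulrC.
  - exact: measurable_funB.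
  - by move=> w; rewrite subr_ge0 -expR0 ler_expR oppr_le0 mulr_ge0// ltW.
  - by rewrite invr_ge0 ltW.
have le_m : (\int[P]_w (Y w)%:E <= m%:E)%E.
  apply: (@fatou_le _ _ _ P setT (fun n w => (Z n w)%:E) _ (cst m%:E)) => //.
  - by move=> n; apply/measurable_EFinP.
  - by move=> n w _; rewrite lee_fin.
  - by move=> w _; apply: cvg_EFin; [exact: nearW|exact: cZ].
  - move=> n; have [U /andP[_ Um] ->] := IZ n; rewrite lee_fin.
    by rewrite ler_pdivrMr// [leRHS]mulrC (le_trans (one_sub_expRN_le U)).
  - exact: cvg_cst.
split.
  apply/eqP; rewrite eq_le le_m /=.
  have fin : (\int[P]_w (Y w)%:E)%E \is a fin_num.
    rewrite ge0_fin_numE ?(le_lt_trans le_m) ?ltry//.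
    by apply: integral_ge0 => w _; rewrite lee_fin.
  rewrite -(fineK fin) lee_fin.
  (* Since [Z n <= Y], the mean of [Z n] is a lower bound. The slack [t ^+ 2 * v] in [U] costs
     [v * t * expR v] after division by [t], because [t <= 1]. *)
  have lb n : (1 - expR (- (t_ n * m))) / t_ n - v * t_ n * expR v <= fine (\int[P]_w (Y w)%:E)%E.
    rewrite -lee_fin fineK//.
    have [U /andP[Um _] UE] := IZ n.
    apply: (@le_trans _ _ (\int[P]_w (Z n w)%:E)%E); last first.
      by apply: ge0_le_integral_EFin.
    rewrite UE lee_fin ler_pdivlMr// mulrBl divfK ?gt_eqF//.
    have eU : expR (- U) <= expR (- (t_ n * m)) * expR (t_ n ^+ 2 * v).
      by rewrite -expRD ler_expR; lra.
    have t1 : t_ n <= 1 by rewrite invf_le1// ler1n.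
    have s1 : t_ n ^+ 2 * v <= v.
      by rewrite ler_piMl// expr_le1// ltW.
    have e1 : expR (- (t_ n * m)) <= 1.
      by rewrite -expR0 ler_expR oppr_le0 mulr_ge0// ltW.
    have e2 : expR (t_ n ^+ 2 * v) - 1 <= t_ n ^+ 2 * v * expR v.
      apply: le_trans (expR_sub1_le _) _.
      by rewrite ler_wpM2l ?ler_expR// mulr_ge0// sqr_ge0.
    have p0 := expR_gt0 (- (t_ n * m)).
    have q0 : 0 <= expR (t_ n ^+ 2 * v) - 1.
      by rewrite subr_ge0 -expR0 ler_expR mulr_ge0// sqr_ge0.
    have -> : v * t_ n * expR v * t_ n = t_ n ^+ 2 * v * expR v by ring.
    have := ler_pM (ltW p0) q0 e1 e2.
    by move: eU; lra.
  have lcvg : (1 - expR (- (t_ n * m))) / t_ n - v * t_ n * expR v @[n --> \oo] --> m.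
    rewrite -[X in _ --> X]subr0; apply: cvgB; first exact: cvg_laplace_quotient.
    rewrite -[X in _ --> X](mul0r (expR v)); apply: cvgM; last exact: cvg_cst.
    exact: cvg_harmonicM.
  rewrite -(cvg_lim _ lcvg)//; apply: limr_le; first by apply/cvg_ex; exists m.
  exact: nearW.
(* The factor 4 comes from the hypothesis at [2 * t], whose slack is [(2 * t) ^+ 2 * v]; the
   exponential tends to one. *)
pose b n : R := m ^+ 2 + 4 * v * expR (4 * t_ n ^+ 2 * v).
apply: (@fatou_le _ _ _ P setT (fun n w => (Z n w ^+ 2)%:E) _ (EFin \o b)) => //.
- by move=> n; apply/measurable_EFinP; exact: measurable_funX.
- by move=> n w _; rewrite lee_fin sqr_ge0.
- move=> w _; apply: cvg_EFin; first exact: nearW.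
  exact: (cvg_comp _ _ (cZ w) (@exprn_continuous _ 2 _)).
- move=> n.
  have [U /andP[_ Um] UE] := L _ (t0 n).
  have [|U2 /andP[Um2 _] UE2] := L (2 * t_ n); first by rewrite mulr_gt0.
  have mE : measurable_fun setT (fun w => 1 - expR (- (t_ n * Y w))).
    exact: measurable_funB.
  have ZE : (\int[P]_w ((1 - expR (- (t_ n * Y w))) ^+ 2)%:E =
      (1 + expR (- U2) - 2 * expR (- U))%:E)%E.
    have : (\int[P]_w ((1 - expR (- (t_ n * Y w))) ^+ 2 +
        2 * expR (- (t_ n * Y w)))%:E = \int[P]_w (1 + expR (- (2 * t_ n * Y w)))%:E)%E.
      apply: eq_integral => w _; congr EFin.
      have -> : - (2 * t_ n * Y w) = - (t_ n * Y w) + - (t_ n * Y w) by ring.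
      by rewrite expRD; ring.
    rewrite !ge0_integralD_EFin//; last 3 first.
    - exact: measurable_funX.
    - exact: measurable_funM.
    - by move=> w; rewrite sqr_ge0.
    rewrite ge0_integralZ_EFin// UE UE2 int1.
    move=> H.
    transitivity ((1 + (expR (- U2))%:E) - (2 * (expR (- U))%:E))%E; last by [].
    by rewrite -H addeK.
  have -> : (\int[P]_w (Z n w ^+ 2)%:E = ((t_ n ^+ 2)^-1)%:E *
      \int[P]_w ((1 - expR (- (t_ n * Y w))) ^+ 2)%:E)%E.
    rewrite -ge0_integralZ_EFin//.
    - by apply: eq_integral => w _; rewrite /Z exprMn exprVn mulrC.
    - exact: measurable_funX.
    - by move=> w; rewrite sqr_ge0.
    - by rewrite invr_ge0 sqr_ge0.
  rewrite ZE -EFinM lee_fin mulrC ler_pdivrMr ?exprn_gt0// /b.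
  pose a := expR (- (t_ n * m)); pose y := 4 * t_ n ^+ 2 * v.
  have aU : a <= expR (- U) by rewrite ler_expR lerN2.
  have aU2 : expR (- U2) <= a ^+ 2 * expR y.
    rewrite /a expr2 -!expRD ler_expR /y.
    have -> : 4 * t_ n ^+ 2 * v = (2 * t_ n) ^+ 2 * v by ring.
    by move: Um2; lra.
  have a1 : a <= 1 by rewrite -expR0 ler_expR oppr_le0 mulr_ge0// ltW.
  have a0 : 0 <= a by exact: expR_ge0.
  have am : (1 - a) ^+ 2 <= (t_ n * m) ^+ 2.
    rewrite lerXn2r ?nnegrE ?subr_ge0//; last exact: one_sub_expRN_le.
    by rewrite mulr_ge0// ltW.
  have y0 : 0 <= y.
    rewrite /y -mulrA; apply: mulr_ge0 => //; apply: mulr_ge0 => //; exact: sqr_ge0.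
  have ey0 : 0 <= expR y - 1 by rewrite subr_ge0 -expR0 ler_expR.
  have h : a ^+ 2 * (expR y - 1) <= 1 * (y * expR y).
    apply: ler_pM => //; [exact: sqr_ge0|by rewrite expr_le1|exact: expR_sub1_le].
  rewrite -/y.
  have -> : (m ^+ 2 + 4 * v * expR y) * t_ n ^+ 2 = (t_ n * m) ^+ 2 + y * expR y.
    by rewrite /y; ring.
  have E : (1 - a) ^+ 2 + a ^+ 2 * (expR y - 1) = 1 - 2 * a + a ^+ 2 * expR y by ring.
  by move: aU aU2 am h E; lra.
- apply: cvg_EFin; first exact: nearW.
  have -> : m ^+ 2 + 4 * v = m ^+ 2 + 4 * v * expR (4 * 0 ^+ 2 * v).
    by rewrite expr0n/= mulr0 mul0r expR0 mulr1.
  apply: cvgD; first exact: cvg_cst.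
  apply: cvgM; first exact: cvg_cst.
  apply: continuous_cvg; first exact: continuous_expR.
  apply: cvgM; last exact: cvg_cst.
  apply: cvgM; first exact: cvg_cst.
  exact: (cvg_comp _ _ cvg_harmonic (@exprn_continuous _ 2 _)).
Qed.
End laplace_transform.

Section simple_function_composition.
Context {R : realType} d1 d2 (T : measurableType d1) (U : measurableType d2).
Variable mu : {measure set T -> \bar R}.
Import HBNNSimple.

(** Through this sum, an identity for events of the form [g @^-1] of a level set becomes one for
    simple functionals of [g]; the Markov property is extended in this way. *)
Lemma integral_nnsfun_comp (D : set T) (g : T -> U) (h : {nnsfun U >-> R}) :
  measurable D -> measurable_fun setT g ->
  (\int[mu]_(w in D) (h (g w))%:E =
   \sum_(r \in range h) (r%:E * mu (D `&` g @^-1` (h @^-1` [set r]))))%E.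
Proof.
move=> mD mg.
have mS r : measurable (g @^-1` (h @^-1` [set r])).
  by rewrite -[X in measurable X]setTI; exact: mg.
under eq_integral do rewrite fimfunE -fsumEFin//.
rewrite ge0_integral_fsum//; last 2 first.
- move=> r; apply/measurable_EFinP; apply: measurable_funM => //.
  apply: (measurable_funS measurableT) => //.
  by apply: measurableT_comp => //; exact: measurable_indic.
- by move=> r x _; rewrite nnfun_muleindic_ge0.
apply: eq_fsbigr => r; rewrite inE => -[y _ <-].
rewrite ge0_integralZ_EFin//; last first.
  apply: (measurable_funS measurableT) => //.
  by apply: measurableT_comp => //; exact: measurable_indic.
congr (_ * _)%E; rewrite (eq_integral (fun w => (\1_(g @^-1` (h @^-1` [set h y])) w)%:E)).
  by rewrite integral_indic// setIC.
by move=> w _; rewrite !indicE; congr (_%:R%:E); apply/idP/idP => /set_mem /= H; exact/mem_set.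
Qed.

End simple_function_composition.

(** * First and second moments of the process *)

Section super_brownian_moments.
Context {R : realType} {d : nat} {alpha beta : R}.
Implicit Types (mu : MF R d) (f : 'rV[R]_d -> R) (K k s t : R).
Hypotheses (alpha0 : 0 <= alpha) (beta0 : 0 <= beta).

Definition growth t f x := expR (beta * t) * heat t f x.

Lemma growth_semigroupE t f x K : 0 <= t -> bounded_borel K f ->
  growth_semigroup beta t f x = (growth t f x)%:E.
Proof.
by move=> t0 fK; rewrite /growth_semigroup (brownian_semigroupE x t0 fK).1 -EFinM.
Qed.

Lemma bounded_borel_growth t f K : 0 <= t -> bounded_borel K f ->
  bounded_borel (expR (beta * t) * K) (growth t f).
Proof.
by move=> t0 fK; apply: bounded_borelZ (expR_ge0 _) (bounded_borel_heat t0 fK).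
Qed.

Lemma growthZ t f x k K : 0 <= t -> 0 <= k -> bounded_borel K f ->
  growth t (fun y => k * f y) x = k * growth t f x.
Proof. by move=> t0 k0 fK; rewrite /growth (heatZ x t0 k0 fK) mulrCA. Qed.

Lemma growth_cst t k x : 0 <= t -> 0 <= k -> growth t (cst k) x = expR (beta * t) * k.
Proof. by move=> t0 k0; rewrite /growth heat_cst. Qed.

Lemma growth0 f x : growth 0 f x = f x.
Proof. by rewrite /growth mulr0 expR0 mul1r heat0. Qed.

Lemma growth_semigroup_ge0 t f x : 0 <= t -> (forall y, 0 <= f y) ->
  (0 <= growth_semigroup beta t f x)%E.
Proof.
move=> t0 f0; rewrite /growth_semigroup mule_ge0 ?lee_fin ?expR_ge0//.
rewrite /brownian_semigroup; case: eqP => _; first by rewrite lee_fin.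
by apply: integral_ge0 => y _; rewrite lee_fin mulr_ge0 ?heat_kernel_ge0.
Qed.

Lemma measurable_log_laplace_solution f u t :
  log_laplace_solution alpha beta f u -> 0 <= t -> measurable_fun setT (u t).
Proof.
move=> [_ mu _] t0.
apply: (@measurable_comp _ _ _ _ _ _ [set p : R * 'rV[R]_d | 0 <= p.1]
  (fun p => u p.1 p.2) setT (fun y => (t, y))) => //.
- rewrite (_ : mkset _ = fst @^-1` `[0, +oo[%classic).
    by rewrite -[X in measurable X]setTI; exact: measurable_fst.
  by apply/seteqP; split => p /=; rewrite in_itv/= andbT.
- by move=> _ [y _ <-].
- exact: pair1_measurable.
Qed.

(** The mild equation subtracts a nonnegative integral, whence the upper bound. Fed back into that
    integral, it bounds the integrand by [alpha * K ^+ 2 * expR (beta * (t + s))], and [s <= t]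
    gives the lower bound. The correction is quadratic in [K], as a variance term must be. *)
Lemma log_laplace_solution_bounds f u K t x : bounded_borel K f ->
  log_laplace_solution alpha beta f u -> 0 <= t ->
  growth t f x - alpha * K ^+ 2 * expR (2 * beta * t) * t <= u t x <= growth t f x.
Proof.
move=> fK su; have [u0 _ ueq] := su; have K0 := bounded_borel_bound fK.
have i0 s y : 0 <= s -> (0 <= \int[lebesgue_measure]_(r in `[0%R, s])
    growth_semigroup beta (s - r) (fun z => alpha * u r z ^+ 2)%R y)%E.
  move=> s0; apply: integral_ge0 => r /=; rewrite in_itv/= => /andP[r0 rs].
  apply: growth_semigroup_ge0 => [|z]; first by rewrite subr_ge0.
  by rewrite mulr_ge0// sqr_ge0.
have ule s y : 0 <= s -> u s y <= growth s f y.
  move=> s0; rewrite -lee_fin -(growth_semigroupE y s0 fK) -(ueq s y s0).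
  by rewrite -[leLHS]adde0 leeD2l ?i0.
move=> t0; rewrite ule// andbT lerBlDr -lee_fin.
rewrite -(growth_semigroupE x t0 fK) -(ueq t x t0) EFinD leeD2l//.
pose c := alpha * K ^+ 2 * expR (2 * beta * t).
apply: (@le_trans _ _ (\int[lebesgue_measure]_(s in `[0%R, t]) c%:E)%E); last first.
  rewrite integral_cst//= lebesgue_measure_itv/=.
  by case: ifPn => _; rewrite ?sube0 ?oppr0 ?mule0 ?lee_fin ?mulr_ge0 ?expR_ge0 ?sqr_ge0//
    -?EFinM ?lee_fin.
apply: ge0_le_integral_nomeas => s /=; rewrite in_itv/= => /andP[s0 st].
  by apply: growth_semigroup_ge0 => [|z]; rewrite ?subr_ge0// mulr_ge0// sqr_ge0.
have ub : bounded_borel (alpha * (expR (beta * s) * K) ^+ 2) (fun y => alpha * u s y ^+ 2).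
  split.
    apply: measurable_funM; first exact: measurable_cst.
    by apply: measurable_funX; exact: measurable_log_laplace_solution su s0.
  move=> y; rewrite mulr_ge0 ?sqr_ge0//= ler_wpM2l// lerXn2r ?nnegrE ?u0//.
    by rewrite mulr_ge0 ?expR_ge0.
  rewrite (le_trans (ule s y s0))//.
  exact: bounded_borel_le (bounded_borel_growth s0 fK) y.
have st0 : 0 <= t - s by rewrite subr_ge0.
rewrite (growth_semigroupE x st0 ub) lee_fin.
apply: le_trans (bounded_borel_le (bounded_borel_growth st0 ub) x) _.
rewrite /c.
have -> : expR (beta * (t - s)) * (alpha * (expR (beta * s) * K) ^+ 2) =
    alpha * K ^+ 2 * (expR (beta * (t - s)) * (expR (beta * s) * expR (beta * s))).
  by ring.
rewrite ler_wpM2l ?mulr_ge0 ?sqr_ge0// -!expRD ler_expR.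
have -> : beta * (t - s) + (beta * s + beta * s) = beta * t + beta * s by ring.
have -> : 2 * beta * t = beta * t + beta * t by ring.
by rewrite lerD2l ler_wpM2l.
Qed.

Context {dO : measure_display} {Omega : measurableType dO}.
Context {X : R -> Omega -> MF R d} {P : MF R d -> probability Omega R}.
Hypothesis hX : super_brownian_motion alpha beta X P.
Lemma measurable_sbm_pairing t f K : 0 <= t -> bounded_borel K f ->
  measurable_fun setT (fun w => \int[X t w]_y f y).
Proof.
move=> t0 fK.
exact: (measurableT_comp (measurable_MF_pairing fK) (sbm_measurable hX t0)).
Qed.

(** The log-Laplace formula for [h * f] puts the exponent between [h * m - h ^+ 2 * v] and [h * m],
    where [m] pairs [mu] with [growth t f] and [v] is proportional to the mass of [mu]; this is the
    input of [moments_of_laplace]. *)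
Lemma sbm_moments mu t f K : 0 <= t -> bounded_borel K f ->
  (\int[P mu]_w (\int[X t w]_y f y)%:E = (\int[mu]_y growth t f y)%:E)%E /\
  (\int[P mu]_w ((\int[X t w]_y f y) ^+ 2)%:E <=
   ((\int[mu]_y growth t f y) ^+ 2 +
    4 * (alpha * K ^+ 2 * expR (2 * beta * t) * t * \int[mu]_y 1))%:E)%E.
Proof.
move=> t0 fK; have K0 := bounded_borel_bound fK.
have gK := bounded_borel_growth t0 fK.
have c0 : 0 <= alpha * K ^+ 2 * expR (2 * beta * t) * t.
  by rewrite !mulr_ge0 ?expR_ge0 ?sqr_ge0.
have b1 : bounded_borel 1 (cst 1 : 'rV[R]_d -> R) by exact: bounded_borel_cst.
apply: moments_of_laplace.
- exact: measurable_sbm_pairing fK.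
- by move=> w; exact: pairing_ge0 fK.
- exact: pairing_ge0 gK.
- by rewrite mulr_ge0// (pairing_ge0 _ b1).
move=> h h0.
have hK := bounded_borelZ (ltW h0) fK.
have [|u [su _] E] := sbm_log_laplace hX hK.1 (bounded_borel_ge0 hK).
  exists (h * K); split; first exact: num_real.
  move=> M KM y _ /=; rewrite ger0_norm ?(bounded_borel_ge0 hK)//.
  by rewrite (le_trans (bounded_borel_le hK _))// ltW.
have ub := log_laplace_solution_bounds _ hK su t0.
have uK : bounded_borel (expR (beta * t) * (h * K)) (u t).
  split; first exact: measurable_log_laplace_solution su t0.
  move=> y; have /andP[_ uy] := ub y; have [u0 _ _] := su; rewrite u0//=.
  exact: le_trans uy (bounded_borel_le (bounded_borel_growth t0 hK) y).
exists (\int[mu]_y u t y).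
  have hg := bounded_borelZ (ltW h0) gK.
  apply/andP; split; last first.
    rewrite -(pairingZ mu h gK); apply: (le_pairing mu uK hg) => y.
    by have /andP[_] := ub y; rewrite (growthZ y t0 (ltW h0) fK).
  rewrite lerBlDr -(pairingZ mu h gK).
  pose c := h ^+ 2 * (alpha * K ^+ 2 * expR (2 * beta * t) * t).
  have c'0 : 0 <= c by rewrite mulr_ge0// sqr_ge0.
  rewrite mulrA -/c -pairing_cst -(pairingD mu uK (bounded_borel_cst c'0)).
  apply: (le_pairing mu hg (bounded_borelD uK (bounded_borel_cst c'0))) => y /=.
  have /andP[+ _] := ub y; rewrite (growthZ y t0 (ltW h0) fK) lerBlDr.
  by rewrite /c exprMn; congr (_ <= _ + _); ring.
rewrite -(E t mu t0) unlock; apply: eq_integral => w _.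
by rewrite (pairingZ _ h fK).
Qed.

End super_brownian_moments.
Arguments growth {R d} beta t f x.
Arguments bounded_borel_growth {R d} beta {t f K} _ _.

(** * A maximal inequality for discrete martingales *)

Section conditional_pairing.
Context {R : realType} d (T : measurableType d) (mu : {measure set T -> \bar R}).
Import HBNNSimple.

(** Stands in for pulling a factor out of a conditional expectation. [Z] is approximated from below
    by simple functions measurable for [<<s G >>]; on their level sets the claim is the hypothesis
    [fg]. *)
Lemma integral_sub_sigma_algebra (G : set (set T)) (f g : T -> R)
    (Z : g_sigma_algebraType G -> R) :
  (forall A, <<s G >> A -> measurable A) ->
  measurable_fun setT f -> measurable_fun setT g ->
  (forall w, 0 <= f w) -> (forall w, 0 <= g w) ->
  (forall A, <<s G >> A -> (\int[mu]_(w in A) (f w)%:E = \int[mu]_(w in A) (g w)%:E)%E) ->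
  measurable_fun setT Z -> (forall w, 0 <= Z w) ->
  (\int[mu]_w (Z w * f w)%:E = \int[mu]_w (Z w * g w)%:E)%E.
Proof.
move=> Gm mf mg f0 g0 fg mZ Z0.
have mZE : measurable_fun setT (EFin \o Z) by exact/measurable_EFinP.
pose Z_ := nnsfun_approx measurableT mZE.
have mZ_ n : measurable_fun [set: T] (Z_ n : T -> R).
  move=> _ B mB; rewrite setTI; apply: Gm.
  by rewrite -[X in <<s _ >> X]setTI; exact: (measurable_funP (Z_ n)).
have mS n r : measurable (Z_ n @^-1` [set r] : set T).
  by rewrite -[X in measurable X]setTI; exact: mZ_.
have simple (h : T -> R) n : measurable_fun setT h -> (forall w, 0 <= h w) ->
    (\int[mu]_w (Z_ n w * h w)%:E =
     \sum_(r \in range (Z_ n)) (r%:E * \int[mu]_(w in Z_ n @^-1` [set r]) (h w)%:E))%E.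
  move=> mh h0.
  transitivity (\int[mu]_w (\sum_(r \in range (Z_ n))
      (r * (\1_(Z_ n @^-1` [set r]) w * h w))%:E))%E.
    apply: eq_integral => w _; rewrite {1}fimfunE fsumEFin//; congr EFin.
    rewrite mulr_fsuml//.
    by apply: eq_fsbigr => r _; rewrite mulrA.
  rewrite ge0_integral_fsum//; last 2 first.
  - move=> r; apply/measurable_EFinP; apply: measurable_funM => //.
    by apply: measurable_funM => //; exact: measurable_indic.
  - move=> r w _; rewrite mulrA lee_fin mulr_ge0//.
    by have := nnfun_muleindic_ge0 (Z_ n) r w; rewrite lee_fin.
  apply: eq_fsbigr => r; rewrite inE => -[y _ <-].
  rewrite ge0_integralZ_EFin//; last 2 first.
  - by apply: measurable_funM => //; exact: measurable_indic.
  - by move=> w; rewrite mulr_ge0.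
  congr (_ * _)%E; rewrite [RHS]integral_mkcond; apply: eq_integral => w _.
  by rewrite /patch indicE; case: ifPn => wS; rewrite ?mul1r ?mul0r.
have limZ (h : T -> R) : measurable_fun setT h -> (forall w, 0 <= h w) ->
    (\int[mu]_w (Z_ n w * h w)%:E)%E @[n --> \oo] --> (\int[mu]_w (Z w * h w)%:E)%E.
  move=> mh h0.
  have cZ w : (Z_ n w * h w)%:E @[n --> \oo] --> (Z w * h w)%:E.
    apply: cvg_EFin; first exact: nearW.
    apply: cvgM; last exact: cvg_cst.
    have : (EFin \o Z_^~ w) @ \oo --> (EFin \o Z) w.
      by apply: (cvg_nnsfun_approx measurableT mZE) => // y _; rewrite lee_fin.
    by move/fine_cvg.
  have -> : (\int[mu]_w (Z w * h w)%:E =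
      \int[mu]_w limn (fun n => (Z_ n w * h w)%:E))%E.
    by apply: eq_integral => w _; apply/esym/cvg_lim => //; exact: cZ.
  apply: cvg_monotone_convergence => //.
  - by move=> n; apply/measurable_EFinP; exact: measurable_funM.
  - by move=> n w _; rewrite lee_fin mulr_ge0.
  - move=> w _ m n mn; rewrite lee_fin ler_wpM2r//.
    by have /lefP := nd_nnsfun_approx measurableT mZE mn; exact.
rewrite -(cvg_lim _ (limZ f mf f0))// -(cvg_lim _ (limZ g mg g0))//.
congr (limn _).
apply/funext => n; rewrite !simple//; apply: eq_fsbigr => r _; rewrite fg//.
by rewrite -[X in <<s _ >> X]setTI; exact: (measurable_funP (Z_ n)).
Qed.
(** Kolmogorov's argument: split the exceedance event by its first index [k]. On that piece, which
    belongs to [<<s G k >>], orthogonality of increments lets [M N] replace [M k], and the pieces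
    add up to at most the variance of [M N - M 0]. *)
Lemma weak_maximal_inequality (G : nat -> set (set T)) (M : nat -> T -> R)
    (N : nat) (lam c : R) :
  (forall k A, <<s G k >> A -> measurable A) ->
  (forall i j A, (i <= j)%N -> <<s G i >> A -> <<s G j >> A) ->
  (forall k, (k <= N)%N ->
    measurable_fun (setT : set (g_sigma_algebraType (G k))) (M k)) ->
  (forall k w, 0 <= M k w) ->
  (forall k A, (k <= N)%N -> <<s G k >> A ->
    (\int[mu]_(w in A) (M N w)%:E = \int[mu]_(w in A) (M k w)%:E)%E) ->
  (forall k, (k <= N)%N -> (\int[mu]_w (M k w ^+ 2)%:E < +oo)%E) ->
  (\int[mu]_w (M N w ^+ 2)%:E <= \int[mu]_w (M 0 w ^+ 2)%:E + c%:E)%E ->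
  0 < lam ->
  ((lam ^+ 2)%:E * mu (\bigcup_(k in [set k | (k <= N)%N])
    [set w | (lam < `|M k w - M 0 w|)%R]) <= c%:E)%E.
Proof.
move=> Gm Gle mG M0 MN M2 MNc lam0.
have mM k : (k <= N)%N -> measurable_fun setT (M k).
  move=> kN _ B mB; rewrite setTI; apply: (Gm k).
  by rewrite -[X in <<s _ >> X]setTI; exact: (mG k kN).
have mG0 k : (k <= N)%N -> measurable_fun (setT : set (g_sigma_algebraType (G k))) (M 0).
  move=> kN _ B mB; rewrite setTI; apply: (Gle 0%N k) => //.
  by rewrite -[X in <<s _ >> X]setTI; exact: (mG 0%N).
have m0 := mM _ (leq0n N); have mN := mM _ (leqnn N).
have orth k (Z : T -> R) : (k <= N)%N ->
    measurable_fun (setT : set (g_sigma_algebraType (G k))) Z ->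
    (forall w, 0 <= Z w) ->
    (\int[mu]_w (Z w * M N w)%:E = \int[mu]_w (Z w * M k w)%:E)%E.
  move=> kN mZ Z0; apply: (@integral_sub_sigma_algebra (G k)) => //.
  - exact: Gm.
  - exact: mM.
  - by move=> A GA; exact: MN.
(* [M 0] is orthogonal to the increment, so its variance is a difference of second moments. In [E]
   the term [2 * M 0 ^+ 2] is added so that all integrands stay nonnegative. *)
have V : (\int[mu]_w ((M N w - M 0 w) ^+ 2)%:E <= c%:E)%E.
  have sqfin : (2%:E * \int[mu]_w (M 0 w ^+ 2)%:E)%E \is a fin_num.
    rewrite fin_numM// ge0_fin_numE ?M2//.
    by apply: integral_ge0 => w _; rewrite lee_fin sqr_ge0.
  have E : (\int[mu]_w ((M N w - M 0 w) ^+ 2)%:E + 2%:E * \int[mu]_w (M 0 w ^+ 2)%:E =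
      \int[mu]_w (M N w ^+ 2)%:E + \int[mu]_w (M 0 w ^+ 2)%:E)%E.
    rewrite -ge0_integralD_EFin//; [|exact: measurable_funX|exact: measurable_funX|
      by move=> w; exact: sqr_ge0|by move=> w; exact: sqr_ge0].
    have -> : (\int[mu]_w (M 0 w ^+ 2)%:E = \int[mu]_w (M 0 w * M N w)%:E)%E.
      by rewrite (orth 0%N)//; exact: mG.
    rewrite -ge0_integralZ_EFin//; [|exact: measurable_funM|by move=> w; rewrite mulr_ge0].
    rewrite -ge0_integralD_EFin//.
    - by apply: eq_integral => w _; congr EFin; ring.
    - by apply: measurable_funX; exact: measurable_funB.
    - by apply: measurable_funM => //; exact: measurable_funM.
    - by move=> w; exact: sqr_ge0.
    - by move=> w; rewrite !mulr_ge0.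
  rewrite -(leeD2rE _ _ sqfin) E.
  apply: (@le_trans _ _ ((\int[mu]_w (M 0 w ^+ 2)%:E + c%:E) + \int[mu]_w (M 0 w ^+ 2)%:E)%E).
    by rewrite leeD2r.
  rewrite -addeA addeCA; apply: leeD2l.
  have x0 : (0 <= \int[mu]_w (M 0 w ^+ 2)%:E)%E.
    by apply: integral_ge0 => w _; rewrite lee_fin sqr_ge0.
  by rewrite -[2%:E]/(1 + 1)%E ge0_muleDl// !mul1e.
have key k A : (k <= N)%N -> <<s G k >> A ->
    (\int[mu]_(w in A) ((M k w - M 0 w) ^+ 2)%:E <=
     \int[mu]_(w in A) ((M N w - M 0 w) ^+ 2)%:E)%E.
  move=> kN GA.
  have mk := mM k kN; have mA := Gm k A GA.
  pose a w : R := \1_A w.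
  have a0 w : 0 <= a w by rewrite /a indicE.
  have a1 w : a w <= 1 by rewrite /a indicE lern1 leq_b1.
  have restr (h : T -> R) : (\int[mu]_(w in A) (h w)%:E = \int[mu]_w (a w * h w)%:E)%E.
    rewrite integral_mkcond; apply: eq_integral => w _.
    by rewrite /patch /a indicE; case: ifPn => wS; rewrite ?mul1r ?mul0r.
  (* [orth] takes nonnegative weights, so [M k - M 0] is split into its positive and negative parts.
     They are bounded by [M k] and [M 0], which makes [x + y] finite and hence cancellable. *)
  pose hp w := Num.max (M k w - M 0 w) 0.
  pose hm w := Num.max (M 0 w - M k w) 0.
  have hp0 w : 0 <= hp w by rewrite le_max lexx orbT.
  have hm0 w : 0 <= hm w by rewrite le_max lexx orbT.
  have hpM w : hp w <= M k w by rewrite ge_max M0 gerBl M0.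
  have hmM w : hm w <= M 0 w by rewrite ge_max M0 gerBl M0.
  have hpm w : hp w - hm w = M k w - M 0 w.
    by rewrite /hp /hm; case: (leP (M k w) (M 0 w)) => h;
      [rewrite max_r ?subr_le0// max_l ?subr_ge0//|
       rewrite max_l ?subr_ge0 ?ltW// max_r ?subr_le0 ?ltW//]; ring.
  have ma : measurable_fun (setT : set (g_sigma_algebraType (G k))) a.
    exact: (@measurable_indic _ (g_sigma_algebraType (G k))).
  have mZ (h : T -> R) : measurable_fun (setT : set (g_sigma_algebraType (G k))) h ->
      measurable_fun (setT : set (g_sigma_algebraType (G k))) (fun w => a w * h w).
    by move=> mh; exact: measurable_funM.
  have mhp : measurable_fun (setT : set (g_sigma_algebraType (G k))) hp.
    apply: measurable_maxr => //; apply: measurable_funB; [exact: mG|exact: mG0].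
  have mhm : measurable_fun (setT : set (g_sigma_algebraType (G k))) hm.
    apply: measurable_maxr => //; apply: measurable_funB; [exact: mG0|exact: mG].
  have toT (h : T -> R) : measurable_fun (setT : set (g_sigma_algebraType (G k))) h ->
      measurable_fun setT h.
    move=> mh _ C mC; rewrite setTI; apply: (Gm k).
    by rewrite -[X in <<s _ >> X]setTI; exact: mh.
  have fin (h : T -> R) : measurable_fun (setT : set (g_sigma_algebraType (G k))) h ->
      (forall w, 0 <= h w) -> (forall w, h w <= Num.max (M k w) (M 0 w)) ->
      (\int[mu]_w (a w * h w * M k w)%:E)%E \is a fin_num.
    move=> mh h0 hM; rewrite ge0_fin_numE; last first.
      by apply: integral_ge0 => w _; rewrite lee_fin !mulr_ge0.
    apply: (@le_lt_trans _ _ (\int[mu]_w (M k w ^+ 2 + M 0 w ^+ 2)%:E)%E); last first.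
      rewrite ge0_integralD_EFin//; [|exact: measurable_funX|exact: measurable_funX|
        by move=> w; exact: sqr_ge0|by move=> w; exact: sqr_ge0].
      by rewrite lte_add_pinfty// M2.
    apply: ge0_le_integral_EFin => //.
    - by apply: measurable_funM => //; apply: toT; exact: mZ.
    - by apply: measurable_funD; exact: measurable_funX.
    - by move=> w; rewrite !mulr_ge0.
    - move=> w _; rewrite -mulrA; apply: (@le_trans _ _ (h w * M k w)).
        by rewrite ler_piMl// mulr_ge0.
      apply: (@le_trans _ _ (Num.max (M k w) (M 0 w) * M k w)); first by rewrite ler_wpM2r.
      case: (leP (M k w) (M 0%N w)) => Mk0; last by rewrite -expr2 lerDl sqr_ge0.
      by rewrite ler_wpDl ?sqr_ge0// expr2 ler_wpM2l.
  have finp := fin hp mhp hp0.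
  have {}finp : (\int[mu]_w (a w * hp w * M k w)%:E)%E \is a fin_num.
    by apply: finp => w; rewrite le_max hpM.
  have finm : (\int[mu]_w (a w * hm w * M k w)%:E)%E \is a fin_num.
    by apply: fin => // w; rewrite le_max hmM orbT.
  have Op := orth k (fun w => a w * hp w) kN (mZ hp mhp) (fun w => mulr_ge0 (a0 w) (hp0 w)).
  have Om := orth k (fun w => a w * hm w) kN (mZ hm mhm) (fun w => mulr_ge0 (a0 w) (hm0 w)).
  have mp := toT _ (mZ hp mhp); have mm := toT _ (mZ hm mhm); have mta := toT _ ma.
  have ax w : 0 <= a w * hp w by rewrite mulr_ge0.
  have ay w : 0 <= a w * hm w by rewrite mulr_ge0.
  rewrite !restr.
  pose x := (2%:E * \int[mu]_w (a w * hp w * M k w)%:E)%E.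
  pose y := (2%:E * \int[mu]_w (a w * hm w * M k w)%:E)%E.
  have xyfin : (x + y)%E \is a fin_num by rewrite fin_numD !fin_numM.
  rewrite -(leeD2rE _ _ xyfin).
  have sum3 (h u v : T -> R) : measurable_fun setT h -> measurable_fun setT u ->
      measurable_fun setT v -> (forall w, 0 <= h w) -> (forall w, 0 <= u w) ->
      (forall w, 0 <= v w) ->
      (\int[mu]_w (a w * h w)%:E + (2%:E * \int[mu]_w (a w * hp w * u w)%:E +
        2%:E * \int[mu]_w (a w * hm w * v w)%:E) =
       \int[mu]_w (a w * h w + (2 * (a w * hp w * u w) + 2 * (a w * hm w * v w)))%:E)%E.
    move=> mh mu' mv h0 u0 v0.
    have m1 : measurable_fun setT (fun w => a w * hp w * u w) by exact: measurable_funM.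
    have m2 : measurable_fun setT (fun w => a w * hm w * v w) by exact: measurable_funM.
    have p1 w : 0 <= a w * hp w * u w by rewrite mulr_ge0.
    have p2 w : 0 <= a w * hm w * v w by rewrite mulr_ge0.
    rewrite ge0_integralD_EFin//; last 4 first.
    - by apply: measurable_funM.
    - by apply: measurable_funD; exact: measurable_funM.
    - by move=> w; rewrite mulr_ge0.
    - by move=> w; rewrite addr_ge0// mulr_ge0.
    congr (_ + _)%E; rewrite ge0_integralD_EFin//.
    - by rewrite !ge0_integralZ_EFin.
    - exact: measurable_funM.
    - exact: measurable_funM.
    - by move=> w; rewrite mulr_ge0.
    - by move=> w; rewrite mulr_ge0.
  have mV (f g : T -> R) : measurable_fun setT f -> measurable_fun setT g ->
      measurable_fun setT (fun w => (f w - g w) ^+ 2).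
    by move=> mf mg; apply: measurable_funX; exact: measurable_funB.
  have sq0 (f g : T -> R) w : 0 <= (f w - g w) ^+ 2 by exact: sqr_ge0.
  (* On one side [M N] replaces [M k] in the [hp] term, on the other in the [hm] term; the
     integrands then differ exactly by [a * (M N - M k) ^+ 2]. *)
  have -> : (\int[mu]_w (a w * (M k w - M 0 w) ^+ 2)%:E + (x + y) =
      \int[mu]_w (a w * (M k w - M 0 w) ^+ 2)%:E +
      (2%:E * \int[mu]_w (a w * hp w * M N w)%:E + y))%E by rewrite Op.
  have -> : (\int[mu]_w (a w * (M N w - M 0 w) ^+ 2)%:E + (x + y) =
      \int[mu]_w (a w * (M N w - M 0 w) ^+ 2)%:E +
      (x + 2%:E * \int[mu]_w (a w * hm w * M N w)%:E))%E by rewrite Om.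
  rewrite /x /y !sum3//; [|exact: mV|exact: mV].
  have mS (h u v : T -> R) : measurable_fun setT h -> measurable_fun setT u ->
      measurable_fun setT v -> measurable_fun setT (fun w =>
        a w * h w + (2 * (a w * hp w * u w) + 2 * (a w * hm w * v w))).
    move=> mh mu' mv; apply: measurable_funD; first exact: measurable_funM.
    by apply: measurable_funD; apply: measurable_funM => //; exact: measurable_funM.
  apply: ge0_le_integral_EFin => //.
  - by apply: mS => //; exact: mV.
  - by apply: mS => //; exact: mV.
  - move=> w; apply: addr_ge0; first by rewrite mulr_ge0// sqr_ge0.
    apply: addr_ge0; apply: mulr_ge0 => //; exact: mulr_ge0.
  - move=> w _; rewrite -subr_ge0.
    have -> : a w * (M N w - M 0 w) ^+ 2 +
        (2 * (a w * hp w * M k w) + 2 * (a w * hm w * M N w)) -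
        (a w * (M k w - M 0 w) ^+ 2 +
        (2 * (a w * hp w * M N w) + 2 * (a w * hm w * M k w))) =
        a w * ((M N w - M 0 w) ^+ 2 - (M k w - M 0 w) ^+ 2 -
          2 * (hp w - hm w) * (M N w - M k w)) by ring.
    rewrite hpm mulr_ge0// (_ : _ - _ = (M N w - M k w) ^+ 2) ?sqr_ge0//; ring.
pose B k := if (k <= N)%N then [set w | lam < `|M k w - M 0 w|] else set0.
have GB k j : (j <= k)%N -> <<s G k >> (B j).
  move=> jk; apply: (Gle j) => //; rewrite /B; case: ifPn => jN; last exact: sigma_algebra0.
  have mh : measurable_fun (setT : set (g_sigma_algebraType (G j)))
      (fun w => `|M j w - M 0 w|).
    apply: measurableT_comp => //; apply: measurable_funB; [exact: mG|exact: mG0].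
  have := mh measurableT `]lam, +oo[%classic (measurable_itv _).
  rewrite setTI; congr (<<s _ >> _); apply/seteqP; split => w /=.
    by rewrite in_itv/= andbT.
  by rewrite in_itv/= andbT.
(* [seqDU B k] is the event that the first exceedance occurs at [k], so it is decided at step
   [k]. *)
have GD k : <<s G k >> (seqDU B k).
  apply: (@measurableD _ (g_sigma_algebraType (G k))); first exact: GB.
  apply: (@bigsetU_measurable _ (g_sigma_algebraType (G k))) => i _.
  by apply: GB; exact/ltnW/ltn_ord.
have mD k : measurable (seqDU B k) by apply: (Gm k).
have UE : \bigcup_(k in [set k | (k <= N)%N]) [set w | lam < `|M k w - M 0 w|] =
    \bigcup_k seqDU B k.
  rewrite -seqDU_bigcup_eq; apply/seteqP; split => w.
    by move=> [k /= kN h]; exists k => //; rewrite /B kN.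
  by move=> [k _]; rewrite /B; case: ifPn => // kN h; exists k.
rewrite UE; apply: le_trans V.
have mU : measurable (\bigcup_k seqDU B k) by exact: bigcup_measurable.
rewrite -integral_cst// ge0_integral_bigcup//; last first.
  by move=> w _; rewrite lee_fin sqr_ge0.
apply: (@le_trans _ _ (\int[mu]_(w in \bigcup_k seqDU B k) ((M N w - M 0 w) ^+ 2)%:E)%E).
  rewrite ge0_integral_bigcup//; last 2 first.
  - apply/measurable_EFinP; apply: measurable_funX; apply: measurable_funTS.
    exact: measurable_funB.
  - by move=> w _; rewrite lee_fin sqr_ge0.
  apply: lee_nneseries => k _.
    by move=> _; apply: integral_ge0 => w _; rewrite lee_fin sqr_ge0.
  have [kN|kN] := leqP k N; last first.
    have -> : seqDU B k = set0 by rewrite /seqDU /B leqNgt kN set0D.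
    by rewrite !integral_set0.
  apply: le_trans (key k _ kN (GD k)).
  apply: ge0_le_integral_EFin => //.
  - by apply: measurable_funX; apply: measurable_funTS; apply: measurable_funB => //; exact: mM.
  - by move=> w; exact: sqr_ge0.
  - move=> w [+ _]; rewrite /B kN /= => h.
    rewrite -[leRHS]real_normK ?num_real// lerXn2r ?nnegrE//; [exact: ltW|exact: ltW].
apply: ge0_subset_integral => //.
- by apply/measurable_EFinP; apply: measurable_funX; exact: measurable_funB.
- by move=> w _; rewrite lee_fin sqr_ge0.
Qed.

End conditional_pairing.

Section image_measure.
Context {R : realType} d1 d2 (T : measurableType d1) (U : measurableType d2).
Variables (g : T -> U) (mg : measurable_fun setT g) (m : {measure set T -> \bar R}).

Definition image_measure : {measure set U -> \bar R}.
Proof. by refine (pushforward m g : {measure set U -> \bar R}). Defined.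

Lemma integral_image_measure (f : U -> \bar R) : measurable_fun setT f ->
  (forall u, (0 <= f u)%E) -> (\int[image_measure]_u f u = \int[m]_w f (g w))%E.
Proof.
by move=> mf f0; rewrite (ge0_integral_pushforward mg m measurableT mf)// preimage_setT.
Qed.

End image_measure.

(** * The Markov property for functionals and the maximal inequality at dyadic times *)

Section super_brownian_markov.
Context {R : realType} {d : nat} {alpha beta : R}.
Hypotheses (alpha0 : 0 <= alpha) (beta0 : 0 <= beta).
Context {dO : measure_display} {Omega : measurableType dO}.
Context {X : R -> Omega -> MF R d} {P : MF R d -> probability Omega R}.
Hypothesis hX : super_brownian_motion alpha beta X P.
Implicit Types (mu nu : MF R d) (f : 'rV[R]_d -> R) (K s t : R).
Implicit Types (Phi : MF R d -> \bar R).
Local Notation growth := (growth beta).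
Import HBNNSimple.

(** Named so that [g_sigma_algebraType (past t)] can be formed; [natural_filtration X t] is
    convertible to [<<s past t >>]. *)
Definition past t : set (set Omega) :=
  [set A | exists s G, [/\ 0 <= s, s <= t, measurable G & A = X s @^-1` G]].

Lemma natural_filtration_measurable t A : natural_filtration X t A -> measurable A.
Proof.
apply: smallest_sub; first exact: sigma_algebra_measurable.
move=> _ [s [G [s0 _ mG ->]]]; rewrite -[X in measurable X]setTI.
exact: (sbm_measurable hX s0).
Qed.

Lemma natural_filtration_le s t A : s <= t -> natural_filtration X s A ->
  natural_filtration X t A.
Proof.
move=> st; apply: sub_sigma_algebra2 => _ [r [G [r0 rs mG ->]]].
by exists r, G; split => //; exact: le_trans rs st.
Qed.

Lemma measurable_past t s (F : MF R d -> R) : 0 <= s -> s <= t ->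
  measurable_fun setT F ->
  measurable_fun (setT : set (g_sigma_algebraType (past t))) (fun w => F (X s w)).
Proof.
move=> s0 st mF _ B mB; rewrite setTI; apply: sub_gen_smallest.
exists s, (F @^-1` B); split => //.
by rewrite -[X in measurable X]setTI; exact: mF.
Qed.

Lemma measurable_integral_law t Phi : 0 <= t -> measurable_fun setT Phi ->
  (forall nu, (0 <= Phi nu)%E) ->
  measurable_fun setT (fun nu => \int[P nu]_w Phi (X t w))%E.
Proof.
move=> t0 mPhi Phi0.
rewrite (_ : (fun nu => _) =
    (fun nu => \int[image_measure (sbm_measurable hX t0) (P nu)]_v Phi v)%E); last first.
  by apply/funext => nu; rewrite integral_image_measure.
apply: (measurable_fun_integral_kernel
  (l := fun nu => image_measure (sbm_measurable hX t0) (P nu))) => // G mG.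
exact: (sbm_measurable_law hX t0 mG).
Qed.

(** For simple functionals this is [sbm_markov] applied to level sets; monotone convergence then
    passes to [Phi] in the left side, in the inner integral and in the outer one. *)
Lemma sbm_markov_integral mu s t A Phi : 0 <= s -> 0 <= t ->
  natural_filtration X s A -> measurable_fun setT Phi -> (forall nu, (0 <= Phi nu)%E) ->
  (\int[P mu]_(w in A) Phi (X (s + t) w) =
   \int[P mu]_(w in A) \int[P (X s w)]_v Phi (X t v))%E.
Proof.
move=> s0 t0 FA mPhi Phi0.
have mA := natural_filtration_measurable FA.
have st0 : 0 <= s + t by rewrite addr_ge0.
have mX := sbm_measurable hX.
pose h := nnsfun_approx measurableT mPhi.
have hPhi nu : (h n nu)%:E @[n --> \oo] --> Phi nu.
  by apply: (cvg_nnsfun_approx measurableT mPhi) => // ? _.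
have hnd nu : {homo (fun n => (h n nu)%:E) : m n / (m <= n)%N >-> (m <= n)%E}.
  move=> m n mn; rewrite lee_fin.
  by have /lefP := nd_nnsfun_approx measurableT mPhi mn; exact.
have mh n : measurable_fun setT (fun nu => (h n nu)%:E) by exact/measurable_EFinP.
have inner nu : (\int[P nu]_v (h n (X t v))%:E)%E @[n --> \oo] -->
    (\int[P nu]_v Phi (X t v))%E.
  have -> : (\int[P nu]_v Phi (X t v) = \int[P nu]_v limn (fun n => (h n (X t v))%:E))%E.
    by apply: eq_integral => v _; apply/esym/cvg_lim => //; exact: hPhi.
  apply: cvg_monotone_convergence => //.
  - by move=> n; exact: (measurableT_comp (mh n) (mX _ t0)).
  - by move=> n v _; rewrite lee_fin.
have lhs : (\int[P mu]_(w in A) (h n (X (s + t) w))%:E)%E @[n --> \oo] -->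
    (\int[P mu]_(w in A) Phi (X (s + t) w))%E.
  have -> : (\int[P mu]_(w in A) Phi (X (s + t) w) =
      \int[P mu]_(w in A) limn (fun n => (h n (X (s + t) w))%:E))%E.
    by apply: eq_integral => v _; apply/esym/cvg_lim => //; exact: hPhi.
  apply: cvg_monotone_convergence => //.
  - by move=> n; apply: measurable_funTS; exact: (measurableT_comp (mh n) (mX _ st0)).
  - by move=> n v _; rewrite lee_fin.
have rhs : (\int[P mu]_(w in A) \int[P (X s w)]_v (h n (X t v))%:E)%E @[n --> \oo] -->
    (\int[P mu]_(w in A) \int[P (X s w)]_v Phi (X t v))%E.
  have -> : (\int[P mu]_(w in A) \int[P (X s w)]_v Phi (X t v) =
      \int[P mu]_(w in A) limn (fun n => \int[P (X s w)]_v (h n (X t v))%:E))%E.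
    by apply: eq_integral => w _; apply/esym/cvg_lim => //; exact: inner.
  apply: cvg_monotone_convergence => //.
  - move=> n; apply: measurable_funTS.
    have mI : measurable_fun setT (fun nu => \int[P nu]_v (h n (X t v))%:E)%E.
      by apply: (measurable_integral_law t0 (mh n)) => nu; rewrite lee_fin.
    exact: (measurableT_comp mI (mX _ s0)).
  - by move=> n w _; apply: integral_ge0 => v _; rewrite lee_fin.
  - move=> w _ m n mn; apply: ge0_le_integral => //.
    + by move=> v _; rewrite lee_fin.
    + exact: (measurableT_comp (mh m) (mX _ t0)).
    + exact: (measurableT_comp (mh n) (mX _ t0)).
    + by move=> v _; exact: hnd.
rewrite -(cvg_lim _ lhs)// -(cvg_lim _ rhs)//; congr (limn _); apply/funext => n.
have mpre r : measurable (h n @^-1` [set r]) by [].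
have mlaw r : measurable_fun setT (fun w => P (X s w) (X t @^-1` (h n @^-1` [set r]))).
  exact: (measurableT_comp (sbm_measurable_law hX t0 (mpre r)) (mX _ s0)).
rewrite (integral_nnsfun_comp _ (h n) mA (mX _ st0)).
transitivity (\int[P mu]_(w in A) \sum_(r \in range (h n))
    (r%:E * P (X s w) (X t @^-1` (h n @^-1` [set r]))))%E; last first.
  apply: eq_integral => w _; rewrite (integral_nnsfun_comp _ (h n) measurableT (mX _ t0)).
  by apply: eq_fsbigr => r _; rewrite setTI.
(* A value outside the range, in particular a negative one, has an empty preimage, and its term is
   zero. *)
have r0 r v : (0 <= r%:E * P v (X t @^-1` (h n @^-1` [set r])))%E.
  have [[nu _ <-]|nr] := pselect (range (h n) r).
    by rewrite mule_ge0// lee_fin.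
  rewrite preimage10 ?preimage_set0 ?measure0 ?mule0//.
rewrite ge0_integral_fsum//; last 1 first.
  by move=> r; apply: measurable_funTS; exact: measurable_funeM.
apply: eq_fsbigr => r; rewrite inE => -[nu _ <-].
rewrite ge0_integralZl ?lee_fin//; last by apply: measurable_funTS; exact: mlaw.
by congr (_ * _)%E; exact: (sbm_markov hX).
Qed.

(** With [s + t] as terminal time this is the martingale property, in the form that compares each
    time with the last one. *)
Lemma sbm_markov_pairing mu s t A f K : 0 <= s -> 0 <= t ->
  natural_filtration X s A -> bounded_borel K f ->
  (\int[P mu]_(w in A) (\int[X (s + t) w]_y f y)%:E =
   \int[P mu]_(w in A) (\int[X s w]_y growth t f y)%:E)%E.
Proof.
move=> s0 t0 FA fK.
rewrite (sbm_markov_integral mu s0 t0 FA (Phi := fun nu => (\int[nu]_y f y)%R%:E)).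
- by apply: eq_integral => w _; exact: (sbm_moments alpha0 beta0 hX _ t0 fK).1.
- by apply/measurable_EFinP; exact: measurable_MF_pairing fK.
- by move=> nu; rewrite lee_fin (pairing_ge0 nu fK).
Qed.

Lemma natural_filtrationT s : natural_filtration X s setT.
Proof. by rewrite -setC0 -setTD; apply: sigma_algebraCD; exact: sigma_algebra0. Qed.

(* The Chapman-Kolmogorov equation is read off the Markov property at [\d_y]. *)
Lemma growth_growth s t f K y : 0 <= s -> 0 <= t -> bounded_borel K f ->
  growth s (growth t f) y = growth (s + t) f y.
Proof.
move=> s0 t0 fK.
pose mu : MF R d := \d_y.
have gK := bounded_borel_growth beta t0 fK.
have := sbm_markov_pairing mu s0 t0 (@natural_filtrationT s) fK.
rewrite (sbm_moments alpha0 beta0 hX mu (addr_ge0 s0 t0) fK).1.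
rewrite (sbm_moments alpha0 beta0 hX mu s0 gK).1.
rewrite (dirac_pairing y (bounded_borel_growth beta (addr_ge0 s0 t0) fK)).
by rewrite (dirac_pairing y (bounded_borel_growth beta s0 gK)) => -[].
Qed.

Definition dyadic s T m k : R := s + (T - s) * (k%:R / 2 ^+ m).

Lemma dyadic0 s T m : dyadic s T m 0 = s.
Proof. by rewrite /dyadic mul0r mulr0 addr0. Qed.

Lemma dyadic_last s T m : dyadic s T m (2 ^ m) = T.
Proof. by rewrite /dyadic natrX divff ?expf_neq0// mulr1 subrKC. Qed.

Lemma dyadic_double s T m k : dyadic s T m.+1 (2 * k) = dyadic s T m k.
Proof. by rewrite /dyadic natrM exprS -mulf_div divff// mul1r. Qed.

Lemma le_dyadic s T m i j : s <= T -> (i <= j)%N -> dyadic s T m i <= dyadic s T m j.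
Proof.
by move=> sT ij; rewrite lerD2l ler_wpM2l ?subr_ge0// ler_wpM2r ?ler_nat.
Qed.

Lemma dyadic_ge s T m k : s <= T -> s <= dyadic s T m k.
Proof. by move=> sT; rewrite -[leLHS](dyadic0 s T m) le_dyadic. Qed.

Lemma dyadic_le s T m k : s <= T -> (k <= 2 ^ m)%N -> dyadic s T m k <= T.
Proof. by move=> sT km; rewrite -[leRHS](dyadic_last s T m) le_dyadic. Qed.

(** Covers negative times as well, because the maximal inequality wants [M k] nonnegative at every
    index, also past the end of the grid. *)
Lemma heat_ge0 t f x : (forall y, 0 <= f y) -> 0 <= heat t f x.
Proof.
move=> f0; rewrite /heat /brownian_semigroup; case: eqP => _; first exact: f0.
by apply: fine_ge0; apply: integral_ge0 => y _; rewrite lee_fin mulr_ge0 ?heat_kernel_ge0.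
Qed.

(** Given the past up to [s], the variance bound of [sbm_moments] is linear in the mass at time [s],
    whose mean is [expR (beta * s)] times the initial mass. *)
Lemma sbm_second_moment_increment mu s t f K : 0 <= s -> 0 <= t -> bounded_borel K f ->
  (\int[P mu]_w ((\int[X (s + t) w]_y f y) ^+ 2)%:E <=
   \int[P mu]_w ((\int[X s w]_y growth t f y) ^+ 2)%:E +
   (4 * (alpha * K ^+ 2 * expR (2 * beta * t) * t * (expR (beta * s) * \int[mu]_y 1)))%:E)%E.
Proof.
move=> s0 t0 fK; have gK := bounded_borel_growth beta t0 fK.
have b1 : bounded_borel 1 (cst 1 : 'rV[R]_d -> R) by exact: bounded_borel_cst.
rewrite (sbm_markov_integral mu s0 t0 (@natural_filtrationT s)
  (Phi := fun nu => ((\int[nu]_y f y) ^+ 2)%R%:E)); last 2 first.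
- by apply/measurable_EFinP; apply: measurable_funX; exact: measurable_MF_pairing fK.
- by move=> nu; rewrite lee_fin sqr_ge0.
pose c := 4 * (alpha * K ^+ 2 * expR (2 * beta * t) * t).
have K0 := bounded_borel_bound fK.
have c0 : 0 <= c.
  by rewrite /c; apply: mulr_ge0 => //; rewrite !mulr_ge0 ?expR_ge0 ?sqr_ge0.
have m1 := measurable_sbm_pairing hX s0 b1.
have mg := measurable_sbm_pairing hX s0 gK.
have -> : 4 * (alpha * K ^+ 2 * expR (2 * beta * t) * t * (expR (beta * s) * \int[mu]_y 1)) =
    c * \int[mu]_y growth s (cst 1) y.
  have -> : \int[mu]_y growth s (cst 1) y = expR (beta * s) * \int[mu]_y 1.
    rewrite -(pairingZ mu _ b1); apply: eq_Rintegral => y _.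
    by rewrite growth_cst.
  by rewrite /c; ring.
rewrite EFinM -(sbm_moments alpha0 beta0 hX mu s0 b1).1.
rewrite -ge0_integralZ_EFin//; last by move=> w; exact: pairing_ge0 b1.
rewrite -ge0_integralD_EFin//; last 4 first.
- exact: measurable_funX.
- exact: measurable_funM.
- by move=> w; exact: sqr_ge0.
- by move=> w; rewrite mulr_ge0// (pairing_ge0 _ b1).
apply: ge0_le_integral => //.
- by move=> w _; apply: integral_ge0 => v _; rewrite lee_fin sqr_ge0.
- have mI : measurable_fun setT (fun nu => \int[P nu]_v ((\int[X t v]_y f y) ^+ 2)%:E)%E.
    apply: (measurable_integral_law t0 (Phi := fun nu => ((\int[nu]_y f y) ^+ 2)%R%:E)).
      by apply/measurable_EFinP; apply: measurable_funX; exact: measurable_MF_pairing fK.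
    by move=> nu; rewrite lee_fin sqr_ge0.
  exact: (measurableT_comp mI (sbm_measurable hX s0)).
- apply/measurable_EFinP; apply: measurable_funD; first exact: measurable_funX.
  exact: measurable_funM.
- move=> w _; have := (sbm_moments alpha0 beta0 hX (X s w) t0 fK).2.
  by rewrite /c mulrA.
Qed.

(** The bound for a grid of [2 ^ m] steps does not depend on [m], and the exceedance events grow
    under refinement, so continuity from below covers all dyadic times at once. *)
Lemma sbm_maximal_inequality mu s T f K lam :
  0 <= s -> s <= T -> bounded_borel K f -> 0 < lam ->
  exists2 E, measurable E /\ ((lam ^+ 2)%:E * P mu E <=
      (4 * (alpha * K ^+ 2 * expR (2 * beta * (T - s)) * (T - s) *
        (expR (beta * s) * \int[mu]_y 1)))%:E)%E &
    forall w, ~ E w -> forall m k, (k <= 2 ^ m)%N ->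
      `|\int[X (dyadic s T m k) w]_y growth (T - dyadic s T m k) f y -
        \int[X s w]_y growth (T - s) f y| <= lam.
Proof.
move=> s0 sT fK lam0.
set c := 4 * _.
pose M m k w := \int[X (dyadic s T m k) w]_y growth (T - dyadic s T m k) f y.
pose B m := \bigcup_(k in [set k | (k <= 2 ^ m)%N])
  [set w | lam < `|M m k w - M m 0 w|].
have q0 m k : 0 <= dyadic s T m k by rewrite (le_trans s0)// dyadic_ge.
have gK m k : (k <= 2 ^ m)%N -> bounded_borel (expR (beta * (T - dyadic s T m k)) * K)
    (growth (T - dyadic s T m k) f).
  by move=> km; apply: bounded_borel_growth => //; rewrite subr_ge0 dyadic_le.
have mM m k : (k <= 2 ^ m)%N -> measurable_fun setT (M m k).
  by move=> km; exact: (measurable_sbm_pairing hX (q0 m k) (gK m k km)).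
have B_le m : ((lam ^+ 2)%:E * P mu (B m) <= c%:E)%E.
  apply: (@weak_maximal_inequality R _ Omega (P mu)
    (fun k => past (dyadic s T m k)) (M m) (2 ^ m)%N lam c).
  - by move=> k A; exact: natural_filtration_measurable.
  - by move=> i j A ij; apply: natural_filtration_le; exact: le_dyadic.
  - move=> k km.
    exact: (measurable_past (q0 m k) (lexx _) (measurable_MF_pairing (gK m k km))).
  - move=> k w; apply: Rintegral_ge0 => y _; rewrite mulr_ge0 ?expR_ge0//.
    by apply: heat_ge0; exact: bounded_borel_ge0 fK.
  - move=> k A km FA; rewrite /M.
    have Tq : 0 <= T - dyadic s T m k by rewrite subr_ge0 dyadic_le.
    rewrite -(sbm_markov_pairing mu (q0 m k) Tq FA fK) subrKC dyadic_last subrr.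
    by apply: eq_integral => w _; congr EFin; apply: eq_Rintegral => y _; rewrite growth0.
  - move=> k km.
    apply: le_lt_trans (sbm_moments alpha0 beta0 hX mu (q0 m k) (gK m k km)).2 _.
    exact: ltry.
  - rewrite /M dyadic0 dyadic_last subrr.
    have Ts : 0 <= T - s by rewrite subr_ge0.
    have := sbm_second_moment_increment mu s0 Ts fK; rewrite subrKC => H.
    apply: le_trans H; rewrite le_eqVlt; apply/orP; left; apply/eqP.
    apply: eq_integral => w _; congr (_ ^+ 2)%:E; apply: eq_Rintegral => y _.
    by rewrite growth0.
  - exact: lam0.
have mB m : measurable (B m).
  apply: bigcup_measurable => k /= km.
  have mh : measurable_fun setT (fun w => `|M m k w - M m 0 w|).
    by apply: measurableT_comp => //; apply: measurable_funB; exact: mM.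
  have := mh measurableT `]lam, +oo[%classic (measurable_itv _).
  rewrite setTI; congr (measurable _); apply/seteqP; split => w /=.
    by rewrite in_itv/= andbT.
  by rewrite in_itv/= andbT.
have Bnd : nondecreasing_seq B.
  apply/nondecreasing_seqP => m; apply/subsetPset => w [k /= km h].
  exists (2 * k)%N; first by rewrite /= expnS leq_pmul2l.
  by move: h; rewrite /= /M !dyadic0 dyadic_double.
exists (\bigcup_m B m).
  split; first exact: bigcup_measurable.
  have lim : ((lam ^+ 2)%:E * P mu (B m))%E @[m --> \oo] -->
      ((lam ^+ 2)%:E * P mu (\bigcup_m B m))%E.
    apply: cvgeZl => //; apply: nondecreasing_cvg_mu => //.
    exact: bigcup_measurable.
  rewrite -(cvg_lim _ lim)//; apply: lime_le; last exact: nearW.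
  by apply/cvg_ex; eexists; exact: lim.
move=> w Ew m k km; rewrite leNgt; apply/negP => h; apply: Ew.
by exists m => //; exists k => //=; rewrite /M dyadic0.
Qed.

End super_brownian_markov.

(** * Almost sure convergence from summable bounds *)

Section summability.
Context {R : realType}.

Lemma sum_inv_sqr_le N : \sum_(i < N) (i.+1%:R ^+ 2)^-1 <= 2 :> R.
Proof.
suff H n : \sum_(i < n.+1) (i.+1%:R ^+ 2)^-1 <= 2 - n.+1%:R^-1 :> R.
  case: N => [|n]; first by rewrite big_ord0.
  by rewrite (le_trans (H n))// gerBl.
elim: n => [|n IHn].
  by rewrite big_ord_recl big_ord0 addr0 expr1n invr1; lra.
rewrite big_ord_recr/=.
have n1 : 0 < n.+1%:R :> R by [].
have n2 : 0 < n.+2%:R :> R by [].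
have : (n.+2%:R ^+ 2)^-1 <= n.+1%:R^-1 - n.+2%:R^-1 :> R.
  have -> : n.+1%:R^-1 - n.+2%:R^-1 = (n.+1%:R * n.+2%:R)^-1 :> R.
    rewrite -[n.+2%:R]natr1; field.
    by rewrite !gt_eqF// natr1.
  by rewrite lef_pV2 ?posrE ?exprn_gt0 ?mulr_gt0// expr2 ler_wpM2r// ler_nat.
by move=> h; apply: le_trans (lerD IHn h) _; rewrite addrA subrK.
Qed.

(** Raise [y <= expR y] at [y = b * n.+1 / k.+1] to the power [k.+1]; the factor [expR b] pays for
    passing from [n] to [n.+1]. *)
Lemma expn_le_expR (b : R) k : 0 < b ->
  exists2 C : R, 0 <= C & forall n : nat, n.+1%:R ^+ k <= C * expR (b * n%:R).
Proof.
move=> b0; exists ((k.+1%:R / b) ^+ k.+1 * expR b).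
  by rewrite mulr_ge0 ?expR_ge0// exprn_ge0// divr_ge0// ltW.
move=> n; rewrite -mulrA -expRD.
have -> : b + b * n%:R = k.+1%:R * (b * n.+1%:R / k.+1%:R).
  by rewrite [RHS]mulrC divfK// -[n.+1%:R]natr1; ring.
rewrite expRM_natl -exprMn.
apply: (@le_trans _ _ (n.+1%:R ^+ k.+1)).
  by rewrite exprS ler_peMl ?exprn_ge0// ler1n.
have c0 : 0 <= k.+1%:R / b by rewrite divr_ge0// ltW.
rewrite lerXn2r ?nnegrE//; first by apply: mulr_ge0 => //; exact: expR_ge0.
have h : b * n.+1%:R / k.+1%:R <= expR (b * n.+1%:R / k.+1%:R).
  by apply: le_trans (expR_ge1Dx _); rewrite lerDr.
rewrite [leLHS](_ : _ = k.+1%:R / b * (b * n.+1%:R / k.+1%:R)).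
  by rewrite ler_wpM2l.
by field; rewrite (gt_eqF b0) nat1r pnatr_eq0.
Qed.

Lemma expn_expRN_le (b : R) k : 0 < b -> exists2 C : R, 0 <= C &
  forall n : nat, n.+1%:R ^+ k * expR (- (b * n%:R)) <= C / n.+1%:R ^+ 2.
Proof.
move=> b0; have [C C0 CE] := expn_le_expR (k + 2) b0; exists C => // n.
rewrite expRN ler_pdivlMr ?exprn_gt0// mulrAC ler_pdivrMr ?expR_gt0//.
by rewrite -exprD.
Qed.

Context d (T : measurableType d) (mu : {measure set T -> \bar R}).

(** The series of the [Z n] has a finite mean, so it is finite almost everywhere and its terms tend
    to zero. *)
Lemma ae_cvg0 (Z : nat -> T -> R) (C : R) :
  (forall n, measurable_fun setT (Z n)) -> (forall n w, 0 <= Z n w) ->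
  (forall n, (\int[mu]_w (Z n w)%:E <= (C / n.+1%:R ^+ 2)%:E)%E) ->
  {ae mu, forall w, Z n w @[n --> \oo] --> 0}.
Proof.
move=> mZ Z0 ZC.
have C0 : 0 <= C.
  rewrite -lee_fin; have := ZC 0%N; rewrite expr1n divr1; apply: le_trans.
  by apply: integral_ge0 => w _; rewrite lee_fin.
pose S w := (\sum_(0 <= n <oo) (Z n w)%:E)%E.
have mS : measurable_fun setT S.
  apply: ge0_emeasurable_sum => [k w _ _|k _]; first by rewrite lee_fin.
  exact/measurable_EFinP.
have S0 w : (0 <= S w)%E by apply: nneseries_ge0 => n _ _; rewrite lee_fin.
have IS : (\int[mu]_w S w <= (C * 2)%:E)%E.
  rewrite /S integral_nneseries//; last 2 first.
  - by move=> n; exact/measurable_EFinP.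
  - by move=> n w _; rewrite lee_fin.
  apply: lime_le.
    by apply: is_cvg_nneseries => n _ _; apply: integral_ge0 => w _; rewrite lee_fin.
  apply: nearW => n; rewrite big_mkord.
  apply: (@le_trans _ _ (\sum_(i < n) (C / i.+1%:R ^+ 2)%:E)%E).
    by apply: lee_sum => i _; exact: ZC.
  by rewrite sumEFin lee_fin -mulr_sumr ler_wpM2l// sum_inv_sqr_le.
have intS : mu.-integrable setT S.
  apply/integrableP; split => //.
  under eq_integral do rewrite gee0_abs//.
  by rewrite (le_lt_trans IS)// ltry.
apply: filterS (integrable_ae measurableT intS) => w /(_ I) finS.
apply: cvg_series_cvg_0.
apply: nondecreasing_is_cvgn.
  apply/nondecreasing_seqP => n; rewrite /series /= big_nat_recr//=.
  by rewrite lerDl.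
exists (fine (S w)) => _ [n _ <-].
rewrite -lee_fin fineK// /series /= -sumEFin.
by apply: nneseries_lim_ge => k _; rewrite lee_fin.
Qed.

(** Borel-Cantelli, from [ae_cvg0] for indicators: an indicator that tends to zero is eventually
    zero. *)
Lemma ae_not_eventually (E : nat -> set T) (C : R) : (forall n, measurable (E n)) ->
  (forall n, (mu (E n) <= (C / n.+1%:R ^+ 2)%:E)%E) ->
  {ae mu, forall w, \forall n \near \oo, ~ E n w}.
Proof.
move=> mE EC.
have : {ae mu, forall w, (\1_(E n) w : R) @[n --> \oo] --> 0}.
  apply: (@ae_cvg0 _ C) => n.
  - exact: measurable_indic.
  - by move=> w; rewrite indicE.
  - by rewrite integral_indic// setIT.
apply: filterS => w /cvgrPdist_lt /(_ 1 ltr01); apply: filterS => n.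
rewrite sub0r normrN indicE => h Ew; move: h.
by rewrite mem_set// normr1 ltxx.
Qed.

End summability.

(** * Density of dyadic times and convergence from summable increments *)

Section dyadic_density.
Context {R : realType}.

Lemma dyadic_dense (s T a b : R) : s <= a -> a < b -> b <= T ->
  exists m k, (k <= 2 ^ m)%N /\ a < dyadic s T m k < b.
Proof.
move=> sa ab bT.
have D0 : 0 < T - s by rewrite subr_gt0; lra.
pose r := (b - a) / (T - s).
have r0 : 0 < r by rewrite divr_gt0// subr_gt0.
pose m := (Num.truncn r^-1).+1.
have m2 : r^-1 < 2 ^+ m.
  apply: (@lt_trans _ _ m%:R); first exact: truncnS_gt.
  by rewrite -natrX ltr_nat ltn_expl.
have p0 : 0 < 2 ^+ m :> R by rewrite exprn_gt0.
pose x := (a - s) / (T - s).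
have x0 : 0 <= x by rewrite /x divr_ge0 ?(ltW D0) ?subr_ge0.
have x1 : x + r <= 1.
  by rewrite /x /r -mulrDl ler_pdivrMr// mul1r; lra.
have y0 : 0 <= x * 2 ^+ m by rewrite mulr_ge0// ltW.
pose k := (Num.truncn (x * 2 ^+ m)).+1.
have k1 : x * 2 ^+ m < k%:R by exact: truncnS_gt.
have k2 : k%:R <= x * 2 ^+ m + 1.
  by rewrite /k -natr1 lerD2r truncn_le.
have kr : k%:R < (x + r) * 2 ^+ m.
  rewrite (le_lt_trans k2)// mulrDl ltrD2l mulrC -ltr_pdivrMr// mul1r.
  exact: m2.
exists m, k; split.
  rewrite -(ler_nat R) natrX ltW// (lt_le_trans kr)// ler_piMl// ltW//.
rewrite /dyadic; apply/andP; split.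
  rewrite -ltrBlDl -ltr_pdivrMl// mulrC ltr_pdivlMr//.
rewrite -ltrBrDl -ltr_pdivlMl// ltr_pdivrMr//.
rewrite (_ : _^-1 * (b - s) = x + r)//.
by rewrite /x /r -mulrDl mulrC; congr (_ * _); ring.
Qed.

End dyadic_density.

Section growing_martingale_limit.
Context {R : realType}.

(** The half-open windows have length two so that each contains the next integer: the increments
    between integers are then summable, and the oscillation inside a window vanishes. *)
Lemma cvg_of_inv_sqr_increments (F : R -> R) :
  (\forall n \near \oo, forall t, n%:R <= t < n%:R + 2 ->
    `|F t - F n%:R| <= (n.+1%:R ^+ 2)^-1) ->
  exists l : R, F t @[t --> +oo] --> l.
Proof.
move=> [N _ FN].
pose v k := F (k + N)%:R.
have cv : cvgn (series (fun k => v k.+1 - v k)).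
  apply: normed_cvg.
  suff : cvgn (fun n => \sum_(0 <= k < n) `|v k.+1 - v k|) by [].
  apply: nondecreasing_is_cvgn.
    by apply/nondecreasing_seqP => n; rewrite big_nat_recr//= lerDl.
  exists 2 => _ [n _ <-]; rewrite big_mkord.
  apply: le_trans (sum_inv_sqr_le n); apply: ler_sum => i _.
  apply: (@le_trans _ _ (((i + N).+1%:R ^+ 2)^-1)).
    apply: FN; first by rewrite /= leq_addl.
    by rewrite /v addSn ler_nat leqnSn/= -[(i + N).+1%:R]natr1 ltrD2l ltr1n.
  by rewrite lef_pV2 ?posrE ?exprn_gt0// lerXn2r ?nnegrE// ler_nat ltnS leq_addr.
have {}cv : cvgn v.
  have -> : v = (fun n => series (fun k => v k.+1 - v k) n + v 0%N).
    by apply/funext => n; rewrite /series /= telescope_sumr// subrK.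
  by apply: is_cvgD => //; exact: is_cvg_cst.
have /cvg_ex[l vl] := cv; exists l.
have Fl : F n%:R @[n --> \oo] --> l by rewrite -(cvg_shiftn N).
apply/cvgrPdist_le => e e0.
have e20 : 0 < e / 2 by rewrite divr_gt0.
have /cvgrPdist_le /(_ _ e20) [N1 _ lN] := Fl.
have [N2 _ iN] : \forall n \near \oo, (n.+1%:R ^+ 2)^-1 <= e / 2 :> R.
  have : (n.+1%:R)^-1 @[n --> \oo] --> (0 : R) by exact: cvg_harmonic.
  move=> /cvgrPdist_le /(_ _ e20); apply: filterS => n.
  rewrite sub0r normrN ger0_norm ?invr_ge0//; apply: le_trans.
  by rewrite lef_pV2 ?posrE ?exprn_gt0// ler_eXnr// ler1n.
exists (maxn N (maxn N1 N2))%:R; split; first exact: num_real.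
move=> t tM; pose n := Num.truncn t.
have t0 : 0 <= t by rewrite (le_trans _ (ltW tM)).
have /andP[nt tn] := truncn_itv t0.
have nM : (maxn N (maxn N1 N2) <= n)%N by rewrite truncn_ge_nat// ltW.
move: nM; rewrite !geq_max => /and3P[nN nN1 nN2].
have h1 := FN n nN t; have h2 := lN n nN1; have h3 := iN n nN2.
have {}h1 : `|F t - F n%:R| <= (n.+1%:R ^+ 2)^-1.
  apply: h1; rewrite nt/= (lt_trans tn)// -natr1 ltrD2l ltr1n//.
rewrite [e]splitr (le_trans (ler_distD (F n%:R) _ _))// lerD//.
by rewrite distrC (le_trans h1).
Qed.

End growing_martingale_limit.

(** * From dyadic times to all times, and convergence of the mass *)

Section super_brownian_paths.
Context {R : realType} {d : nat} {alpha beta : R}.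
Hypotheses (alpha0 : 0 <= alpha) (beta0 : 0 < beta).
Context {dO : measure_display} {Omega : measurableType dO}.
Context {X : R -> Omega -> MF R d} {P : MF R d -> probability Omega R}.
Hypothesis hX : super_brownian_motion alpha beta X P.
Implicit Types (nu : MF R d) (f g : 'rV[R]_d -> R) (K L r s t T eta lam delta : R).
Local Notation growth := (growth beta).

Lemma pairing_sub_le nu f g K L delta : bounded_borel K f -> bounded_borel L g ->
  (forall y, `|f y - g y| <= delta) ->
  `|\int[nu]_y f y - \int[nu]_y g y| <= delta * \int[nu]_y 1.
Proof.
move=> fK gL fg.
have delta0 : 0 <= delta by rewrite (le_trans _ (fg 0)).
have dd := bounded_borel_cst (d := d) delta0.
rewrite -pairing_cst ler_norml lerBrDr lerBlDr addrC lerBlDr.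
rewrite -(pairingD nu fK dd) [_ + \int[nu]_y g y]addrC -(pairingD nu gL dd).
apply/andP; split.
- apply: (le_pairing nu gL (bounded_borelD fK dd)) => y /=.
  by have := fg y; rewrite ler_norml; lra.
- apply: (le_pairing nu fK (bounded_borelD gL dd)) => y /=.
  by have := fg y; rewrite ler_norml; lra.
Qed.

Definition mass t w : R := expR (- beta * t) * \int[X t w]_y 1.

Lemma sbm_right_cvg w t f K : 0 <= t -> bounded_borel K f -> continuous f ->
  \int[X s w]_y f y @[s --> t^'+] --> \int[X t w]_y f y.
Proof.
move=> t0 fK cf.
have bf : continuous f /\ bounded_fun f.
  split => //; exists K; split; first exact: num_real.
  move=> M KM y _ /=; rewrite ger0_norm ?(bounded_borel_ge0 fK)//.
  by rewrite (le_trans (bounded_borel_le fK _))// ltW.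
have h := ((sbm_cadlag hX) w).1 t t0.
exact: (@MF_cvgP R d ((X ^~ w) @ t^'+) _ (X t w)).1 h (exist _ f bf).
Qed.

Lemma pairing_growth nu t f K : 0 <= t -> bounded_borel K f ->
  \int[nu]_y growth t f y = expR (beta * t) * \int[nu]_y heat t f y.
Proof.
by move=> t0 fK; rewrite -(pairingZ nu _ (bounded_borel_heat t0 fK)).
Qed.

(** In the martingale the test function [growth (T - q) f] moves with [q], so right-continuity of
    paths does not apply to it directly. At a dyadic [q] it is replaced by the fixed [f], at the
    cost [delta * mass q w]; only pairings with [f] and with 1 are then followed down to [t]. The
    room between [t] and [T] provides such [q]. *)
Lemma sbm_path_bound w s T t f K eta delta :
  0 <= s -> s <= t -> t < T -> bounded_borel K f -> continuous f ->
  (forall r y, 0 <= r -> r <= T - t -> `|heat r f y - f y| <= delta) ->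
  (forall m k, (k <= 2 ^ m)%N ->
    `|\int[X (dyadic s T m k) w]_y growth (T - dyadic s T m k) f y -
      \int[X s w]_y growth (T - s) f y| <= expR (beta * T) * eta) ->
  `|expR (- beta * t) * \int[X t w]_y f y -
    expR (- beta * s) * \int[X s w]_y heat (T - s) f y| <= eta + delta * mass t w.
Proof.
move=> s0 st tT fK cf hf good.
have t0 : 0 <= t by exact: le_trans st.
have sT : s <= T by rewrite (le_trans st)// ltW.
set a := expR (- beta * s) * _.
pose G (q : R) : R := `|expR (- beta * q) * \int[X q w]_y f y - a| - delta * mass q w.
have cG : G q @[q --> t^'+] --> G t.
  have ce : expR (- beta * q) @[q --> t^'+] --> expR (- beta * t).
    apply: cvg_at_right_filter; apply: continuous_cvg; first exact: continuous_expR.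
    by apply: cvgM; [exact: cvg_cst|exact: cvg_id].
  have c1 : continuous (cst 1 : 'rV[R]_d -> R) by exact: cst_continuous.
  have b1 : bounded_borel 1 (cst 1 : 'rV[R]_d -> R) by exact: bounded_borel_cst.
  apply: cvgB.
    apply: cvg_norm; apply: cvgB; last exact: cvg_cst.
    by apply: cvgM => //; exact: sbm_right_cvg fK cf.
  apply: cvgM; first exact: cvg_cst.
  apply: cvgM => //.
  exact: (sbm_right_cvg t0 b1 c1).
rewrite -lerBlDr -/(G t) leNgt; apply/negP => etaG.
have : \forall q \near t^'+, eta < G q by exact: (cvgr_gt (G t) cG).
case => e /= e0 ball_e.
have [||m [k [km /andP[tq qb]]]] := @dyadic_dense R s T t (Num.min (t + e) T) st.
  by rewrite lt_min ltrDl e0.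
  by rewrite ge_min lexx orbT.
pose q := dyadic s T m k.
move: qb; rewrite lt_min -/q => /andP[qe qT].
have : eta < G q.
  apply: ball_e => //=; rewrite ltr_distlC; apply/andP; split => //.
  by rewrite (lt_trans _ tq)// ltrBlDr ltrDl.
apply/negP; rewrite -leNgt /G lerBlDr.
have q0 : 0 <= q by rewrite (le_trans t0)// ltW.
have Tq0 : 0 <= T - q by rewrite subr_ge0 ltW.
have Ts0 : 0 <= T - s by rewrite subr_ge0.
have := good m k km; rewrite -/q.
rewrite (pairing_growth _ Tq0 fK) (pairing_growth _ Ts0 fK).
pose b := \int[X q w]_y heat (T - q) f y.
move=> goodq.
have h1 : `|expR (- beta * q) * b - a| <= eta.
  have E r c : expR (beta * T) * (expR (- beta * r) * c) = expR (beta * (T - r)) * c.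
    by rewrite mulrA -expRD; congr (expR _ * _); ring.
  rewrite -(ler_pM2l (expR_gt0 (beta * T))).
  by rewrite -[X in X * `|_|]ger0_norm ?expR_ge0// -normrM mulrBr /a !E.
have h2 : `|expR (- beta * q) * \int[X q w]_y f y - expR (- beta * q) * b| <=
    delta * mass q w.
  rewrite -mulrBr normrM ger0_norm ?expR_ge0// /mass mulrCA ler_wpM2l ?expR_ge0//.
  apply: pairing_sub_le fK (bounded_borel_heat Tq0 fK) _ => y.
  by rewrite distrC hf// lerB// ltW.
rewrite [leRHS]addrC; apply: le_trans (ler_distD (expR (- beta * q) * b) _ _) _.
exact: lerD.
Qed.

Variable x : 'rV[R]_d.
Let mu : MF R d := \d_x.

(** The level [expR (beta * T) * eta] undoes the normalisation: the exponents [2 * beta * (T - s)],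
    [beta * s] and [- (2 * beta * T)] add up to [- (beta * s)]. One event serves every [t] before
    [T]. *)
Lemma sbm_good_event s T f K eta : 0 <= s -> s <= T -> 0 < eta ->
  bounded_borel K f -> continuous f ->
  exists2 E, measurable E /\
      (P mu E <= (4 * alpha * K ^+ 2 * (T - s) * expR (- (beta * s)) / eta ^+ 2)%:E)%E &
    forall w, ~ E w -> forall t delta, s <= t -> t < T ->
    (forall r y, 0 <= r -> r <= T - t -> `|heat r f y - f y| <= delta) ->
    `|expR (- beta * t) * \int[X t w]_y f y -
      expR (- beta * s) * \int[X s w]_y heat (T - s) f y| <= eta + delta * mass t w.
Proof.
move=> s0 sT eta0 fK cf.
pose lam := expR (beta * T) * eta.
have lam0 : 0 < lam by rewrite mulr_gt0 ?expR_gt0.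
have [E [mE PE] good] := sbm_maximal_inequality alpha0 (ltW beta0) hX mu s0 sT fK lam0.
exists E; last first.
  move=> w Ew t delta st tT hf; apply: sbm_path_bound s0 st tT fK cf hf _.
  exact: good.
split => //.
have PEfin : P mu E \is a fin_num by exact: fin_num_measure.
move: PE; rewrite -(fineK PEfin) -EFinM !lee_fin.
have b1 : bounded_borel 1 (cst 1 : 'rV[R]_d -> R) by exact: bounded_borel_cst.
rewrite (dirac_pairing x b1).
move=> PE; rewrite ler_pdivlMr ?exprn_gt0//.
rewrite -(ler_pM2l (expR_gt0 (2 * beta * T))).
have -> : expR (2 * beta * T) * (fine (P mu E) * eta ^+ 2) = lam ^+ 2 * fine (P mu E).
  have -> : expR (2 * beta * T) = expR (beta * T) ^+ 2.
    by rewrite expr2 -expRD; congr expR; ring.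
  by rewrite /lam; ring.
apply: (le_trans PE); rewrite le_eqVlt; apply/orP; left; apply/eqP.
have -> : 2 * beta * (T - s) = 2 * beta * T + (- (beta * s) - beta * s) by ring.
rewrite expRD mulr1.
have -> : expR (- (beta * s) - beta * s) = expR (- (beta * s)) * expR (- (beta * s)).
  by rewrite -expRD.
have : expR (- (beta * s)) * expR (beta * s) = 1 by rewrite -expRD addNr expR0.
set u := expR (- _); set v := expR (beta * s) => uv.
transitivity (4 * alpha * K ^+ 2 * (T - s) * expR (2 * beta * T) * u * (u * v)); first by ring.
by rewrite uv; ring.
Qed.

(** The good event for [f = 1], which the heat flow fixes, so [delta = 0]. With [eta = n.+1 ^- 2],
    dividing by [eta ^+ 2] costs [n.+1 ^+ 4], which the exponential absorbs. *)
Lemma mass_increments : {ae P mu, forall w, \forall n \near \oo,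
  forall t, n%:R <= t < n%:R + 2 -> `|mass t w - mass n%:R w| <= (n.+1%:R ^+ 2)^-1}.
Proof.
have b1 : bounded_borel 1 (cst 1 : 'rV[R]_d -> R) by exact: bounded_borel_cst.
have c1 : continuous (cst 1 : 'rV[R]_d -> R) by exact: cst_continuous.
have [C C0 CE] := expn_expRN_le 4 beta0.
have /choice[E EP] : forall n : nat, exists E, [/\ measurable E,
    (P mu E <= (8 * alpha * C / n.+1%:R ^+ 2)%:E)%E &
    forall w, ~ E w -> forall t, n%:R <= t < n%:R + 2 ->
      `|mass t w - mass n%:R w| <= (n.+1%:R ^+ 2)^-1].
  move=> n.
  have n2 : n%:R <= n%:R + 2 :> R by rewrite lerDl.
  have e0 : 0 < (n.+1%:R ^+ 2)^-1 :> R by rewrite invr_gt0 exprn_gt0.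
  have [E [mE PE] good] := sbm_good_event (ler0n R n) n2 e0 b1 c1.
  exists E; split => //.
    apply: (le_trans PE); rewrite lee_fin.
    have -> : n%:R + 2 - n%:R = 2 :> R by ring.
    have := ler_wpM2l (mulr_ge0 (ler0n R 8) alpha0) (CE n).
    rewrite [8 * alpha * (C / _)]mulrA; apply: le_trans.
    rewrite exprVn invrK expr1n -exprM le_eqVlt; apply/orP; left; apply/eqP.
    by ring.
  move=> w Ew t /andP[nt tn].
  have := good w Ew t 0 nt tn; rewrite mul0r addr0 => H.
  have Ts0 : 0 <= n%:R + 2 - n%:R :> R by rewrite subr_ge0.
  have h1 : heat (n%:R + 2 - n%:R) (cst 1) = cst 1 :> ('rV[R]_d -> R).
    by apply/funext => y; rewrite heat_cst.
  rewrite h1 in H; apply: H => r y r0 _.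
  by rewrite heat_cst// subrr normr0.
have mE n : measurable (E n) by have [] := EP n.
have PE n : (P mu (E n) <= (8 * alpha * C / n.+1%:R ^+ 2)%:E)%E by have [] := EP n.
apply: filterS (ae_not_eventually mE PE) => w; apply: filterS => n.
by have [_ _] := EP n; exact.
Qed.

End super_brownian_paths.

(** * Uniform approximation on quartic time blocks *)

Section time_blocks.
Context {R : realType} {d : nat} {alpha beta : R}.
Hypotheses (alpha0 : 0 <= alpha) (beta0 : 0 < beta).
Context {dO : measure_display} {Omega : measurableType dO}.
Context {X : R -> Omega -> MF R d} {P : MF R d -> probability Omega R}.
Hypothesis hX : super_brownian_motion alpha beta X P.
Implicit Types (f g : 'rV[R]_d -> R) (K L r s t T eta delta : R).
Local Notation mass := (@mass R d beta dO Omega X).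
Variable x : 'rV[R]_d.
Let mu : MF R d := \d_x.

(* With [eta = (n+1)^-p], the terminal times [T] run through the grid of mesh
   [eta^3]; the union over its [(n+1)^(4+3p)] points costs a power of [n], which
   the factor [expR (- beta * n)] of the maximal inequality absorbs. *)
Lemma sbm_block_approximation f K L p : 0 <= L -> bounded_borel K f ->
  (forall y z, `|f y - f z| <= L * `|y - z|) ->
  {ae P mu, forall w, \forall n \near \oo,
    forall t, n%:R ^+ 4 <= t -> t < n.+1%:R ^+ 4 ->
    exists T : R, [/\ t < T, T <= t + 1 &
      `|expR (- beta * t) * \int[X t w]_y f y -
        expR (- beta * n%:R) * \int[X n%:R w]_y heat (T - n%:R) f y| <=
      (n.+1%:R ^+ p)^-1 * (1 + (L + 4 * K * d%:R) * mass t w)]}.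
Proof.
move=> L0 fK fL; have K0 := bounded_borel_bound fK.
have cf : continuous f by exact: lipschitz_continuous fL.
(* The exponent collects [4 + 3 * p] from the number of grid points, 4 from the length of [T - s],
   and [2 * p] from [eta ^- 2]. *)
have [C C0 CE] := expn_expRN_le (8 + 5 * p) beta0.
have /choice[E EP] : forall n : nat, exists E, [/\ measurable E,
    (P mu E <= (4 * alpha * K ^+ 2 * C / n.+1%:R ^+ 2)%:E)%E &
    forall w, ~ E w -> forall t, n%:R ^+ 4 <= t -> t < n.+1%:R ^+ 4 ->
    exists T : R, [/\ t < T, T <= t + 1 &
      `|expR (- beta * t) * \int[X t w]_y f y -
        expR (- beta * n%:R) * \int[X n%:R w]_y heat (T - n%:R) f y| <=
      (n.+1%:R ^+ p)^-1 * (1 + (L + 4 * K * d%:R) * mass t w)]].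
  move=> n.
  have [eta etaE] : exists eta : R, eta = (n.+1%:R ^+ p)^-1 by exists (n.+1%:R ^+ p)^-1.
  have n1 : 1 <= n.+1%:R :> R by rewrite ler1n.
  have eta0 : 0 < eta by rewrite etaE invr_gt0 exprn_gt0.
  have eta1 : eta <= 1 by rewrite etaE invf_le1 ?exprn_gt0// exprn_ege1.
  have [h hE] : exists h : R, h = eta ^+ 3 by exists (eta ^+ 3).
  have h0 : 0 < h by rewrite hE exprn_gt0.
  have h1 : h <= 1 by rewrite hE exprn_ile1// ltW.
  have [J JE] : exists J : nat, J = (n.+1 ^ (4 + 3 * p))%N by exists (n.+1 ^ (4 + 3 * p))%N.
  have Jh : J%:R * h = n.+1%:R ^+ 4.
    have hn : h = (n.+1%:R ^+ (3 * p))^-1 by rewrite hE etaE exprVn -exprM mulnC.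
    by rewrite JE natrX hn exprD mulfK// expf_neq0// pnatr_eq0.
  have [q qE] : exists q : R,
      q = 4 * alpha * K ^+ 2 * n.+1%:R ^+ 4 * expR (- (beta * n%:R)) / eta ^+ 2 by eexists.
  have q0 : 0 <= q.
    by rewrite qE !mulr_ge0 ?expR_ge0 ?exprn_ge0// ?invr_ge0 ?exprn_ge0 ?ltW.
  have /choice[F FP] : forall j : nat, exists F, [/\ measurable F,
      (j < J)%N -> (P mu F <= q%:E)%E &
      n%:R <= j.+1%:R * h -> forall w, ~ F w -> forall t delta, n%:R <= t -> t < j.+1%:R * h ->
      (forall r y, 0 <= r -> r <= j.+1%:R * h - t -> `|heat r f y - f y| <= delta) ->
      `|expR (- beta * t) * \int[X t w]_y f y -
        expR (- beta * n%:R) * \int[X n%:R w]_y heat (j.+1%:R * h - n%:R) f y| <=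
      eta + delta * mass t w].
    (* Grid points before the starting time [n] receive the empty event. *)
    move=> j; have [nT|nT] := leP n%:R (j.+1%:R * h); last first.
      exists set0; split => //.
      by move=> _; rewrite measure0 lee_fin.
    have [F [mF PF] good] := sbm_good_event alpha0 beta0 hX x (ler0n R n) nT eta0 fK cf.
    exists F; split => // jJ; apply: (le_trans PF); rewrite lee_fin qE.
    rewrite ler_wpM2r ?invr_ge0 ?exprn_ge0 ?(ltW eta0)// ler_wpM2r ?expR_ge0//.
    rewrite ler_wpM2l ?mulr_ge0 ?exprn_ge0// lerBlDr.
    by rewrite (@le_trans _ _ (J%:R * h)) ?ler_pM2r ?ler_nat// Jh lerDl.
  have mF j : measurable (F j) by have [] := FP j.
  exists (\big[setU/set0]_(j < J) F j); split.
  - by apply: bigsetU_measurable => j _.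
  - apply: le_trans (Boole_inequality (P mu) (fun j _ => mF j)) _.
    apply: (@le_trans _ _ (\sum_(j < J) q%:E)%E).
      by apply: lee_sum => j _; have [_ h2 _] := FP j; exact: h2.
    rewrite sumEFin sumr_const card_ord lee_fin -[q *+ J]mulr_natl.
    have := ler_wpM2l (mulr_ge0 (mulr_ge0 (ler0n R 4) alpha0) (exprn_ge0 2 K0)) (CE n).
    rewrite [4 * alpha * K ^+ 2 * (C / _)]mulrA; apply: le_trans.
    rewrite qE JE natrX etaE exprVn invrK -exprM le_eqVlt; apply/orP; left; apply/eqP.
    have -> : (8 + 5 * p = (4 + 3 * p) + 4 + p * 2)%N by ring.
    by rewrite !exprD; ring.
  move=> w Ew t nt tn; rewrite -etaE.
  have t0 : 0 <= t by rewrite (le_trans _ nt)// exprn_ge0.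
  have [j jE] : exists j : nat, j = Num.truncn (t / h) by eexists.
  have th0 : 0 <= t / h by rewrite divr_ge0// ltW.
  have /andP[] := truncn_itv th0; rewrite -jE ler_pdivlMr// ltr_pdivrMr// => jt tj.
  have jJ : (j < J)%N.
    by rewrite -(ltr_nat R) -(ltr_pM2r h0) Jh (le_lt_trans jt).
  have nt' : n%:R <= t.
    apply: le_trans nt; case: (n) => [|m]; first by rewrite exprn_ge0.
    by rewrite ler_eXnr// ler1n.
  exists (j.+1%:R * h); split => //.
    by rewrite -natr1 mulrDl mul1r lerD.
  have [_ _ /(_ (le_trans nt' (ltW tj)) w) good] := FP j.
  rewrite mulrDr mulr1 mulrA [eta * (_ + _)]mulrC; apply: good => //.
    by move=> Fw; apply: Ew; rewrite (bigD1 (Ordinal jJ))//=; left.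
  move=> r y; rewrite le_eqVlt => /predU1P[<- _|r0 rT].
    by rewrite heat0 subrr normr0 mulr_ge0 ?addr_ge0 ?mulr_ge0// ltW.
  (* At spatial scale [eta] the error is [L * eta] plus a multiple of [r / eta ^+ 2]; the mesh
     [h = eta ^+ 3] makes both of order [eta]. *)
  apply: le_trans (heat_sub_lipschitz y r0 eta0 L0 fK fL) _.
  rewrite [leRHS]mulrDl lerD// -[leLHS]mulrA ler_wpM2l ?mulr_ge0//.
  rewrite ler_pdivrMr ?exprn_gt0// -exprS -hE (le_trans rT)//.
  by rewrite lerBlDl -natr1 mulrDl mul1r lerD2r.
have mE n : measurable (E n) by have [] := EP n.
have PE n : (P mu (E n) <= (4 * alpha * K ^+ 2 * C / n.+1%:R ^+ 2)%:E)%E by have [] := EP n.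
apply: filterS (ae_not_eventually mE PE) => w; apply: filterS => n.
by have [_ _] := EP n; exact.
Qed.

End time_blocks.

(** * Gaussian averages and their rate of convergence *)

Section gaussian_averages.
Context {R : realType} {d : nat}.
Implicit Types (f : 'rV[R]_d -> R) (x y z : 'rV[R]_d) (K rho r s : R).

Lemma ler_norm_coord y i : `|y ord0 i| <= `|y|.
Proof.
rewrite [leRHS]/Num.norm/= mx_normrE; apply/bigmax_geP; right.
by exists (ord0, i).
Qed.

Let cube rho : set 'rV[R]_d := [set v | forall i, `[- rho, rho]%classic (v ord0 i)].

Let measurable_cube rho : measurable (cube rho).
Proof.
rewrite [X in measurable X](_ : _ = \bigcap_(i in [set: 'I_d])
    ((fun v : 'rV[R]_d => v ord0 i) @^-1` `[- rho, rho]%classic)).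
  apply: fin_bigcap_measurable => [|i _]; first exact: finite_finset.
  by rewrite -[X in measurable X]setTI; exact: measurable_rV_coord.
by apply/seteqP; split=> [v vA i _|v vA i]; exact: vA.
Qed.

Let cube_norm rho y : `|y| <= rho -> cube rho y.
Proof.
move=> yr i; rewrite /= in_itv/= -ler_norml.
exact: le_trans (ler_norm_coord y i) yr.
Qed.

(** A ball of the maximum norm lies in a cube, whose measure is a finite product of interval
    lengths. *)
Lemma bounded_support_integral_lty f K rho : bounded_borel K f ->
  (forall y, rho < `|y| -> f y = 0) -> (\int[lebesgue_rV d]_y (f y)%:E < +oo)%E.
Proof.
move=> fK f0; have K0 := bounded_borel_bound fK.
have mc := measurable_cube rho.
have lc : (lebesgue_rV d (cube rho) < +oo)%E.
  rewrite (@lebesgue_rV_box R d (fun=> `[- rho, rho]%classic)); last first.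
    by move=> i; exact: measurable_itv.
  set Q := (X in (X < _)%E); suff [] : (Q < +oo)%E /\ (0 <= Q)%E by [].
  apply: (big_ind (fun e : \bar R => (e < +oo)%E /\ (0 <= e)%E)) => [|a b [a1 a0] [b1 b0]|i _].
  - by rewrite ltry lee_fin ler01.
  - by rewrite mule_ge0// lte_mul_pinfty// ge0_fin_numE.
  - by rewrite measure_ge0 lebesgue_measure_itv; case: ifP; rewrite ltry.
apply: (@le_lt_trans _ _ (\int[lebesgue_rV d]_y (K * \1_(cube rho) y)%:E)%E).
  apply: ge0_le_integral_EFin => //.
  - exact: fK.1.
  - by apply: measurable_funM; [exact: measurable_cst|exact: measurable_indic].
  - exact: bounded_borel_ge0 fK.
  - move=> y _; have [yr|yr] := leP `|y| rho.
      rewrite indicE mem_set ?mulr1 ?(bounded_borel_le fK)//.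
      exact: cube_norm.
    by rewrite f0// mulr_ge0// indicE.
rewrite ge0_integralZ_EFin// integral_indic// setIT.
by rewrite lte_mul_pinfty// ?lee_fin// ltry.
Qed.

Lemma bounded_support_integralE f K rho : bounded_borel K f ->
  (forall y, rho < `|y| -> f y = 0) ->
  (\int[lebesgue_rV d]_y (f y)%:E = (fine (\int[lebesgue_rV d]_y (f y)%:E))%:E)%E.
Proof.
move=> fK fsupp; rewrite fineK// ge0_fin_numE.
  exact: bounded_support_integral_lty fK fsupp.
by apply: integral_ge0 => y _; rewrite lee_fin (bounded_borel_ge0 fK).
Qed.

(** Removing the normalising constant leaves the kernel [gauss_exp r], which is at most one and
    increases with [r]; this is the source of the monotonicity and of the bound by the integral. *)
Definition gauss_average r f y := (2 * pi * r) `^ (d%:R / 2) * heat r f y.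

Lemma gauss_averageE r f y K : 0 < r -> bounded_borel K f ->
  (gauss_average r f y)%:E = (\int[lebesgue_rV d]_z (gauss_exp r y z * f z)%:E)%E.
Proof.
move=> r0 fK; have p0 : 0 < 2 * pi * r by rewrite !mulr_gt0// pi_gt0.
rewrite /gauss_average EFinM (heatE y r0 fK) -ge0_integralZ_EFin//.
- apply: eq_integral => z _; congr EFin; rewrite heat_kernelE !mulrA.
  by rewrite -powRD ?subrr ?powRr0 ?mul1r// (gt_eqF p0) implybT.
- by apply: measurable_funM; [exact: measurable_heat_kernelr|exact: fK.1].
- by move=> z; rewrite mulr_ge0 ?heat_kernel_ge0// (bounded_borel_ge0 fK).
- exact: powR_ge0.
Qed.

Lemma gauss_exp_ge0 r y z : 0 <= gauss_exp r y z.
Proof. exact: expR_ge0. Qed.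

Lemma le_gauss_exp r s y z : 0 < r -> r <= s -> gauss_exp r y z <= gauss_exp s y z.
Proof.
move=> r0 rs; rewrite ler_expR !mulNr lerN2 ler_wpM2l//.
  by apply: sumr_ge0 => i _; exact: sqr_ge0.
by rewrite lef_pV2 ?posrE ?mulr_gt0// ?(lt_le_trans r0)// ler_pM2l.
Qed.

Let measurable_gauss_expM r f y K : bounded_borel K f ->
  measurable_fun setT (fun z => gauss_exp r y z * f z).
Proof.
by move=> fK; apply: measurable_funM; [exact: measurable_gauss_expr|exact: fK.1].
Qed.

Lemma le_gauss_average r s f y K : 0 < r -> r <= s -> bounded_borel K f ->
  gauss_average r f y <= gauss_average s f y.
Proof.
move=> r0 rs fK; have s0 := lt_le_trans r0 rs.
rewrite -lee_fin (gauss_averageE y r0 fK) (gauss_averageE y s0 fK).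
apply: ge0_le_integral_EFin => //.
- exact: measurable_gauss_expM fK.
- exact: measurable_gauss_expM fK.
- by move=> z; rewrite mulr_ge0 ?gauss_exp_ge0 ?(bounded_borel_ge0 fK).
- by move=> z _; rewrite ler_wpM2r ?(bounded_borel_ge0 fK)// le_gauss_exp.
Qed.

Lemma gauss_average_le r f y K : 0 < r -> bounded_borel K f ->
  ((gauss_average r f y)%:E <= \int[lebesgue_rV d]_z (f z)%:E)%E.
Proof.
move=> r0 fK; rewrite (gauss_averageE y r0 fK); apply: ge0_le_integral_EFin => //.
- exact: measurable_gauss_expM fK.
- exact: fK.1.
- by move=> z; rewrite mulr_ge0 ?gauss_exp_ge0 ?(bounded_borel_ge0 fK).
- move=> z _; rewrite ler_piMl ?(bounded_borel_ge0 fK)//.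
  exact: bounded_borel_le (bounded_borel_gauss_exp y r0) z.
Qed.

Lemma gauss_average_ge0 r f y K : 0 <= r -> bounded_borel K f -> 0 <= gauss_average r f y.
Proof.
by move=> r0 fK; rewrite mulr_ge0 ?powR_ge0// (bounded_borel_ge0 (bounded_borel_heat r0 fK)).
Qed.

(** Uses [expR (- a) >= 1 - a] on the support of [f]; the factor [d] turns the maximum norm into the
    sum of squares. A negative prefactor is treated apart, where the claim is trivial. *)
Lemma gauss_average_ge r f y K rho : 0 < r -> 0 <= rho -> bounded_borel K f ->
  (forall z, rho < `|z| -> f z = 0) ->
  (((1 - d%:R * (`|y| + rho) ^+ 2 / (2 * r)) * fine (\int[lebesgue_rV d]_z (f z)%:E)%E)%:E <=
   (gauss_average r f y)%:E)%E.
Proof.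
move=> r0 rho0 fK f0; have f_ge0 := bounded_borel_ge0 fK.
set c := 1 - _; have [c0|c0] := leP 0 c; last first.
  rewrite lee_fin (@le_trans _ _ 0) ?(gauss_average_ge0 _ (ltW r0) fK)//.
  by rewrite nmulr_rle0// fine_ge0// integral_ge0// => z _; rewrite lee_fin.
rewrite EFinM -(bounded_support_integralE fK f0).
rewrite -ge0_integralZ_EFin//; last exact: fK.1.
rewrite (gauss_averageE y r0 fK); apply: ge0_le_integral_EFin => //.
- by apply: measurable_funM; [exact: measurable_cst|exact: fK.1].
- exact: measurable_gauss_expM fK.
- by move=> z; rewrite mulr_ge0.
- move=> z _; have [zr|zr] := leP `|z| rho; last by rewrite f0// !mulr0.
  rewrite ler_wpM2r//; apply: le_trans (expR_ge1Dx _).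
  rewrite /c mulNr lerD2l lerN2 ler_wpM2r ?invr_ge0 ?mulr_ge0 ?(ltW r0)//.
  have -> : d%:R * (`|y| + rho) ^+ 2 = \sum_(i < d) (`|y| + rho) ^+ 2.
    by rewrite sumr_const card_ord mulr_natl.
  apply: ler_sum => i _.
  rewrite -real_normK ?num_real// lerXn2r ?nnegrE ?addr_ge0//.
  apply: le_trans (ler_normB _ _) _; apply: lerD; first exact: ler_norm_coord.
  exact: le_trans (ler_norm_coord z i) zr.
Qed.

Lemma bounded_borel_gauss_average r f K rho : 0 < r -> bounded_borel K f ->
  (forall y, rho < `|y| -> f y = 0) ->
  bounded_borel (fine (\int[lebesgue_rV d]_y (f y)%:E)%E) (gauss_average r f).
Proof.
move=> r0 fK fsupp; have [h _] := bounded_borelZ (powR_ge0 (2 * pi * r) (d%:R / 2))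
  (bounded_borel_heat (ltW r0) fK).
split=> // y; rewrite (gauss_average_ge0 _ (ltW r0) fK)/= -lee_fin.
by rewrite -(bounded_support_integralE fK fsupp); exact: gauss_average_le r0 fK.
Qed.

End gaussian_averages.

(** * Replacing the Gaussian average by the full integral *)

Section averaged_initial_error.
Context {R : realType} {d : nat} {alpha beta : R}.
Hypotheses (alpha0 : 0 <= alpha) (beta0 : 0 < beta).
Context {dO : measure_display} {Omega : measurableType dO}.
Context {X : R -> Omega -> MF R d} {P : MF R d -> probability Omega R}.
Hypothesis hX : super_brownian_motion alpha beta X P.
Implicit Types (f g : 'rV[R]_d -> R) (K rho r s t : R).
Variable x : 'rV[R]_d.
Let mu : MF R d := \d_x.

Lemma heat_heat s t f K y : 0 <= s -> 0 <= t -> bounded_borel K f ->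
  heat s (heat t f) y = heat (s + t) f y.
Proof.
move=> s0 t0 fK.
have := growth_growth alpha0 (ltW beta0) hX y s0 t0 fK.
rewrite /growth (heatZ y s0 (expR_ge0 _) (bounded_borel_heat t0 fK)).
by rewrite mulrA -expRD -mulrDr => /(mulfI (lt0r_neq0 (expR_gt0 _))).
Qed.

(* The error is nonnegative, so it suffices to sum its means
   [I - (r / n^4)^(d/2) * gauss_average n^4 f x], where [r = n^4 - n]. *)
Lemma sbm_average_error f K rho (I := fine (\int[lebesgue_rV d]_y (f y)%:E)%E) :
  0 <= rho -> bounded_borel K f -> (forall y, rho < `|y| -> f y = 0) ->
  {ae P mu, forall w,
    expR (- beta * n%:R) *
      \int[X n%:R w]_y (I - gauss_average (n%:R ^+ 4 - n%:R) f y) @[n --> \oo] --> 0}.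
Proof.
move=> rho0 fK fsupp.
have f0 := bounded_borel_ge0 fK.
have I0 : 0 <= I by rewrite fine_ge0// integral_ge0// => y _; rewrite lee_fin.
(* The shift by two keeps this time positive, since [n ^+ 4 - n] vanishes at 0 and 1. *)
pose r n : R := n.+2%:R ^+ 4 - n.+2%:R.
have r0 n : 0 < r n.
  by rewrite subr_gt0 -[ltLHS]expr1 ltr_eXn2l// ltr1n.
have gI n : bounded_borel I (gauss_average (r n) f).
  exact: bounded_borel_gauss_average fK fsupp.
pose Z n w := expR (- beta * n.+2%:R) *
  \int[X n.+2%:R w]_y (I - gauss_average (r n) f y).
have gIB n := bounded_borelB (gI n).
suff : {ae P mu, forall w, Z n w @[n --> \oo] --> 0}.
  apply: filterS => w Zw; rewrite -(cvg_shiftn 2).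
  by under eq_fun do rewrite addn2.
pose D := d%:R * (`|x| + rho) ^+ 2.
have D0 : 0 <= D by rewrite mulr_ge0// exprn_ge0// addr_ge0.
apply: (@ae_cvg0 _ _ _ _ _ (I * (d%:R + D))).
- move=> n; apply: measurable_funM; first exact: measurable_cst.
  exact: (measurable_sbm_pairing hX (ler0n R n.+2) (gIB n)).
- by move=> n w; rewrite mulr_ge0 ?expR_ge0// (pairing_ge0 _ (gIB n)).
move=> n; rewrite ge0_integralZ_EFin//; last first.
- by move=> w; exact: pairing_ge0 (gIB n).
- exact: (measurable_sbm_pairing hX (ler0n R n.+2) (gIB n)).
have N0 : 0 <= n.+2%:R :> R by [].
have [-> _] := sbm_moments alpha0 (ltW beta0) hX mu N0 (gIB n).
rewrite (dirac_pairing x (bounded_borel_growth beta N0 (gIB n))) -EFinM lee_fin.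
rewrite /growth mulrA -expRD mulNr addNr expR0 mul1r.
have HE : heat n.+2%:R (fun y => I - gauss_average (r n) f y) x =
    I - heat n.+2%:R (gauss_average (r n) f) x.
  apply/eqP; rewrite eq_sym subr_eq -(heatD x N0 (gIB n) (gI n)); apply/eqP.
  rewrite -[LHS](heat_cst x N0 I0); congr (heat _ _ x).
  by apply/funext => y /=; rewrite subrK.
rewrite {}HE.
have N4 : 0 < n.+2%:R ^+ 4 :> R by rewrite exprn_gt0.
pose q := r n / n.+2%:R ^+ 4.
have q0 : 0 < q by rewrite divr_gt0.
have q1 : q <= 1 by rewrite ler_pdivrMr// mul1r gerBl.
have pi0 : 0 < 2 * pi :> R by rewrite mulr_gt0// pi_gt0.
(* The heat times [n.+2] and [r n] add up to [n.+2 ^+ 4]; only the normalisation still refers to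
   [r n], whence the power of [q]. *)
have -> : heat n.+2%:R (gauss_average (r n) f) x =
    q `^ (d%:R / 2) * gauss_average (n.+2%:R ^+ 4) f x.
  rewrite (heatZ x N0 (powR_ge0 _ _) (bounded_borel_heat (ltW (r0 n)) fK)).
  rewrite (heat_heat x N0 (ltW (r0 n)) fK) addrC subrK mulrA; congr (_ * _).
  rewrite -[RHS]powRM ?(mulr_ge0 (ltW pi0) (ltW N4)) ?(ltW q0)//; congr powR.
  by rewrite mulrCA divfK// gt_eqF.
set a := q `^ _.
have a0 : 0 <= a by exact: powR_ge0.
have a1 : a <= 1.
  by rewrite -[leRHS](powRr0 q); apply: ger_powR; rewrite ?q0// divr_ge0.
have aq : 1 - d%:R * (1 - q) <= a by exact: powR_half_ge.
have := gauss_average_ge x N4 rho0 fK fsupp; rewrite lee_fin -/I.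
set G := gauss_average _ _ _; rewrite -/D => G1.
have n12 : 0 < n.+1%:R ^+ 2 :> R by rewrite exprn_gt0.
(* [1 - q] equals [n.+2 ^- 3] and the support term is of order [n.+2 ^- 4]; both are compared with
   the summable [n.+1 ^- 2] of [ae_cvg0]. *)
have le2 k : (2 <= k)%N -> (n.+2%:R ^+ k)^-1 <= (n.+1%:R ^+ 2)^-1 :> R.
  move=> k2; rewrite lef_pV2 ?posrE ?exprn_gt0//.
  apply: (@le_trans _ _ (n.+2%:R ^+ 2)); first by rewrite lerXn2r ?nnegrE// ler_nat.
  by rewrite ler_eXn2l// ltr1n.
have h1 : 1 - q <= (n.+1%:R ^+ 2)^-1.
  apply: le_trans (le2 3 isT).
  by rewrite /q /r mulrBl divff ?gt_eqF// opprB addrC subrK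
    [_ ^+ 4]exprS invfM mulVKf// le_eqVlt eqxx.
have h2 : D / (2 * n.+2%:R ^+ 4) <= D * (n.+1%:R ^+ 2)^-1.
  rewrite ler_wpM2l// (le_trans _ (le2 4 isT))// lef_pV2 ?posrE ?mulr_gt0//.
  by rewrite ler_peMl ?ltW// ltr1n.
have h3 : a * ((1 - D / (2 * n.+2%:R ^+ 4)) * I) <= a * G by rewrite ler_wpM2l.
have h4 : a * I >= (1 - d%:R * (n.+1%:R ^+ 2)^-1) * I.
  by rewrite ler_wpM2r// (le_trans _ aq)// lerD2l lerN2 ler_wpM2l.
have h5 : a * (D / (2 * n.+2%:R ^+ 4) * I) <= D * (n.+1%:R ^+ 2)^-1 * I.
  rewrite mulrA ler_wpM2r// (le_trans _ h2)// ler_piMl//.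
  by rewrite divr_ge0// mulr_ge0// ltW.
have -> : I * (d%:R + D) / n.+1%:R ^+ 2 =
    d%:R * (n.+1%:R ^+ 2)^-1 * I + D * (n.+1%:R ^+ 2)^-1 * I by ring.
have key (u v z b g i : R) : b * ((1 - u) * i) <= b * g -> (1 - v) * i <= b * i ->
    b * (u * i) <= z * i -> i - b * g <= v * i + z * i.
  by rewrite mulrBl mul1r mulrBr mulrBl mul1r; lra.
exact: key h3 h4 h5.
Qed.

End averaged_initial_error.

(** Here [y] is the rescaled pairing, [b] changes its normalisation, [g] is the averaged pairing at
    time [n], [m] the mass bound on it and [o] the limit. Since [b >= 1/2], [y] is at most
    [2 * (m + (e + u))], so replacing [b * y] by [y] costs at most [z] times that. *)
Lemma ler_dist_rescaled (R : realFieldType) (b z y g m e u v o : R) :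
  0 <= y -> b <= 1 -> 1 - z <= b -> z <= 2^-1 ->
  `|b * y - g| <= u -> g <= m -> m - e <= g -> `|o - m| = v ->
  `|o - y| <= e + u + v + z * (2 * (m + (e + u))).
Proof.
move=> y0 b1 zb z2 /ler_normlP[u1 u2] gm mg <-.
have z0 : 0 <= z by lra.
have yb : 2^-1 * y <= b * y by rewrite ler_wpM2r//; lra.
have : (1 - b) * y <= z * (2 * (m + (e + u))) by rewrite ler_pM//; lra.
have : b * y <= y by rewrite ler_piMl.
rewrite mulrBl mul1r => h7 h8.
have := ler_norm (o - m); have := ler_norm (- (o - m)); rewrite normrN => h9 h10.
by apply/ler_normlP; split; lra.
Qed.

(** * The local limit for Lipschitz functions of bounded support *)

Section local_limit.
Context {R : realType} {d : nat} {alpha beta : R}.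
Hypotheses (alpha0 : 0 <= alpha) (beta0 : 0 < beta).
Context {dO : measure_display} {Omega : measurableType dO}.
Context {X : R -> Omega -> MF R d} {P : MF R d -> probability Omega R}.
Hypothesis hX : super_brownian_motion alpha beta X P.
Implicit Types (f g : 'rV[R]_d -> R) (K L rho r s t T : R).
Local Notation mass := (@mass R d beta dO Omega X).
Variable x : 'rV[R]_d.
Let mu : MF R d := \d_x.

Lemma cvg_of_quartic_blocks (F : R -> R) (l : R) (c : nat -> R) :
  c n @[n --> \oo] --> 0 ->
  (\forall n \near \oo, forall t, n%:R ^+ 4 <= t -> t < n.+1%:R ^+ 4 ->
    `|l - F t| <= c n) ->
  F t @[t --> +oo] --> l.
Proof.
move=> c0 [N1 _ FN]; apply/cvgrPdist_le => e e0.
have /cvgrPdist_le /(_ _ e0) [N2 _ cN] := c0.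
exists ((maxn N1 N2)%:R ^+ 4); split; first exact: num_real.
move=> t tM; have t0 : 0 <= t by rewrite (le_trans _ (ltW tM))// exprn_ge0.
pose n := Num.truncn (Num.sqrt (Num.sqrt t)).
have ss0 : 0 <= Num.sqrt (Num.sqrt t) by exact: sqrtr_ge0.
have ssE : Num.sqrt (Num.sqrt t) ^+ 4 = t.
  by rewrite (exprM _ 2 2) !sqr_sqrtr ?sqrtr_ge0.
have /andP[nt tn] := truncn_itv ss0.
have {}nt : n%:R ^+ 4 <= t by rewrite -ssE lerXn2r ?nnegrE.
have {}tn : t < n.+1%:R ^+ 4 by rewrite -ssE ltrXn2r ?nnegrE.
have : (maxn N1 N2 < n.+1)%N.
  by rewrite -(ltr_nat R) -(@ltr_pXn2r _ 4) ?nnegrE// (lt_trans tM).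
rewrite ltnS geq_max => /andP[n1 n2].
apply: le_trans (FN n n1 t nt tn) _; apply: le_trans (ler_norm _) _.
by have := cN n n2; rewrite sub0r normrN.
Qed.

Lemma powR_quartic (a : R) : 0 <= a -> (a ^+ 4) `^ (d%:R / 2) = a ^+ (2 * d).
Proof.
move=> a0; rewrite -powR_mulrn// -powRrM -powR_mulrn//; congr powR.
by rewrite natrM; field.
Qed.

(** [W] is quantified inside the almost sure event, so the null set does not depend on the limit of
    the mass. *)
Lemma sbm_local_limit f K L rho (I := fine (\int[lebesgue_rV d]_y (f y)%:E)%E) :
  0 <= L -> 0 <= rho -> bounded_borel K f ->
  (forall y z, `|f y - f z| <= L * `|y - z|) ->
  (forall y, rho < `|y| -> f y = 0) ->
  {ae P mu, forall w (W : R), mass t w @[t --> +oo] --> W ->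
    (2 * pi * t) `^ (d%:R / 2) * (expR (- beta * t) * \int[X t w]_y f y)
      @[t --> +oo] --> I * W}.
Proof.
move=> L0 rho0 fK fL fsupp; have K0 := bounded_borel_bound fK.
have I0 : 0 <= I.
  by rewrite fine_ge0// integral_ge0// => y _; rewrite lee_fin (bounded_borel_ge0 fK).
(* On a block the normalisation is of order [n.+1 ^+ (2 * d)]; the choice [p = 2 * d + 1] leaves one
   factor [n.+1 ^- 1]. *)
have block := sbm_block_approximation alpha0 beta0 hX x (2 * d).+1 L0 fK fL.
have error := sbm_average_error alpha0 beta0 hX x rho0 fK fsupp.
apply: filterS2 block error => w block error W massW.
set err := (fun n : nat => expR (- beta * n%:R) * _) in error.
have massn : mass n%:R w @[n --> \oo] --> W by exact: (cvg_comp _ _ (@cvgr_idn R) massW).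
pose C : R := (2 * pi) `^ (d%:R / 2) * (1 + (L + 4 * K * d%:R) * (W + 1)).
pose eps (n : nat) : R := err n + C * n.+1%:R^-1.
have eps0 : eps n @[n --> \oo] --> 0.
  rewrite -[X in _ --> X](_ : 0 + C * 0 = 0); last by rewrite mulr0 addr0.
  by apply: cvgD => //; apply: cvgM; [exact: cvg_cst|exact: cvg_harmonic].
(* The three terms account for averaging together with path fluctuation, for the mass at time [n]
   against its limit, and for the change of normalisation from [t] to [s]. *)
pose c (n : nat) : R := eps n + I * `|W - mass n%:R w| +
  2 * d%:R * n.+1%:R^-1 * (2 * (I * mass n%:R w + eps n)).
have c0 : c n @[n --> \oo] --> 0.
  rewrite -[X in _ --> X](_ : 0 + I * `|W - W| + 2 * d%:R * 0 * (2 * (I * W + 0)) = 0); last first.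
    by rewrite subrr normr0 !mulr0 mul0r !addr0.
  apply: cvgD.
    apply: cvgD => //; apply: cvgM; first exact: cvg_cst.
    by apply: cvg_norm; apply: cvgB => //; exact: cvg_cst.
  apply: cvgM; first by apply: cvgM; [exact: cvg_cst|exact: cvg_harmonic].
  apply: cvgM; first exact: cvg_cst.
  by apply: cvgD => //; apply: cvgM => //; exact: cvg_cst.
apply: cvg_of_quartic_blocks c0 _.
have [M [_ massM]] : \forall t \near +oo, mass t w <= W + 1.
  by apply: (cvgr_le W) => //; rewrite ltrDl.
pose N := (Num.truncn `|M|).+1.
near=> n => t nt tn.
have n2 : (1 < n)%N by near: n; exists 2%N.
have n0 : (0 < n)%N by exact: ltnW.
have nN : (N <= n)%N by near: n; exists N.
have nd : (4 * d <= n)%N by near: n; exists (4 * d)%N.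
have n0R : 0 < n%:R :> R by rewrite ltr0n.
have ltn : n%:R <= n%:R ^+ 4 :> R by rewrite ler_eXnr// ler1n.
have t0 : 0 < t by rewrite (lt_le_trans n0R)// (le_trans ltn).
have mt : mass t w <= W + 1.
  apply: massM; rewrite (le_lt_trans (ler_norm _))//.
  rewrite (lt_le_trans (truncnS_gt _))// (le_trans _ (le_trans ltn nt))//.
  by rewrite ler_nat.
have [T [tT T1 bound]] : exists T : R, [/\ t < T, T <= t + 1 &
      `|expR (- beta * t) * \int[X t w]_y f y -
        expR (- beta * n%:R) * \int[X n%:R w]_y heat (T - n%:R) f y| <=
      (n.+1%:R ^+ (2 * d).+1)^-1 * (1 + (L + 4 * K * d%:R) * mass t w)].
  by move: t nt tn {t0 mt}; near: n.
pose s : R := T - n%:R.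
have rn : n%:R ^+ 4 - n%:R < s by rewrite ltrD2r (le_lt_trans nt).
have rn0 : 0 < n%:R ^+ 4 - n%:R :> R.
  by rewrite subr_gt0 -[ltLHS]expr1 ltr_eXn2l// ltr1n.
have s0 : 0 < s by exact: lt_trans rn.
have st : s <= t.
  by rewrite lerBlDr (le_trans T1)// lerD2l ler1n.
have pi0 : 0 < 2 * pi :> R by rewrite mulr_gt0// pi_gt0.
set Y := (2 * pi * t) `^ _ * _.
have q0 : 0 < s / t by rewrite divr_gt0.
have q1 : s / t <= 1 by rewrite ler_pdivrMr// mul1r.
pose a := (s / t) `^ (d%:R / 2).
have aY : a * Y = (2 * pi * s) `^ (d%:R / 2) * (expR (- beta * t) * \int[X t w]_y f y).
  rewrite [LHS]mulrA; congr (_ * _).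
  rewrite -[LHS]powRM ?(ltW q0) ?(mulr_ge0 (ltW pi0) (ltW t0))//; congr powR.
  by rewrite mulrCA divfK// gt_eqF.
pose G := expR (- beta * n%:R) * \int[X n%:R w]_y gauss_average s f y.
have sfK := bounded_borel_heat (ltW s0) fK.
have GE : G = (2 * pi * s) `^ (d%:R / 2) *
    (expR (- beta * n%:R) * \int[X n%:R w]_y heat s f y).
  by rewrite /G (pairingZ _ _ sfK) mulrCA.
have h1 : `|a * Y - G| <= C * n.+1%:R^-1.
  rewrite aY GE -mulrBr normrM ger0_norm ?powR_ge0//.
  have p1 : (2 * pi * s) `^ (d%:R / 2) <= (2 * pi) `^ (d%:R / 2) * n.+1%:R ^+ (2 * d).
    rewrite -powR_quartic// -powRM ?(ltW pi0)//; apply: ge0_ler_powR.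
    - by rewrite divr_ge0.
    - by rewrite nnegrE mulr_ge0 ?ltW.
    - by rewrite nnegrE mulr_ge0 ?ltW// exprn_gt0.
    - by rewrite ler_pM2l// (le_trans st)// ltW.
  apply: le_trans (ler_pM _ _ p1 bound) _ => //; first exact: powR_ge0.
  have cancel (A b z m : R) : b != 0 -> z != 0 -> A * b * ((z * b)^-1 * m) = A * m / z.
    by move=> b0 z0; field; rewrite ?b0 ?z0.
  rewrite exprS cancel ?expf_neq0// ler_wpM2r// ler_wpM2l ?powR_ge0// lerD2l.
  by rewrite ler_wpM2l// addr_ge0// !mulr_ge0.
have gn := bounded_borel_gauss_average rn0 fK fsupp.
have gs := bounded_borel_gauss_average s0 fK fsupp.
have h2 : G <= I * mass n%:R w.
  rewrite /mass mulrCA ler_wpM2l ?expR_ge0// -pairing_cst.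
  exact: (le_pairing _ gs (bounded_borel_cst I0) (bounded_borel_le gs)).
(* Monotonicity of [gauss_average] in its time lets the single error at time [n ^+ 4 - n] control
   every [s] of the block. *)
have h3 : I * mass n%:R w - err n <= G.
  rewrite /mass mulrCA /err -mulrBr ler_wpM2l ?expR_ge0//.
  rewrite (pairingB _ (bounded_borel_cst I0) gn) -pairing_cst subKr.
  by apply: (le_pairing _ gn gs) => y; exact: le_gauss_average (ltW rn) fK.
have Y0 : 0 <= Y.
  by rewrite !mulr_ge0 ?powR_ge0 ?expR_ge0// (pairing_ge0 _ fK).
have a1 : a <= 1.
  by rewrite -[leRHS](powRr0 (s / t)); apply: ger_powR; rewrite ?q0// divr_ge0.
(* As [t < T], the difference [t - s] is below [n], whereas [t >= n ^+ 4]; hence [1 - s / t] is at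
   most [2 / n.+1]. *)
have h4 : 1 - 2 * d%:R * n.+1%:R^-1 <= a.
  apply: le_trans (powR_half_ge q0 q1); rewrite lerD2l lerN2 [leRHS]mulrAC [leLHS]mulrC.
  rewrite ler_wpM2r// -[X in X - _](divff (lt0r_neq0 t0)) -mulrBl ler_pdivrMr//.
  apply: (@le_trans _ _ n%:R); first by rewrite /s; move: tT; lra.
  rewrite mulrAC ler_pdivlMr// (le_trans _ (ler_wpM2l (ler0n R 2) nt))//.
  apply: (@le_trans _ _ (2 * n%:R ^+ 2)); last by rewrite ler_wpM2l// ler_eXn2l// ltr1n.
  have : 1 <= n%:R :> R by rewrite ler1n.
  by rewrite -natr1; nra.
have h5 : 2 * d%:R * n.+1%:R^-1 <= 2^-1 :> R.
  rewrite ler_pdivrMr//.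
  have : (4 * d)%:R <= n%:R :> R by rewrite ler_nat.
  by rewrite natrM -natr1; lra.
have h6 : `|I * W - I * mass n%:R w| = I * `|W - mass n%:R w|.
  by rewrite -mulrBr normrM ger0_norm.
exact: ler_dist_rescaled Y0 a1 h4 h5 h1 h2 h3 h6.
Unshelve. all: by end_near.
Qed.

End local_limit.

Lemma cvg_of_sandwich (R : realType) T (F : set_system T) {FF : Filter F}
    (lo up : nat -> T -> R) (a b : nat -> R) (g : T -> R) (l : R) :
  (forall k, lo k t @[t --> F] --> a k) -> (forall k, up k t @[t --> F] --> b k) ->
  a k @[k --> \oo] --> l -> b k @[k --> \oo] --> l ->
  (forall k, \forall t \near F, lo k t <= g t <= up k t) ->
  g t @[t --> F] --> l.
Proof.
move=> loa upb al bl gE; apply/cvgrPdist_le => e e0.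
have e20 : 0 < e / 2 by rewrite divr_gt0.
have /cvgrPdist_le /(_ _ e20) [N1 _ aN] := al.
have /cvgrPdist_le /(_ _ e20) [N2 _ bN] := bl.
pose k := maxn N1 N2.
have := aN k (leq_maxl _ _); have := bN k (leq_maxr _ _).
move=> /ler_normlP[b1 b2] /ler_normlP[a1 a2].
have /cvgrPdist_le /(_ _ e20) lok := loa k.
have /cvgrPdist_le /(_ _ e20) upk := upb k.
apply: filterS3 lok upk (gE k) => t /ler_normlP[l1 l2] /ler_normlP[u1 u2] /andP[g1 g2].
by apply/ler_normlP; split; lra.
Qed.

(** * Bounded sets with null boundary *)

Section bounded_sets.
Context {R : realType} {d : nat}.
Implicit Types (f g h : 'rV[R]_d -> R) (B U : set 'rV[R]_d) (rho : R).

Lemma cvg_integral_bounded_support (g : nat -> 'rV[R]_d -> R) h rho :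
  (forall k, bounded_borel 1 (g k)) -> bounded_borel 1 h ->
  (forall k y, rho < `|y| -> g k y = 0) -> (forall y, rho < `|y| -> h y = 0) ->
  (forall y, g k y @[k --> \oo] --> h y) ->
  fine (\int[lebesgue_rV d]_y (g k y)%:E)%E @[k --> \oo] -->
    fine (\int[lebesgue_rV d]_y (h y)%:E)%E.
Proof.
move=> g1 h1 gsupp hsupp gh.
pose A : set 'rV[R]_d := [set y | `|y| <= rho].
have mA : measurable A.
  have mn : measurable_fun [set: 'rV[R]_d] (fun y : 'rV[R]_d => `|y|).
    by apply: continuous_measurable_rV; exact: norm_continuous.
  rewrite (_ : A = setT `&` (fun y : 'rV[R]_d => `|y|) @^-1` `]-oo, rho]%classic).
    by apply: mn => //; exact: measurable_itv.
  by rewrite setTI; apply/seteqP; split=> y /=; rewrite /A/= in_itv.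
have A1 : bounded_borel 1 (\1_A : 'rV[R]_d -> R) by exact: bounded_borel_indic.
have Asupp y : rho < `|y| -> (\1_A y : R) = 0.
  by move=> yr; rewrite indicE memNset//= /A/=; apply/negP; rewrite -ltNge.
apply: fine_cvg; rewrite -(bounded_support_integralE h1 hsupp).
have [] := @dominated_convergence _ _ _ (lebesgue_rV d) setT measurableT
  (fun k y => (g k y)%:E) (fun y => (h y)%:E) (fun y => (\1_A y)%:E) => //.
- by move=> k; apply/measurable_EFinP; exact: (g1 k).1.
- by apply/measurable_EFinP; exact: h1.1.
- by apply: aeW => y _; apply/cvg_EFin; [exact: nearW|exact: gh].
- apply/integrableP; split; first by apply/measurable_EFinP; exact: A1.1.
  under eq_integral do rewrite /= ger0_norm ?(bounded_borel_ge0 A1)//.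
  exact: bounded_support_integral_lty A1 Asupp.
- apply: aeW => y k _; rewrite abse_EFin lee_fin ger0_norm ?(bounded_borel_ge0 (g1 k))//.
  have [yr|yr] := leP `|y| rho; last by rewrite gsupp// indicE.
  by rewrite indicE mem_set// (bounded_borel_le (g1 k)).
Qed.

Lemma cvg_gauss_average f K rho x : 0 <= rho -> bounded_borel K f ->
  (forall y, rho < `|y| -> f y = 0) ->
  gauss_average t f x @[t --> +oo] --> fine (\int[lebesgue_rV d]_y (f y)%:E)%E.
Proof.
move=> rho0 fK fsupp; set I := fine _.
pose D := d%:R * (`|x| + rho) ^+ 2.
have lo : (1 - D / (2 * t)) * I @[t --> +oo] --> I.
  rewrite -[X in _ --> X](_ : (1 - D / 2 * 0) * I = I); last by rewrite mulr0 subr0 mul1r.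
  apply: cvgM; last exact: cvg_cst.
  apply: cvgB; first exact: cvg_cst.
  under eq_fun do rewrite invfM mulrA.
  apply: cvgM; first exact: cvg_cst.
  by apply/gtr0_cvgV0; [exact: nbhs_pinfty_gt|exact: cvg_id].
apply: (squeeze_cvgr _ lo (cvg_cst I)); near=> t.
have t0 : 0 < t by near: t; exact: nbhs_pinfty_gt.
apply/andP; split.
  by have := gauss_average_ge x t0 rho0 fK fsupp; rewrite lee_fin.
by rewrite -lee_fin -(bounded_support_integralE fK fsupp); exact: gauss_average_le t0 fK.
Unshelve. all: by end_near. Qed.

Lemma indic_integralE B : measurable B ->
  fine (\int[lebesgue_rV d]_y (\1_B y : R)%:E)%E = fine (lebesgue_rV d B).
Proof. by move=> mB; rewrite integral_indic// setIT. Qed.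

Lemma precompact_norm_bounded B : precompact B ->
  exists2 rho : R, 0 <= rho & forall y, closure B y -> `|y| <= rho.
Proof.
rewrite precompactE => /compact_bounded[M [_ MB]].
exists (`|M| + 1); first by rewrite addr_ge0.
by move=> y By; apply: MB => //; rewrite (le_lt_trans (ler_norm M))// ltrDl.
Qed.

Lemma null_boundary_measure B : measurable B ->
  lebesgue_rV d (closure B `\` B°) = 0%E ->
  lebesgue_rV d B° = lebesgue_rV d B /\ lebesgue_rV d (closure B) = lebesgue_rV d B.
Proof.
move=> mB null.
have mI : measurable B° by apply: sub_gen_smallest; exact: open_interior.
have mC : measurable (closure B).
  rewrite -[closure B]setCK; apply: measurableC; apply: sub_gen_smallest.
  by rewrite openC; exact: closed_closure.
have CI : (lebesgue_rV d (closure B) <= lebesgue_rV d B°)%E.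
  rewrite -(setUIDK (closure B) B°) measureU0 ?null//.
  + by apply: le_measure; rewrite ?inE//; exact: measurableI.
  + exact: measurableI.
  + exact: measurableD.
have IB : (lebesgue_rV d B° <= lebesgue_rV d B)%E.
  by apply: le_measure; rewrite ?inE//; exact: interior_subset.
have BC : (lebesgue_rV d B <= lebesgue_rV d (closure B))%E.
  by apply: le_measure; rewrite ?inE//; exact: subset_closure.
split; apply/eqP; rewrite eq_le.
  by rewrite IB (le_trans BC).
by rewrite BC andbT (le_trans CI).
Qed.

End bounded_sets.

(** * Limits of the mass of a bounded set and of its mean *)

Section bounded_set_limit.
Context {R : realType} {d : nat} {alpha beta : R}.
Hypotheses (alpha0 : 0 <= alpha) (beta0 : 0 < beta).
Context {dO : measure_display} {Omega : measurableType dO}.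
Context {X : R -> Omega -> MF R d} {P : MF R d -> probability Omega R}.
Hypothesis hX : super_brownian_motion alpha beta X P.
Implicit Types (f g : 'rV[R]_d -> R) (B : set 'rV[R]_d) (K L rho r s t T : R).
Local Notation mass := (@mass R d beta dO Omega X).
Variable x : 'rV[R]_d.
Let mu : MF R d := \d_x.

(** Bumps from inside the interior and from outside the closure sandwich the indicator; their
    integrals tend to the measures of interior and closure, which agree because the boundary is
    null. *)
Lemma sbm_bounded_set_limit B : measurable B -> precompact B ->
  lebesgue_rV d (closure B `\` B°) = 0%E ->
  {ae P mu, forall w (W : R), mass t w @[t --> +oo] --> W ->
    (2 * pi * t) `^ (d%:R / 2) * (expR (- beta * t) * fine (X t w B))
      @[t --> +oo] --> fine (lebesgue_rV d B) * W}.
Proof.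
move=> mB pB null; have [rho rho0 Brho] := precompact_norm_bounded pB.
have oC : open (~` closure B) by rewrite openC; exact: closed_closure.
have mI : measurable B° by apply: sub_gen_smallest; exact: open_interior.
have mC : measurable (closure B).
  by rewrite -[closure B]setCK; apply: measurableC; exact: sub_gen_smallest.
have [IE CE] := null_boundary_measure mB null.
have rho10 : 0 <= rho + 1 by rewrite addr_ge0.
have rho1 y : rho + 1 < `|y| -> ~ closure B y.
  by move=> yr /Brho; apply/negP; rewrite -ltNge (lt_trans _ yr)// ltrDl.
have rho1I y : rho + 1 < `|y| -> ~ B° y.
  by move=> /rho1 yC /interior_subset /subset_closure.
pose lo (k : nat) : 'rV[R]_d -> R := bump B° k%:R.
(* The slope [k.+1] is at least one, so [up k] vanishes at distance one from [closure B] and all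
   supports fit in the radius [rho + 1]. *)
pose up (k : nat) (y : 'rV[R]_d) : R := 1 - bump (~` closure B) k.+1%:R y.
have lo1 k : bounded_borel 1 (lo k) by exact: bounded_borel_bump.
have up1 k : bounded_borel 1 (up k) by apply: bounded_borelB; exact: bounded_borel_bump.
have loL k y z : `|lo k y - lo k z| <= k%:R * `|y - z| by exact: bump_lipschitz.
have upL k y z : `|up k y - up k z| <= k.+1%:R * `|y - z|.
  have -> : up k y - up k z =
      bump (~` closure B) k.+1%:R z - bump (~` closure B) k.+1%:R y by rewrite /up; ring.
  rewrite distrC.
  exact: bump_lipschitz.
have losupp k y : rho + 1 < `|y| -> lo k y = 0 by move=> /rho1I; exact: bump_out.
have upsupp k y : rho + 1 < `|y| -> up k y = 0.
  move=> yr; rewrite /up bump_in ?subrr// => z /contrapT Cz.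
  apply: (@le_trans _ _ `|y - z|); last by rewrite ler_peMl// ler1n.
  have := Brho _ Cz; have := lerB_dist y z; lra.
have loc : fine (\int[lebesgue_rV d]_y (lo k y)%:E)%E @[k --> \oo] -->
    fine (lebesgue_rV d B).
  rewrite -IE -(indic_integralE mI).
  apply: cvg_integral_bounded_support lo1 (bounded_borel_indic mI) losupp _ _ => y.
    by move=> /rho1I yI; rewrite indicE memNset.
  exact: cvg_bump (open_interior _).
have upc : fine (\int[lebesgue_rV d]_y (up k y)%:E)%E @[k --> \oo] -->
    fine (lebesgue_rV d B).
  rewrite -CE -(indic_integralE mC).
  apply: cvg_integral_bounded_support up1 (bounded_borel_indic mC) upsupp _ _ => y.
    by move=> /rho1 yC; rewrite indicE memNset.
  have -> : (\1_(closure B) y : R) = 1 - \1_(~` closure B) y.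
    by rewrite !indicE in_setC; case: (_ \in _); rewrite /= ?subr0 ?subrr.
  apply: cvgB; first exact: cvg_cst.
  by rewrite (cvg_shiftS (fun k => bump (~` closure B) k%:R y)); exact: cvg_bump.
have lolim k := sbm_local_limit alpha0 beta0 hX x (ler0n R k) rho10 (lo1 k) (loL k) (losupp k).
have uplim k := sbm_local_limit alpha0 beta0 hX x (ler0n R k.+1) rho10 (up1 k) (upL k) (upsupp k).
apply: filterS2 (ae_foralln lolim) (ae_foralln uplim) => w low upw W massW.
apply: (cvg_of_sandwich (fun k => low k W massW) (fun k => upw k W massW)).
- by apply: cvgM loc _; exact: cvg_cst.
- by apply: cvgM upc _; exact: cvg_cst.
move=> k; apply: nearW => t; rewrite -(pairing_indic _ mB).
have B1 := bounded_borel_indic mB.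
rewrite !ler_wpM2l ?powR_ge0 ?expR_ge0//=.
- apply: (le_pairing _ B1 (up1 k)) => y; rewrite indicE.
  have [By|By] := pselect (B y); last by rewrite memNset// (bounded_borel_ge0 (up1 k)).
  rewrite mem_set// /up bump_out ?subr0// => yC.
  by apply: yC; exact: subset_closure.
- apply: (le_pairing _ (lo1 k) B1) => y; rewrite indicE.
  have [By|By] := pselect (B y); first by rewrite mem_set// (bounded_borel_le (lo1 k)).
  by rewrite memNset// /lo bump_out//; apply: contra_not By; exact: interior_subset.
Qed.

(** The first-moment formula holds for bounded Borel functions, so the indicator is used directly:
    the rescaled mean is exactly its [gauss_average] at [x]. *)
Lemma sbm_mean_bounded_set B : measurable B -> precompact B ->
  (2 * pi * t) `^ (d%:R / 2) * (expR (- beta * t) *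
     fine 'E_(P mu)[fun w => fine (X t w B)]%E) @[t --> +oo] -->
  fine (lebesgue_rV d B).
Proof.
move=> mB pB; have [rho rho0 Brho] := precompact_norm_bounded pB.
have B1 := bounded_borel_indic mB.
have Bsupp y : rho < `|y| -> (\1_B y : R) = 0.
  move=> yr; rewrite indicE memNset// => /subset_closure /Brho.
  by apply/negP; rewrite -ltNge.
rewrite -(indic_integralE mB).
apply: cvg_trans (cvg_gauss_average x rho0 B1 Bsupp).
apply: near_eq_cvg; near=> t.
have t0 : 0 <= t by near: t; exact: nbhs_pinfty_ge.
rewrite unlock.
under eq_integral do rewrite -(pairing_indic _ mB).
have [-> _] := sbm_moments alpha0 (ltW beta0) hX mu t0 B1.
rewrite /= (dirac_pairing x (bounded_borel_growth beta t0 B1)) /growth.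
by rewrite /gauss_average [expR _ * (_ * _)]mulrA -expRD mulNr addNr expR0 mul1r.
Unshelve. all: by end_near. Qed.

(** A random variable must be measurable everywhere, so [W] is the upper limit along integer times,
    made real by [fine]; where the mass converges it is the limit along all times. *)
Lemma sbm_mass_limit : exists W : {mfun Omega >-> R},
  {ae P mu, forall w, mass t w @[t --> +oo] --> W w}.
Proof.
pose V w := fine (limn_esup (fun n => (mass n%:R w)%:E)).
have mV : measurable_fun setT V.
  apply: measurableT_comp => //; apply: measurable_fun_limn_esup => n.
  apply/measurable_EFinP; apply: measurable_funM; first exact: measurable_cst.
  exact: (measurable_sbm_pairing hX (ler0n R n) (bounded_borel_cst ler01)).
exists (mfun_Sub (mem_set mV)).
apply: filterS (mass_increments alpha0 beta0 hX x) => w incr.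
have [l massl] := cvg_of_inv_sqr_increments incr.
have massn : mass n%:R w @[n --> \oo] --> l by exact: (cvg_comp _ _ (@cvgr_idn R) massl).
suff -> : mfun_Sub (mem_set mV) w = l by [].
rewrite /= /V; have [_ ->] : (limn_einf (fun n => (mass n%:R w)%:E) = l%:E) *
    (limn_esup (fun n => (mass n%:R w)%:E) = l%:E).
  by apply: cvg_limn_einf_sup; apply/cvg_EFin; [exact: nearW|exact: massn].
by [].
Qed.

End bounded_set_limit.

Theorem corollary3p1 (R : realType) (d : nat) (hd : (1 <= d)%N)
    (alpha beta : R) (halpha : 0 < alpha) (hbeta : 0 < beta)
    (dO : measure_display) (Omega : measurableType dO)
    (X : R -> Omega -> MF R d) (P : MF R d -> probability Omega R)
    (hX : super_brownian_motion alpha beta X P) (x : 'rV[R]_d) :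
  let Px := P (\d_x : {finite_measure set 'rV[R]_d -> \bar R}) in
  exists W : {RV Px >-> R},
    {ae Px, forall w,
       expR (- beta * t) * \int[X t w]_y 1 @[t --> +oo] --> W w} /\
    forall B : set 'rV[R]_d,
      measurable B -> precompact B -> (0 < lebesgue_rV d B)%E ->
      lebesgue_rV d (closure B `\` B°) = 0%E ->
      {ae Px, forall w,
         fine (X t w B) / fine 'E_Px[fun w' => fine (X t w' B)]%E
           @[t --> +oo] --> W w}.
Proof.
move=> Px; have [W massW] := sbm_mass_limit (ltW halpha) hbeta hX x.
exists W; split; first exact: massW.
move=> B mB pB B0 null.
(* [fine] would turn an infinite measure into 0, so finiteness is what makes [b0] positive. *)
have Blty : (lebesgue_rV d B < +oo)%E.
  have [rho rho0 Brho] := precompact_norm_bounded pB.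
  have := @bounded_support_integral_lty _ _ _ _ rho (bounded_borel_indic mB).
  rewrite integral_indic// setIT; apply => y yr.
  rewrite indicE memNset// => /subset_closure /Brho.
  by apply/negP; rewrite -ltNge.
have b0 : 0 < fine (lebesgue_rV d B) by rewrite fine_gt0// B0.
apply: filterS2 massW (sbm_bounded_set_limit (ltW halpha) hbeta hX x mB pB null).
move=> w massWw /(_ _ massWw) Xlim.
have Elim := sbm_mean_bounded_set (ltW halpha) hbeta hX x mB pB.
have WE : fine (lebesgue_rV d B) * W w / fine (lebesgue_rV d B) = W w.
  by rewrite mulrAC divff ?gt_eqF// mul1r.
(* Numerator and mean carry the same factor [(2 * pi * t)^(d/2) * expR (- beta * t)], nonzero for
   [t > 0], which cancels in the quotient. *)
rewrite -[X in _ --> X]WE; apply: cvg_trans (cvgM Xlim (cvgV (lt0r_neq0 b0) Elim)).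
apply: near_eq_cvg; near=> t.
have t0 : 0 < t by near: t; exact: nbhs_pinfty_gt.
have p0 : (2 * pi * t) `^ (d%:R / 2) != 0.
  by rewrite gt_eqF// powR_gt0// !mulr_gt0// pi_gt0.
have cancel (A E a e : R) : A != 0 -> E != 0 -> A * (E * a) / (A * (E * e)) = a / e.
  by move=> A0 E0; rewrite !mulrA -mulf_div divff ?mul1r// mulf_neq0.
exact: cancel p0 (lt0r_neq0 (expR_gt0 _)).
Unshelve. all: by end_near. Qed.
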